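(* Let $d\ge 2$ be a constant and $\phi\ge 1$. The expected length of the longest path in the 2-Opt state graph (a) is $O(n^4\cdot\phi)$ for $\phi$-perturbed Manhattan instances with $n$ points; (b) is $O(n^{4+1/3}\cdot\log(n\phi)\cdot\phi^{8/3})$ for $\phi$-perturbed Euclidean instances with $n$ points.
   Context: A $\phi$-perturbed instance with $n$ points in dimension $d$: vertices $v_1,\ldots,v_n$ are placed independently in $[0,1]^d$, vertex $v_i$ according to a probability density $f_i\colon[0,1]^d\to[0,\phi]$ (different vertices may have different densities). In a Manhattan instance distances are $L_1$ distances; in a Euclidean instance they are $L_2$ distances. A 2-change on a tour selects two tour edges $\{u_1,u_2\}$ and $\{v_1,v_2\}$ with $u_1,u_2,v_1,v_2$ distinct and appearing in this order along the tour, and replaces them by $\{u_1,v_1\}$ and $\{u_2,v_2\}$, provided this strictly decreases the tour length. The state graph has all tours (Hamiltonian cycles) as vertices and an arc from tour $v$ to tour $u$ if $u$ arises from $v$ by one improving 2-change. The $O$-notation hides constants depending on $d$. *)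

(* Defs.v *)
From HB Require Import structures.
From mathcomp Require Import all_boot all_order all_algebra.
From mathcomp Require Import all_classical all_reals all_analysis.

Set Implicit Arguments.
Unset Strict Implicit.
Unset Printing Implicit Defensive.

Import Order.TTheory GRing.Theory Num.Theory.
Import numFieldNormedType.Exports.

Section Tours.
Local Open Scope set_scope.
Variable n : nat.
Implicit Types (s : seq 'I_n) (T : {set {set 'I_n}}).

(* next joins the last vertex of s to its first one. *)
Definition cycle_edges s : {set {set 'I_n}} :=
  [set [set x; next s x] | x in s].

(* s lists all vertices in an order in which T visits them: one such s for each
   start vertex and each of the two directions. *)
Definition traverses s T : bool :=
  [&& uniq s, size s == n & T == cycle_edges s].

(* Hamiltonian cycles of the complete graph, as sets of undirected edges;
   a cycle has at least three vertices. *)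
Definition is_tour T : bool :=
  (2 < n) && [exists s : n.-tuple 'I_n, traverses s T].

Definition tour : finType := {T : {set {set 'I_n}} | is_tour T}.

(* As s is duplicate-free, subseq forces u1, u2, v1, v2 to be distinct, and the
   two edges to be traversed by s from u1 to u2 and from v1 to v2. *)
Definition two_change T T' : bool :=
  [exists s : n.-tuple 'I_n,
    traverses s T &&
    [exists u1, exists u2, exists v1, exists v2,
      [&& subseq [:: u1; u2; v1; v2] s,
          [set u1; u2] \in T, [set v1; v2] \in T &
          T' == (T :\: [set [set u1; u2]; [set v1; v2]])
                  :|: [set [set u1; v1]; [set u2; v2]]]]].

End Tours.

Section StateGraph.
Local Open Scope ring_scope.
Variables (R : realType) (Pt : Type) (dist : Pt -> Pt -> R).
Variables (n : nat) (x : 'I_n -> Pt).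

Definition tour_length (T : {set {set 'I_n}}) : R :=
  \sum_(i < n) \sum_(j < n | (i < j)%N && ([set i; j]%SET \in T))
    dist (x i) (x j).

Definition two_opt_arc : rel (tour n) := fun T T' =>
  two_change (val T) (val T') &&
  (tour_length (val T') < tour_length (val T)).

End StateGraph.

(* The number of arcs of a longest simple directed path of e; a simple path has
   fewer arcs than there are vertices. *)
Definition longest_path (V : finType) (e : rel V) : nat :=
  \max_(k < #|V| | [exists y : V, exists p : k.-tuple V,
                      path e y p && uniq (y :: p)]) k.

Local Open Scope classical_set_scope.
Local Open Scope ring_scope.

Definition dist_L1 (R : realType) (d : nat) (x y : d.-tuple R) : R :=
  \sum_(k < d) `|tnth x k - tnth y k|.

Definition dist_L2 (R : realType) (d : nat) (x y : d.-tuple R) : R :=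
  Num.sqrt (\sum_(k < d) (tnth x k - tnth y k) ^+ 2).

Section ConsTuple.
Variables (R : realType) (d : nat).

Definition cons_pair (p : R * d.-tuple R) : d.+1.-tuple R :=
  [tuple of p.1 :: p.2].

Lemma measurable_cons_pair : measurable_fun [set: R * d.-tuple R] cons_pair.
Proof. exact: measurable_cons. Qed.

Definition uncons_tuple (t : d.+1.-tuple R) : R * d.-tuple R :=
  (thead t, [tuple of behead t]).

Lemma measurable_uncons_tuple :
  measurable_fun [set: d.+1.-tuple R] uncons_tuple.
Proof.
apply/measurable_fun_pair; first exact: (@measurable_tnth _ _ d.+1 ord0).
exact: measurable_behead.
Qed.

Lemma cons_pairK : cancel cons_pair uncons_tuple.
Proof. by move=> [a t]; congr pair; apply: val_inj. Qed.

Lemma uncons_tupleK : cancel uncons_tuple cons_pair.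
Proof. by move=> t; rewrite /cons_pair [RHS]tuple_eta; apply: val_inj. Qed.

End ConsTuple.

Section ConsMeasure.
Local Open Scope ereal_scope.
Variables (R : realType) (d : nat).
Variable mu : {sigma_finite_measure set (d.-tuple R) -> \bar R}.

(* The image of lebesgue_measure \x mu under R * R^d ~ R^(d+1). *)
Definition cons_measure : set (d.+1.-tuple R) -> \bar R :=
  pushforward (lebesgue_measure \x mu) (@cons_pair R d).

Let mcons := @measurable_cons_pair R d.

Let cons_measure0 : cons_measure set0 = 0.
Proof. exact: measure0. Qed.

Let cons_measure_ge0 A : 0 <= cons_measure A.
Proof. exact: measure_ge0. Qed.

Let cons_measure_sigma_additive : semi_sigma_additive cons_measure.
Proof.
move=> F mF tF mUF; rewrite /cons_measure /pushforward preimage_bigcup.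
apply: measure_semi_sigma_additive.
- by move=> n; rewrite -[X in measurable X]setTI; exact: mcons.
- apply/trivIsetP => /= i j _ _ ij; rewrite -preimage_setI.
  by move/trivIsetP : tF => /(_ _ _ _ _ ij) ->//; rewrite preimage_set0.
- by rewrite -preimage_bigcup -[X in measurable X]setTI; exact: mcons.
Qed.

HB.instance Definition _ := isMeasure.Build _ _ _ cons_measure
  cons_measure0 cons_measure_ge0 cons_measure_sigma_additive.

Let cons_measure_sigma_finite : sigma_finite setT cons_measure.
Proof.
have /sigma_finiteP[F [FT ndF Foo]] :=
  sigma_finiteT (@lebesgue_measure R).
have /sigma_finiteP[G [GT ndG Goo]] := sigma_finiteT mu.
exists (fun k => @uncons_tuple R d @^-1` (F k `*` G k)).
  rewrite -preimage_bigcup (_ : \bigcup_k (F k `*` G k) = setT).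
    by rewrite preimage_setT.
  apply/seteqP; split => // -[x y] _.
  have [i _ Fx] : (\bigcup_k F k) x by rewrite -FT.
  have [j _ Gy] : (\bigcup_k G k) y by rewrite -GT.
  exists (maxn i j) => //; split.
    by move: x Fx; exact/subsetPset/ndF/leq_maxl.
  by move: y Gy; exact/subsetPset/ndG/leq_maxr.
move=> k; have [mF Fk] := Foo k; have [mG Gk] := Goo k; split.
  rewrite -[X in measurable X]setTI; apply: measurable_uncons_tuple => //.
  exact: measurableX.
rewrite /cons_measure /pushforward -comp_preimage.
rewrite (_ : _ \o _ = idfun); last by apply/funext => p; exact: cons_pairK.
rewrite preimage_id.
by rewrite product_measure1E// lte_mul_pinfty// ge0_fin_numE.
Qed.

HB.instance Definition _ := Measure_isSigmaFinite.Build _ _ _ cons_measure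
  cons_measure_sigma_finite.

End ConsMeasure.

Fixpoint lebesgue_tuple (R : realType) (d : nat) :
    {sigma_finite_measure set (d.-tuple R) -> \bar R} :=
  match d with
  | 0%N => \d_[tuple]
  | d'.+1 => cons_measure (lebesgue_tuple R d')
  end.

Lemma lebesgue_tuple_box (R : realType) (d : nat) (A : 'I_d -> set R) :
  (forall k, measurable (A k)) ->
  lebesgue_tuple R d [set t | forall k, A k (tnth t k)] =
  (\prod_(k < d) lebesgue_measure (A k))%E.
Proof.
elim: d A => [|d IH] A mA /=.
  rewrite big_ord0 /dirac /= indicE mem_set //; by case.
rewrite big_ord_recl -(IH (fun k => A (lift ord0 k)))//.
rewrite /cons_measure /pushforward.
rewrite -product_measure1E//; last 2 first.
- exact: mA.
- rewrite (_ : mkset _ =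
      \bigcap_(k in [set: 'I_d]) ((@tnth d R)^~ k @^-1` A (lift ord0 k))).
    apply: fin_bigcap_measurable => // k _.
    rewrite -[X in measurable X]setTI; exact: measurable_tnth.
  by apply/seteqP; split => t /= h k => [_|]; [exact: h|exact: (h k I)].
- congr (_ _); apply/seteqP; split => [[a t]|[a t]] /=.
    move=> h; split; first exact: (h ord0).
    by move=> k; have := h (lift ord0 k); rewrite tnthS.
  move=> [h0 h] k; case: (unliftP ord0 k) => [j|] ->; last by [].
  by rewrite tnthS; exact: h.
Qed.

Definition unit_cube (R : realType) (d : nat) : set (d.-tuple R) :=
  [set t | forall k, 0 <= tnth t k <= 1].

Section Perturbed.
Local Open Scope ereal_scope.
Variables (R : realType) (d : nat).
Variables (disp : measure_display) (Omega : measurableType disp).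
Variable P : probability Omega R.

Definition mutually_independent (n : nat) (v : 'I_n -> {RV P >-> d.-tuple R}) :=
  forall (J : {set 'I_n}) (A : 'I_n -> set (d.-tuple R)),
    (forall i, measurable (A i)) ->
    P (\bigcap_(i in [set` J]) (v i @^-1` A i)) =
    \prod_(i in J) P (v i @^-1` A i).

(* X lies in the unit cube and has there a density with values in [0, phi]. *)
Definition has_bounded_density (phi : R) (X : {RV P >-> d.-tuple R}) :=
  exists f : d.-tuple R -> R,
    [/\ measurable_fun (@unit_cube R d) f,
        forall t, @unit_cube R d t -> (0 <= f t <= phi)%R &
        forall A, measurable A ->
          distribution P X A =
          \int[lebesgue_tuple R d]_(t in A `&` @unit_cube R d) (f t)%:E].

Definition perturbed_instance (n : nat) (phi : R)
    (v : 'I_n -> {RV P >-> d.-tuple R}) :=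
  mutually_independent v /\ forall i, has_bounded_density phi (v i).

(* The length of a longest path in the 2-Opt state graph of the random
   instance. *)
Definition longest_2opt_path (dist : d.-tuple R -> d.-tuple R -> R) (n : nat)
    (v : 'I_n -> {RV P >-> d.-tuple R}) : Omega -> R :=
  fun w => (longest_path (two_opt_arc dist (fun i => v i w)))%:R%R.

End Perturbed.

(* Main.v *)
(** A path of t steps contains, for t > 4n, two improving 2-changes such that
    the second removes an edge inserted by the first and such that both gains
    are O(n / t): tour lengths are O(n), so most gains are small, and an edge
    inserted by a step is either removed later or among the n edges of the last
    tour.  So a long path forces the event that some linked pair of 2-changes
    has both gains in (0, e] with e = O(n / t).

    Replacing the law of a vertex by the uniform law on the cube costs a factor
    phi per vertex.  For the L1 metric the gains are linear forms of the
    coordinates with integer coefficients once the order of the coordinates is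
    fixed; since the gains are positive, two of these forms can be solved
    successively for two coordinates, which gives probability O(phi^2 e^2) for
    each pair.  For the L2 metric, given the other vertices, the last vertex of
    a 2-change lies within e of a sheet of a hyperboloid; integrating the
    measure of this neighbourhood over the remaining vertices gives
    O(phi^5 e^(15/8)) if the pair involves six vertices and O(phi^4 e^(3/2)) if
    it involves five.  A union bound over the pairs and a dyadic summation of
    the tail of the path length conclude.  Any exponent below 2 could
    replace 15/8, which makes phi^5 e^(15/8) independent of phi at the scale
    e = n^(-10/3) phi^(-8/3) of the second bound. *)

Require Import Defs.
From HB Require Import structures.
From mathcomp Require Import all_boot all_order all_algebra.
From mathcomp Require Import all_classical all_reals all_analysis.
From mathcomp Require Import measurable_realfun.
From mathcomp Require Import zify ring lra.

Set Implicit Arguments.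
Unset Strict Implicit.
Unset Printing Implicit Defensive.

Import Order.TTheory GRing.Theory Num.Theory.
Import numFieldNormedType.Exports.

(** * Linked pairs in long paths *)

(** A single gain in (0, e] has a probability of order e, hence the length a tail of order 1 / t,
    which is not summable. Two linked gains raise the exponent of e above 1. The second change must
    not remove both edges inserted by the first, since both gains would then depend on the same four
    vertices. Such pairs cannot exhaust the path: four vertices carry only three perfect matchings,
    and improving steps strictly shorten them, so two such pairs never follow each other.

    The Euclidean obstacle is that |YA| - |YB| varies slowly near the line AB, where the
    neighbourhood of a sheet becomes thick. The quantity |AB|^2 - (|YA| - |YB|)^2, called the
    defect, measures both effects: it bounds the gradient from below where it is large, and confines
    Y to a thin slab around the line where it is small. With six vertices a singularity |AO|^(-2g)
    remains, where g < 1 is forced by integrability in the plane. With five vertices the two sheets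
    share vertices, the probabilities no longer decouple, and |AB|^(-3/2) remains. One vertex of
    each Euclidean pair keeps its own law, which explains phi^5 and phi^4 for six and five
    vertices. *)

Section ExchangeSequence.
Local Open Scope nat_scope.
Variables (E : finType) (n t : nat).
Variables (T : nat -> {set E}) (rm ad : nat -> {set E}).
Hypothesis card_ad : forall i, i < t -> #|ad i| = 2.
Hypothesis card_rm : forall i, i < t -> #|rm i| = 2.
Hypothesis rm_sub : forall i, i < t -> (rm i \subset T i)%SET.
Hypothesis ad_disj : forall i, i < t -> [disjoint ad i & T i].
Hypothesis T_step : forall i, i < t -> T i.+1 = (T i :\: rm i :|: ad i)%SET.
Hypothesis card_last : #|T t| <= n.

(** An edge may be inserted and removed several times. This pairs the insertion of f at step i with
    the first later removal, so that j and f determine i. *)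
Definition removed_at i f j : bool :=
  [&& i < j, f \in ad i, f \in rm j &
      [forall l : 'I_t, (i < l <= j) ==> (f \in T l)]].

Let rm_gone i f : i < t -> f \in rm i -> f \notin T i.+1.
Proof.
move=> it fi; have fT : f \in T i by exact: (fintype.subsetP (rm_sub it)).
rewrite T_step // !inE fi /= ; apply/negP => fa.
by have /pred0P /(_ f) /= := ad_disj it; rewrite fa fT.
Qed.

Lemma removed_at_inj i i' f j : i < t -> i' < t -> j < t ->
  removed_at i f j -> removed_at i' f j -> i = i'.
Proof.
wlog ii' : i i' / i < i'.
  move=> H it it' jt h h'; have [ii|ii|//] := ltngtP i i'.
    exact: H.
  by apply/esym; apply: H.
move=> it it' jt /and4P[ij fi fj /forallP al] /and4P[i'j fi' _ _].
have := al (Ordinal it'); rewrite /= ii' (ltnW i'j) /= => fT.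
by have /pred0P /(_ f) /= := ad_disj it'; rewrite fi' fT.
Qed.

Definition survives i f := [forall l : 'I_t.+1, (i < l) ==> (f \in T l)].

Lemma survives_or_removed i f : i < t -> f \in ad i ->
  survives i f \/ exists2 j, j < t & removed_at i f j.
Proof.
move=> it fi; case: (boolP (survives i f)) => [sf|nsf]; [by left|right].
move: nsf; rewrite /survives negb_forall => /existsP /= [l0]; rewrite negb_imply => /andP[il0 fl0].
have ex : exists l, (i < l) && (f \notin T l) by exists l0; rewrite il0.
(* The first index l after i at which f is missing exceeds i + 1, because step i inserts f; hence
   step l - 1 removes f. *)
case: (ex_minnP ex) => l /andP[il fl] lmin.
have ll0 : l <= l0 by apply: lmin; rewrite il0.
have l0t := ltn_ord l0.
have li1 : i.+1 < l.
  rewrite ltn_neqAle il andbT; apply/negP => /eqP eil.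
  by move: fl; rewrite -eil T_step // !inE fi orbT.
case: l il fl lmin ll0 li1 => // j _ fj1 lmin jl0 ij.
rewrite ltnS in ij.
have jt : j < t by lia.
have fT l : i < l <= j -> f \in T l.
  move=> /andP[il lj]; apply/negPn/negP => fl.
  by have := lmin l; rewrite il fl => /(_ isT); lia.
exists j => //; apply/and4P; split=> //.
  move: fj1; rewrite T_step // !inE fT ?ij ?leqnn //= andbT negb_or negbK.
  by case/andP.
by apply/forallP => l; apply/implyP => /fT.
Qed.

Hypothesis no_chain : forall i j k, i < j -> j < k -> k < t ->
  ad i = rm j -> ad j = rm k -> False.

Variable big : pred nat.

(** Unless it starts a linked pair of small steps, every step i lies in one of four classes: an edge
    it inserts survives to the end (at most n steps); both its edges are removed together by one
    step (at most t / 2, since [no_chain] keeps the removing step out of this class); it is big; or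
    an edge it inserts is removed by a big step (at most two such i per big step). So t <= n + t / 2
    + 3 |B|, against the hypothesis. *)
Lemma exists_linked_small_steps :
  (n + 3 * #|[set i : 'I_t | big i]%SET|).*2 < t ->
  exists i j, [/\ i < j, j < t, ~~ big i, ~~ big j &
    exists f, [/\ f \in ad i, f \in rm j & ad i != rm j]].
Proof.
move=> tbig; apply: contrapT => nex.
set B := [set i : 'I_t | big i]%SET in tbig.
pose A := [set i : 'I_t | [exists f in ad i, survives i f]]%SET.
pose P2 (i j : 'I_t) := (ad i == rm j) && [forall f in ad i, removed_at i f j].
pose B2 := [set i : 'I_t | [exists j, P2 i j]]%SET.
have cA : #|A| <= n.
  apply: leq_trans card_last.
  pose g (i : 'I_t) := [pick f in ad i | survives i f].
  have gP i : i \in A -> exists2 f, g i = Some f & f \in ad i /\ survives i f.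
    rewrite inE => /existsP[f /andP[fi sf]]; rewrite /g.
    by case: pickP => [f' /andP[? ?]|/(_ f)]; [exists f'|rewrite fi sf].
  have ginj : {in A &, injective g}.
    move=> i i' /gP[f gf [fi sf]] /gP[f' gf' [fi' sf']]; rewrite gf gf' => -[ff'].
    subst f'; apply/val_inj.
    (* An edge inserted at step b is absent just before it, so it cannot have survived from an
       earlier step a. *)
    have key (a b : 'I_t) : f \in ad b -> survives a f -> ~~ (a < b).
      move=> fb sa; apply/negP => ab.
      have bt : b < t.+1 by apply: ltnW; rewrite ltnS.
      have /= := forallP sa (Ordinal bt); rewrite ab /= => fT.
      by have /pred0P /(_ f) /= := ad_disj (ltn_ord b); rewrite fb fT.
    apply/eqP; rewrite eqn_leq; apply/andP; split; rewrite leqNgt; exact: key.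
  rewrite -(card_in_imset ginj) -(card_imset (mem (T t)) (@Some_inj _)).
  apply/subset_leq_card/fintype.subsetP => o /imsetP[i iA ->].
  have [f -> [fi sf]] := gP _ iA.
  apply/imsetP; exists f => //; have /= := forallP sf ord_max.
  by rewrite ltn_ord.
have B2P i : i \in B2 -> exists j, P2 i j by rewrite inE => /existsP.
have cB2 : #|B2|.*2 <= t.
  pose b (i : 'I_t) := odflt i [pick j | P2 i j].
  have bP i : i \in B2 -> P2 i (b i).
    by move=> /B2P[j Pj]; rewrite /b; case: pickP => // /(_ j); rewrite Pj.
  have P2rem (i j : 'I_t) : P2 i j -> exists2 f, f \in rm j & removed_at i f j.
    move=> /andP[/eqP eij /forallP H].
    have /card_gt0P[f fi] : 0 < #|ad i| by rewrite card_ad.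
    by exists f; [rewrite -eij|move: (H f); rewrite fi].
  have binj : {in B2 &, injective b}.
    move=> i i' /bP Pi /bP Pi' eb; apply/val_inj.
    rewrite -eb in Pi'.
    have [f fj rf] := P2rem _ _ Pi.
    apply: (removed_at_inj (ltn_ord i) (ltn_ord i') (ltn_ord (b i)) rf).
    by have /andP[/eqP e /forallP/(_ f)] := Pi'; rewrite e fj.
  have bdisj : [disjoint b @: B2 & B2].
    apply/pred0P => j /=; apply/negP => /andP[/imsetP[i /bP Pi ->] /bP Pj].
    have [f _ /and4P[ij _ _ _]] := P2rem _ _ Pi.
    have [f' _ /and4P[jk _ _ _]] := P2rem _ _ Pj.
    by apply: (@no_chain _ _ _ ij jk) => //; apply/eqP;
      [case/andP: Pi|case/andP: Pj].
  have := bdisj; rewrite -leq_card_setU => /eqP eU.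
  rewrite -addnn -{1}(card_in_imset binj) -eU.
  by apply: leq_trans (max_card _) _; rewrite card_ord.
pose Q j := [set i : 'I_t | [exists f in rm j, removed_at i f j]]%SET.
have cQ (j : 'I_t) : #|Q j| <= 2.
  rewrite -(card_rm (ltn_ord j)).
  pose g (i : 'I_t) := [pick f in rm j | removed_at i f j].
  have gP i : i \in Q j -> exists2 f, g i = Some f & f \in rm j /\ removed_at i f j.
    rewrite inE => /existsP[f /andP[fi sf]]; rewrite /g.
    by case: pickP => [f' /andP[? ?]|/(_ f)]; [exists f'|rewrite fi sf].
  have ginj : {in Q j &, injective g}.
    move=> i i' /gP[f gf [fi sf]] /gP[f' gf' [fi' sf']]; rewrite gf gf' => -[ff'].
    by subst f'; apply/val_inj; exact: (removed_at_inj (ltn_ord i) (ltn_ord i') (ltn_ord j) sf sf').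
  rewrite -(card_in_imset ginj) -(card_imset (mem (rm j)) (@Some_inj _)).
  apply/subset_leq_card/fintype.subsetP => o /imsetP[i iA ->].
  by have [f -> [fi sf]] := gP _ iA; apply/imsetP; exists f.
pose Q' := (\bigcup_(j in B) Q j)%SET.
have cQ' : #|Q'| <= 2 * #|B|.
  rewrite /Q' mulnC -sum_nat_const.
  elim/big_ind2 : _ => [|A1 a A2 b h1 h2|j _]; first by rewrite cards0.
    by apply: leq_trans (leq_add h1 h2); rewrite cardsU leq_subr.
  exact: cQ.
have cover : ([set: 'I_t] \subset A :|: B2 :|: B :|: Q')%SET.
  apply/fintype.subsetP => i _; rewrite !finset.in_setU.
  case: (boolP (i \in A)) => //= iA; case: (boolP (i \in B2)) => //= iB2.
  case: (boolP (i \in B)) => //= iB.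
  have linked (j : 'I_t) f : removed_at i f j -> ad i != rm j -> i \in Q'.
    move=> rf nij; apply/bigcupP; exists j; last first.
      rewrite inE; apply/existsP; exists f; rewrite rf andbT.
      by case/and4P: rf.
    rewrite inE; apply: contrapT => /negP nbj; apply: nex; exists i, j.
    have /and4P[ij fi fj _] := rf.
    split=> //; first by move: iB; rewrite inE.
    by exists f.
  have rem f : f \in ad i -> exists j : 'I_t, removed_at i f j.
    move=> fi; have [sf|[j jt]] := survives_or_removed (ltn_ord i) fi.
      by move: iA; rewrite inE negb_exists => /forallP/(_ f); rewrite fi sf.
    by exists (Ordinal jt).
  have : ~~ [forall j, ~~ P2 i j] = false.
    apply/negbTE; rewrite negbK; apply/forallP => j; apply/negP => Pij.
    by move: iB2; rewrite inE negb_exists => /forallP/(_ j); rewrite Pij.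
  move/negbFE/forallP => nP2.
  have /card_gt0P[f fi] : 0 < #|ad i| by rewrite card_ad.
  have [j rf] := rem _ fi.
  have [eij|] := eqVneq (ad i) (rm j); last exact: linked rf.
  (* If rm j = ad i although i is not in [B2], some f2 of ad i was removed earlier, at a step j2 <
     j, and inserted again. That earlier removal is the linked one: rm j2 = ad i would also remove f
     at j2, while f stays present until j. *)
  have := nP2 j; rewrite negb_and eij eqxx /= negb_forall => /existsP[f2].
  rewrite negb_imply => /andP[f2j nrf2].
  have f2i : f2 \in ad i by rewrite eij.
  have [j2 rf2] := rem _ f2i.
  have /and4P[ij2 _ f2j2 /forallP al2] := rf2.
  have /and4P[ij _ fj /forallP al] := rf.
  have [jj2|j2j] := leqP j j2.
    case/negP: nrf2; apply/and4P; split=> //.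
    apply/forallP => l; apply/implyP => /andP[il lj].
    by have := al2 l; rewrite il (leq_trans lj jj2).
  apply: linked rf2 _; apply/negP => /eqP ei2.
  have := rm_gone (_ : j2 < t) (_ : f \in rm j2); rewrite -ei2 fi.
  have j21t : j2.+1 < t by apply: leq_ltn_trans j2j (ltn_ord j).
  have := al (Ordinal j21t); rewrite /= j2j ltnS (ltnW ij2) /=.
  by move=> -> /(_ (ltn_ord j2) isT).
have := subset_leq_card cover; rewrite cardsT card_ord => ht.
have h1 := (leq_card_setU (A :|: B2 :|: B) Q').1.
have h2 := (leq_card_setU (A :|: B2) B).1.
have h3 := (leq_card_setU A B2).1.
move: (leq_trans ht h1) h2 h3 cA cB2 cQ' tbig; rewrite -!muln2.
lia.
Qed.

End ExchangeSequence.

(** * 2-changes as exchanges of two edges *)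

Section TwoChanges.
Local Open Scope set_scope.
Local Open Scope ring_scope.
Variables (R : realDomainType).

Definition gain (V : Type) (D : V -> V -> R) (a b c e : V) : R :=
  D a b + D c e - D a c - D b e.

Lemma set2_inj (V : finType) (a b c d : V) : [set a; b]%SET = [set c; d]%SET ->
  (a = c /\ b = d) \/ (a = d /\ b = c).
Proof.
move=> e.
have : a \in [set c; d]%SET by rewrite -e set21.
have : b \in [set c; d]%SET by rewrite -e set22.
have : c \in [set a; b]%SET by rewrite e set21.
have : d \in [set a; b]%SET by rewrite e set22.
rewrite !finset.in_set2.
by do 4![case/orP => /eqP ?]; subst; tauto.
Qed.

Variable n : nat.
Implicit Types (T : {set {set 'I_n}}) (s : seq 'I_n).

Lemma next_neq s y : uniq s -> (2 < size s)%N -> y \in s ->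
  next s y != y /\ next s (next s y) != y.
Proof.
move=> us ss ys; have [i p ep] := rot_to ys.
have : uniq (y :: p) by rewrite -ep rot_uniq.
have : (2 < size (y :: p))%N by rewrite -ep size_rot.
rewrite -!(next_rot i us) ep.
case: p {ep} => [|z [|w p]] //= _ /and3P[].
rewrite !inE !negb_or => /and3P[yz yw _] /andP[zw _] _.
by rewrite !eqxx [z == y]eq_sym (negbTE yz) eq_sym yw.
Qed.

Lemma card_tour T : is_tour T -> #|T| = n.
Proof.
case/andP => n2 /existsP[s /and3P[us /eqP ss /eqP ->]].
rewrite /cycle_edges card_in_imset; first by rewrite (card_uniqP us).
move=> x y xs ys /set2_inj[[]//|[xy yx]].
have s2 : (2 < size s)%N by rewrite ss.
by have [_] := next_neq us s2 ys; rewrite -xy -yx eqxx.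
Qed.

Lemma tour_edge T e : is_tour T -> e \in T ->
  exists a b, a != b /\ e = [set a; b]%SET.
Proof.
case/andP => n2 /existsP[s /and3P[us /eqP ss /eqP ->]] /imsetP[x xs ->].
exists x, (next s x); split => //.
have s2 : (2 < size s)%N by rewrite ss.
by have [] := next_neq us s2 xs; rewrite eq_sym.
Qed.

Definition exchange (a b c e : 'I_n) (rm ad : {set {set 'I_n}}) :=
  [/\ uniq [:: a; b; c; e], rm = [set [set a; b]; [set c; e]]%SET &
      ad = [set [set a; c]; [set b; e]]%SET].

(** The same two edge sets admit several labellings by vertices. These two symmetries suffice to
    bring any chosen inserted or removed edge to the front. *)
Lemma exchangeC a b c e rm ad : exchange a b c e rm ad ->
  exchange b a e c rm ad /\ exchange c e a b rm ad.
Proof.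
case; rewrite /= !inE !negb_or => /and4P[/and3P[ab ac ae] /andP[bc be] ce _] -> ->.
split; split => /=.
- by rewrite !inE !negb_or eq_sym ab be bc ae ac eq_sym ce.
- by rewrite (finset.setUC [set b]%SET [set a]%SET) (finset.setUC [set e]%SET [set c]%SET).
- by rewrite (finset.setUC [set [set b; e]]%SET).
- by rewrite !inE !negb_or ce eq_sym ac eq_sym bc eq_sym ae eq_sym be ab.
- by rewrite (finset.setUC [set [set c; e]]%SET).
- by rewrite (finset.setUC [set c]%SET [set a]%SET) (finset.setUC [set e]%SET [set b]%SET).
Qed.

Lemma exchange_ad a b c e rm ad f : exchange a b c e rm ad -> f \in ad ->
  exists a b c e, exchange a b c e rm ad /\ f = [set a; c]%SET.
Proof.
move=> X; have [_ _ e1] := X; rewrite {1}e1 finset.in_set2 => /orP[]/eqP ->.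
  by exists a, b, c, e.
by have [X1 _] := exchangeC X; exists b, a, e, c.
Qed.

Lemma exchange_rm a b c e rm ad f : exchange a b c e rm ad -> f \in rm ->
  exists a b c e, exchange a b c e rm ad /\ f = [set a; b]%SET.
Proof.
move=> X; have [_ e1 _] := X; rewrite {1}e1 finset.in_set2 => /orP[]/eqP ->.
  by exists a, b, c, e.
by have [_ X1] := exchangeC X; exists c, e, a, b.
Qed.

Lemma exchange_card a b c e rm ad : exchange a b c e rm ad ->
  #|rm| = 2%N /\ #|ad| = 2%N.
Proof.
case=> u -> ->; rewrite !cards2; split; congr (S _); apply/eqP; rewrite eqb1;
  apply/eqP => /set2_inj; move: u;
  rewrite /= !inE !negb_or => /and4P[/and3P[ab ac ae] /andP[bc be] ce _];
  move=> [[h1 h2]|[h1 h2]]; subst; by rewrite eqxx in ab ac ae bc be ce.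
Qed.

(** That the inserted edges are new follows by counting: both tours have n edges, so the n - 2 kept
    edges cannot meet the inserted ones, and an inserted edge is never a removed one because the
    four vertices are distinct. *)
Lemma two_changeP T T' : is_tour T -> is_tour T' -> two_change T T' ->
  exists a b c e, exists rm ad, [/\ exchange a b c e rm ad, (rm \subset T)%SET,
    [disjoint ad & T] & T' = (T :\: rm :|: ad)%SET].
Proof.
move=> tT tT' /existsP[s /andP[/and3P[us _ _]]].
case/existsP=> a /existsP[b /existsP[c /existsP[e]]].
case/and4P => ss abT ceT /eqP eT'.
set rm := [set _; _]%SET in eT'; set ad := (X in T' = (_ :|: X)%SET) in eT'.
have X : exchange a b c e rm ad by split=> //; exact: subseq_uniq ss us.
have rmT : rm \subset T.
  by apply/fintype.subsetP => f; rewrite finset.in_set2 => /orP[]/eqP ->.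
exists a, b, c, e, rm, ad; split=> //.
have [crm cad] := exchange_card X.
have cT : #|T :\: rm| = (n - 2)%N.
  by rewrite cardsD (finset.setIidPr rmT) crm (card_tour tT).
have n2 : (2 < n)%N by case/andP: tT.
have dad : [disjoint T :\: rm & ad].
  rewrite -leq_card_setU -eT' (card_tour tT') cT cad; apply/eqP; lia.
have rmad f : f \in rm -> f \notin ad.
  move=> frm; apply/negP => fad; move: frm fad.
  rewrite !finset.in_set2.
  case: X => u _ _ ; move: u.
  rewrite /= !inE !negb_or => /and4P[/and3P[ab ac ae] /andP[bc be] ce _].
  by move=> /orP[]/eqP -> /orP[]/eqP/set2_inj[[h1 h2]|[h1 h2]]; subst; 
    rewrite eqxx in ab ac ae bc be ce.
apply/pred0P => f /=; apply/negP => /andP[fad fT].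
have /pred0P/(_ f)/negbT := dad; rewrite /= negb_and fad orbF finset.in_setD fT andbT negbK.
by move=> /rmad; rewrite fad.
Qed.

End TwoChanges.

(** * Small linked gains forced by a long path *)

Section LinkedGains.
Local Open Scope ring_scope.
Variables (R : realType) (n : nat).

Section Weights.
Variable D : 'I_n -> 'I_n -> R.
Hypothesis D_sym : forall i j, D i j = D j i.

(** The condition i < j lets each two-element set meet exactly one term; all other sets have weight
    0. *)
Definition edge_weight (e : {set 'I_n}) : R :=
  \sum_(i < n) \sum_(j < n | (i < j)%N && (e == [set i; j]%SET)) D i j.

Lemma edge_weight2 a b : a != b -> edge_weight [set a; b]%SET = D a b.
Proof.
wlog ab : a b / (a < b)%N.
  move=> H nab; have [ab|ab|/val_inj ab] := ltngtP a b; first exact: H.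
    by rewrite finset.setUC D_sym H // eq_sym.
  by rewrite ab eqxx in nab.
move=> nab; rewrite /edge_weight (bigD1 a) //= (bigD1 b) /=; last first.
  by rewrite ab eqxx.
rewrite [X in _ + X + _]big1 ?addr0; last first.
  move=> j /andP[/andP[aj /eqP/set2_inj[[_ <-]|[ja ba]]]]; first by rewrite eqxx.
  by rewrite ja ltnn in aj.
rewrite big1 ?addr0 // => i ia; apply: big1 => j.
move=> /andP[ij /eqP/set2_inj[[ai _]|[aj bi]]]; first by rewrite ai eqxx in ia.
by move: ab; rewrite aj bi ltnNge (ltnW ij).
Qed.

Definition set_weight (A : {set {set 'I_n}}) : R := \sum_(e in A) edge_weight e.

Lemma exchange_gain a b c e rm ad : exchange a b c e rm ad ->
  set_weight rm - set_weight ad = gain D a b c e.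
Proof.
move=> X; have [crm cad] := exchange_card X.
case: X crm cad => u -> -> ; move: u.
rewrite /= !inE !negb_or => /and4P[/and3P[ab ac ae] /andP[bc be] ce _].
rewrite !cards2 => -[/eqP]; rewrite eqb1 => n1 [/eqP]; rewrite eqb1 => n2.
rewrite /set_weight !big_setU1 ?inE //= !big_set1 !edge_weight2 //.
by rewrite /gain; lra.
Qed.

End Weights.

Variables (Pt : Type) (dist : Pt -> Pt -> R) (x : 'I_n -> Pt).
Hypothesis dist_sym : forall p q, dist p q = dist q p.
Let D i j := dist (x i) (x j).
Let D_sym i j : D i j = D j i. Proof. exact: dist_sym. Qed.

Lemma tour_lengthE T : tour_length dist x T = set_weight D T.
Proof.
rewrite /tour_length /set_weight /edge_weight exchange_big /=.
apply: eq_bigr => i _.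
rewrite (exchange_big_dep (fun j : 'I_n => (i < j)%N)) /=; last first.
  by move=> e j _ /andP[].
rewrite big_mkcondr /=; apply: eq_bigr => j ij.
case: ifPn => ijT; last first.
  rewrite big_pred0 // => e; apply/negP => /andP[eT /andP[_ /eqP ee]].
  by rewrite -ee eT in ijT.
rewrite (bigD1 [set i; j]%SET) /= ?ijT ?ij ?eqxx // big1 ?addr0 // => e.
move=> /andP[/andP[_ /andP[_ /eqP ->]]]; by rewrite eqxx.
Qed.

Lemma tour_length_le (M : R) T : (forall i j, D i j <= M) -> is_tour T ->
  tour_length dist x T <= n%:R * M.
Proof.
move=> DM tT; rewrite tour_lengthE -(card_tour tT) mulr_natl -sumr_const.
apply: ler_sum => e /(tour_edge tT)[a [b [ab ->]]].
by rewrite edge_weight2.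
Qed.

Lemma set_weight_exchange (T rm ad : {set {set 'I_n}}) : (rm \subset T)%SET -> [disjoint ad & T] ->
  set_weight D (T :\: rm :|: ad)%SET = set_weight D T - (set_weight D rm - set_weight D ad).
Proof.
move=> rT dT; have -> : set_weight D T = set_weight D (T :\: rm)%SET + set_weight D rm.
  rewrite /set_weight [LHS](big_setID rm) /= addrC.
  by rewrite (finset.setIidPr rT).
have -> : set_weight D (T :\: rm :|: ad)%SET = set_weight D (T :\: rm)%SET + set_weight D ad.
  rewrite /set_weight -bigU /=.
    by apply: eq_bigl => e; rewrite finset.in_setU.
  by rewrite disjoint_sym; apply: disjointWr dT; exact: finset.subsetDl.
by lra.
Qed.

(** Four vertices have three perfect matchings, so an exchange that removes the second one, [ad],
    inserts either the first one again or the third. *)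
Lemma matching_exchange (a b c e a' b' c' e' : 'I_n) rm ad rm' ad' :
  exchange a b c e rm ad -> exchange a' b' c' e' rm' ad' -> ad = rm' ->
  ad' = rm \/ ad' = [set [set a; e]; [set b; c]]%SET.
Proof.
move=> [u -> ->] [u' -> ->] /set2_inj.
have C (V : finType) (y z : V) : [set y; z]%SET = [set z; y]%SET by exact: finset.setUC.
case=> -[/set2_inj h1 /set2_inj h2];
  case: h1 => -[? ?]; case: h2 => -[? ?]; subst;
  first [by left | by right | by left; rewrite C | by right; rewrite C
  | by right; rewrite [X in [set _; X]%SET]C
  | by right; rewrite C [X in [set _; X]%SET = _]C
  | by right; rewrite C [X in [set X; _]%SET = _]C
  | by left; rewrite [X in [set _; X]%SET = _]C [X in [set X; _]%SET = _]C
  | by left; rewrite C [X in [set _; X]%SET = _]C [X in [set X; _]%SET = _]C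
  | by right; rewrite [X in [set X; _]%SET = _]C
  | by right; rewrite [X in [set _; X]%SET = _]C].
Qed.

Hypothesis dist_ge0 : forall p q, 0 <= dist p q.

(** The shared edge is {v1, v3}, inserted by the first 2-change and removed by the second. The
    inequality of sets leaves at least one of v5, v6 outside the first 2-change. *)
Definition linked_gains (eps : R) := exists v1 v2 v3 v4 v5 v6 : 'I_n,
  [/\ uniq [:: v1; v2; v3; v4], uniq [:: v1; v3; v5; v6],
      [set v5; v6]%SET != [set v2; v4]%SET,
      0 < gain D v1 v2 v3 v4 <= eps & 0 < gain D v1 v3 v5 v6 <= eps].

Lemma gain_sym a b c e : gain D b a e c = gain D a b c e /\ gain D c e a b = gain D a b c e.
Proof.
by rewrite /gain (D_sym b a) (D_sym e c) (D_sym c a) (D_sym e b); split; lra.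
Qed.

Lemma linked_of_exchange a b c e a' b' c' e' rm ad rm' ad' f eps :
  exchange a b c e rm ad -> exchange a' b' c' e' rm' ad' ->
  f \in ad -> f \in rm' -> ad != rm' ->
  0 < set_weight D rm - set_weight D ad <= eps ->
  0 < set_weight D rm' - set_weight D ad' <= eps -> linked_gains eps.
Proof.
move=> /exchange_ad H /exchange_rm H' /H[{}a [{}b [{}c [{}e [{H} X ->]]]]].
move=> /H'[{}a' [{}b' [{}c' [{}e' [{H'} X' eac]]]]] nadrm.
rewrite (exchange_gain D_sym X) (exchange_gain D_sym X') => g g'.
have [Xb _] := exchangeC X'.
have [ua _ ead] := X.
have [ub erm' _] := X'; have [uc _ _] := Xb.
have := set2_inj eac => -[[? ?]|[? ?]]; subst.
  exists a', b, b', e, c', e'; split => //.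
  by apply: contra nadrm => /eqP ->.
exists b', b, a', e, e', c'; split => //; last by rewrite (gain_sym a' b' c' e').1.
apply: contra nadrm; rewrite finset.setUC => /eqP ->.
by rewrite (finset.setUC [set a']%SET).
Qed.

Lemma longest_path_ge (V : finType) (e : rel V) t : (0 < t)%N ->
  (t <= longest_path e)%N ->
  exists y (p : seq V), path e y p /\ size p = t.
Proof.
move=> t0; rewrite /longest_path => tl.
have [k Pk tk] : exists2 k : 'I_#|V|, [exists y : V, exists p : k.-tuple V,
                      path e y p && uniq (y :: p)] & (t <= k)%N.
  apply: contrapT => nex; move: tl; rewrite leqNgt => /negP; apply.
  elim/big_ind : _ => // [m m' hm hm'|k Pk]; first by rewrite gtn_max hm.
  by rewrite ltnNge; apply/negP => tk; apply: nex; exists k.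
have /existsP[y /existsP[p /andP[yp _]]] := Pk.
exists y, (take t p); split; last by rewrite size_takel // size_tuple.
by move: yp; rewrite -{1}(cat_take_drop t p) cat_path => /andP[].
Qed.

(** The gains along the path sum to at most one tour length, n * M, so at most t / 12 of them exceed
    eps. Together with n < t / 4 this gives 2 (n + 3 |B|) < t, as the counting of linked steps
    requires. *)
Lemma linked_gains_of_path (M eps : R) (t : nat) :
  (forall i j, D i j <= M) -> 0 < eps -> (4 * n < t)%N ->
  12 * n%:R * M <= eps * t%:R ->
  (t <= longest_path (two_opt_arc dist x))%N -> linked_gains eps.
Proof.
move=> DM eps0 nt hM /longest_path_ge [|y [p [yp sp]]]; first by lia.
pose T i := val (nth y (y :: p) i).
have tT i : is_tour (T i) by apply: (valP (nth y (y :: p) i)).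
have /pathP arc := yp.
have step (i : nat) : exists q : ('I_n * 'I_n * 'I_n * 'I_n) *
    ({set {set 'I_n}} * {set {set 'I_n}}), (i < t)%N ->
    [/\ exchange q.1.1.1.1 q.1.1.1.2 q.1.1.2 q.1.2 q.2.1 q.2.2, (q.2.1 \subset T i)%SET,
      [disjoint q.2.2 & T i] & T i.+1 = (T i :\: q.2.1 :|: q.2.2)%SET].
  have [it|it] := ltnP i t; last first.
    have n0 : (0 < n)%N by have /andP[] := tT i; lia.
    by exists (Ordinal n0, Ordinal n0, Ordinal n0, Ordinal n0, (finset.set0, finset.set0)).
  have := arc y i; rewrite sp => /(_ it) /andP[tc _].
  have [a [b [c [e [rm [ad H]]]]]] := two_changeP (tT i) (tT i.+1) tc.
  by exists (a, b, c, e, (rm, ad)).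
have {step} [q qP] := choice step.
pose rm i := (q i).2.1; pose ad i := (q i).2.2.
pose W := set_weight D.
have gainE i : (i < t)%N -> W (T i) - W (T i.+1) = W (rm i) - W (ad i).
  move=> /qP[_ h1 h2 ->]; rewrite /W set_weight_exchange //.
  by rewrite /rm /ad; lra.
have gain0 i : (i < t)%N -> 0 < W (rm i) - W (ad i).
  move=> it; rewrite -gainE // subr_gt0 /W -!tour_lengthE.
  by have := arc y i; rewrite sp => /(_ it) /andP[].
pose big i := eps < W (rm i) - W (ad i).
have cbig : eps * #|[set i : 'I_t | big i]%SET|%:R <= n%:R * M.
  rewrite mulr_natr -sumr_const.
  apply: le_trans (_ : \sum_(i in [set i : 'I_t | big i]%SET) (W (T i) - W (T i.+1)) <= _).
    apply: ler_sum => i; rewrite inE => /ltW; by rewrite gainE.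
  apply: le_trans (_ : \sum_(i < t) (W (T i) - W (T i.+1)) <= _).
    rewrite [leRHS](bigID (mem [set i : 'I_t | big i]%SET)) /= lerDl.
    by apply: sumr_ge0 => i _; rewrite gainE // ltW // gain0.
  rewrite -(big_mkord xpredT (fun i => W (T i) - W (T i.+1))).
  have -> : \sum_(0 <= i < t) (W (T i) - W (T i.+1)) = W (T 0%N) - W (T t).
    rewrite -opprB -(telescope_sumr (fun i => W (T i)) (leq0n t)) -sumrN.
    by apply: eq_bigr => i _; rewrite opprB.
  apply: le_trans (tour_length_le DM (tT 0%N)).
  rewrite tour_lengthE lerBlDr lerDl /W /set_weight.
  by apply: sumr_ge0 => e _; do 2!(apply: sumr_ge0 => ? _); exact: dist_ge0.
have rmad i : (i < t)%N -> [/\ #|rm i| = 2%N, #|ad i| = 2%N,  (rm i \subset T i)%SET,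
    [disjoint ad i & T i] & T i.+1 = (T i :\: rm i :|: ad i)%SET].
  by move=> /qP[X h1 h2 h3]; have [c1 c2] := exchange_card X.
have [i [j [ij jt nbi nbj [f [fi fj ne]]]]] : exists i j, [/\ (i < j)%N, (j < t)%N, ~~ big i, ~~ big j &
    exists f, [/\ f \in ad i, f \in rm j & ad i != rm j]].
  apply: (@exists_linked_small_steps _ n t T rm ad).
  - by move=> i /rmad[].
  - by move=> i /rmad[].
  - by move=> i /rmad[].
  - by move=> i /rmad[].
  - by move=> i /rmad[].
  - by rewrite (card_tour (tT t)).
  (* A chain of three exchanges on the same four vertices would run through four matchings of
     strictly decreasing weight, but only three exist. *)
  - move=> i j k ij jk kt e1 e2.
    have jt := ltn_trans jk kt; have it := ltn_trans ij jt.
    have [Xi _ _ _] := qP i it.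
    have [Xj _ _ _] := qP j jt.
    have [Xk _ _ _] := qP k kt.
    have gi := gain0 i it; have gj := gain0 j jt; have gk := gain0 k kt.
    have [e3|e3] := matching_exchange Xi Xj e1.
      by move: gi gj; rewrite e1 /ad e3 -/(rm i); lra.
    have Xj' : exchange (q i).1.1.1.1 (q i).1.1.2 (q i).1.2 (q i).1.1.1.2 (rm j) (ad j).
      case: Xi e1 e3 => u eri eai e1 e3; split.
      - move: u; rewrite /= !inE !negb_or.
        move=> /and4P[/and3P[ab ac ae] /andP[bc be] ce _].
        by rewrite ac ae ab ce eq_sym bc eq_sym be.
      - by rewrite -e1 /ad eai (finset.setUC [set (q i).1.2]%SET).
      - by rewrite /ad e3 (finset.setUC [set (q i).1.1.1.2]%SET).
    have [e4|e4] := matching_exchange Xj' Xk e2.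
      by move: gj gk; rewrite e2 /ad e4 -/(rm j); lra.
    have e5 : ad k = rm i by rewrite /ad e4; case: Xi.
    move: gi gj gk; rewrite e1 e2 e5; lra.
  - have : 12 * (#|[set i : 'I_t | big i]%SET|%:R : R) <= t%:R.
      by rewrite -(ler_pM2l eps0); apply: le_trans hM; rewrite mulrCA -mulrA ler_wpM2l.
    rewrite -natrM ler_nat -mul2n; lia.
have [Xi _ _ _] := qP i (ltn_trans ij jt).
have [Xj _ _ _] := qP j jt.
apply: (linked_of_exchange Xi Xj fi fj ne).
  by rewrite gain0 ?(ltn_trans ij jt) //= leNgt.
by rewrite gain0 //= leNgt.
Qed.

End LinkedGains.

Local Open Scope classical_set_scope.
Local Open Scope ring_scope.

(** * Resampling single vertices *)

Section Update.
Context d (T : measurableType d) (n : nat).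

Definition upd (t : n.-tuple T) (i : 'I_n) (x : T) : n.-tuple T :=
  [tuple if j == i then x else tnth t j | j < n].

Lemma tnth_upd t i x j : tnth (upd t i x) j = if j == i then x else tnth t j.
Proof. by rewrite tnth_mktuple. Qed.

Lemma upd_same t i x : tnth (upd t i x) i = x.
Proof. by rewrite tnth_upd eqxx. Qed.

Lemma upd_other t i x j : j != i -> tnth (upd t i x) j = tnth t j.
Proof. by rewrite tnth_upd => /negbTE ->. Qed.

Lemma upd_comm t i j x y : i != j ->
  upd (upd t i x) j y = upd (upd t j y) i x.
Proof.
move=> ij; apply: eq_from_tnth => k; rewrite !tnth_upd.
by have [->|//] := eqVneq k i; rewrite (negbTE ij).
Qed.

Lemma measurable_updp i :
  measurable_fun [set: n.-tuple T * T] (fun p => upd p.1 i p.2).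
Proof.
apply/measurable_fun_tnthP => j /=; rewrite /comp.
under eq_fun do rewrite tnth_upd.
have [_|_] := eqVneq j i; first exact: measurable_snd.
exact: (measurableT_comp (measurable_tnth j) measurable_fst).
Qed.

Lemma measurable_upd t i : measurable_fun [set: T] (upd t i).
Proof.
have m2 : measurable_fun [set: T] (fun x : T => (t, x)).
  by apply/measurable_fun_pair; [exact: measurable_cst|exact: measurable_id].
exact: (measurableT_comp (measurable_updp i) m2).
Qed.

Definition box (A : 'I_n -> set T) : set (n.-tuple T) :=
  [set t | forall i, A i (tnth t i)].

Lemma measurable_box A : (forall i, measurable (A i)) -> measurable (box A).
Proof.
move=> mA.
rewrite (_ : box A = \bigcap_(i in [set: 'I_n]) ((@tnth n T)^~ i @^-1` A i)).
  apply: fin_bigcap_measurable => // i _.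
  rewrite -[X in measurable X]setTI; exact: measurable_tnth.
by apply/seteqP; split => t /= h k => [_|]; [exact: h|exact: (h k I)].
Qed.

End Update.

Section BoxUnique.
Local Open Scope ereal_scope.
Context d (T : measurableType d) (R : realType) (n : nat).

(** Boxes are stable under intersection and generate the sigma-algebra of tuples, so they determine
    a finite measure. *)
Lemma box_unique (m1 m2 : {measure set (n.-tuple T) -> \bar R}) :
  m1 setT < +oo ->
  (forall A, (forall i, measurable (A i)) -> m1 (box A) = m2 (box A)) ->
  forall B, measurable B -> m1 B = m2 B.
Proof.
move=> m1oo m12 B mB.
pose G := [set box A | A in [set A : 'I_n -> set T | forall i, measurable (A i)]].
have GT : G setT.
  by exists (fun _ => setT) => //; apply/seteqP; split.
apply: (measure_unique G (fun _ => setT)) => //.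
- apply/seteqP; split; last first.
    apply: smallest_sub; first exact: sigma_algebra_measurable.
    by move=> _ [A mA <-]; exact: measurable_box.
  rewrite /measurable /= /g_sigma_preimage.
  apply: smallest_sub; first exact: smallest_sigma_algebra.
  move=> C; rewrite -bigcup_seq => -[i _ [A mA <-]]; rewrite setTI.
  apply: sub_sigma_algebra.
  exists (fun j => if j == i then A else setT).
    by move=> j /=; case: eqP.
  apply/seteqP; split => t /=; first by move=> /(_ i); rewrite eqxx.
  by move=> At j; case: eqP => [->|].
- move=> _ _ [A mA <-] [A' mA' <-]; exists (fun i => A i `&` A' i).
    by move=> i; apply: measurableI; [exact: mA|exact: mA'].
  by apply/seteqP; split => t /= => [h|[h h'] i]; [split=> i; case: (h i)|split].
- by rewrite bigcup_const.
- by move=> _ [A mA <-]; exact: m12.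
Qed.

End BoxUnique.

Section Resample.
Local Open Scope ereal_scope.
Context d (T : measurableType d) (R : realType) (n : nat).
Variables (m : probability (n.-tuple T) R) (mi : 'I_n -> probability T R).
Hypothesis m_box : forall A, (forall i, measurable (A i)) ->
  m (box A) = \prod_(i < n) mi i (A i).

(** Replacing coordinate i by an independent copy does not change the law on boxes, hence nowhere.
    This is Fubini for one coordinate without an n-fold product measure; it serves for the vertices
    of an instance as well as for the coordinates of a point. *)
Lemma resample (f : n.-tuple T -> \bar R) i :
  measurable_fun [set: n.-tuple T] f -> (forall t, 0 <= f t) ->
  \int[m]_t f t = \int[m]_t \int[mi i]_x f (upd t i x).
Proof.
move=> mf f0.
pose u (p : n.-tuple T * T) := upd p.1 i p.2.
have mu : measurable_fun [set: n.-tuple T * T] u := measurable_updp i.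
have mfu : measurable_fun [set: n.-tuple T * T] (f \o u) by exact: measurableT_comp.
transitivity (\int[pushforward (m \x mi i) u]_t f t); last first.
  rewrite ge0_integral_pushforward //= preimage_setT.
  by rewrite fubini_tonelli1.
apply: eq_measure_integral => B mB _.
apply: (@box_unique _ T R n m (pushforward (m \x mi i) u)) => //.
  exact: (eq_ind_r (fun z => z < +oo) (ltry 1) (probability_setT m)).
move=> A mA; rewrite /pushforward.
have e : u @^-1` box A =
    box (fun j => if j == i then setT else A j) `*` A i.
  apply/seteqP; split => -[t x] /=.
    move=> h; split; last by have := h i; rewrite upd_same.
    by move=> j; have := h j; rewrite tnth_upd; case: eqP.
  move=> [h hx] j; have := h j; rewrite tnth_upd; case: eqP => // -> _.
  exact: hx.
transitivity ((m \x mi i) (box (fun j => if j == i then setT else A j) `*` A i));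
  last by rewrite -e.
set A' := fun j => _.
have mA' j : measurable (A' j) by rewrite /A'; case: eqP.
transitivity (\prod_(j < n) mi j (A j)); first exact: m_box.
transitivity (m (box A') * mi i (A i)); last first.
  by apply/esym/product_measure1E => //; exact: measurable_box.
transitivity ((\prod_(j < n) mi j (A' j)) * mi i (A i)); last first.
  by congr (_ * _); apply/esym; exact: m_box.
rewrite (bigD1 i) //= [in RHS](bigD1 i) //= (_ : A' i = setT); last by rewrite /A' eqxx.
rewrite (_ : mi i setT = 1); last exact: probability_setT.
rewrite mul1e muleC; congr (_ * _).
by apply: eq_bigr => j /negbTE ji; rewrite /A' ji.
Qed.

Lemma measurable_resample (mu : probability T R) (f : n.-tuple T -> \bar R) i :
  measurable_fun [set: n.-tuple T] f -> (forall t, 0 <= f t) ->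
  measurable_fun [set: n.-tuple T] (fun t => \int[mu]_x f (upd t i x)).
Proof.
move=> mf f0.
apply: (measurable_fun_fubini_tonelli_F (m2 := mu) (fun p => f (upd p.1 i p.2))).
  exact: measurableT_comp mf (measurable_updp i).
by [].
Qed.

End Resample.

(** * Uniform laws on the unit interval and the cube *)

Section Unif01.
Variable R : realType.
Local Open Scope ereal_scope.

(* [R] and [measurableTypeR R] have the same measurable sets but different
   displays; tuples over [R] refer to the former. *)
Definition unif01 : set R -> \bar R :=
  mrestr (@lebesgue_measure R) (measurable_itv `[0%R, 1%R]).

Let unif01_0 : unif01 set0 = 0. Proof. exact: measure0. Qed.
Let unif01_ge0 A : 0 <= unif01 A. Proof. exact: measure_ge0. Qed.
Let unif01_sigma_additive : semi_sigma_additive unif01.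
Proof.
exact: (@measure_semi_sigma_additive _ _ _
  (mrestr (@lebesgue_measure R) (measurable_itv `[0%R, 1%R]))).
Qed.
HB.instance Definition _ := isMeasure.Build _ _ _ unif01
  unif01_0 unif01_ge0 unif01_sigma_additive.

Let unif01_setT : unif01 setT = 1.
Proof.
by rewrite /unif01 /mrestr setTI lebesgue_measure_itv /= lte01 oppr0 adde0.
Qed.
HB.instance Definition _ := Measure_isProbability.Build _ _ _ unif01 unif01_setT.

Variable d : nat.

Lemma unit_cube_box : @unit_cube R d = @box _ R d (fun _ => `[0%R, 1%R]%classic).
Proof.
by apply/seteqP; split => t /= h k; have := h k; rewrite /= in_itv.
Qed.

Lemma measurable_unit_cube : measurable (@unit_cube R d).
Proof. by rewrite unit_cube_box; exact: measurable_box. Qed.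

Definition unif_cube : set (d.-tuple R) -> \bar R :=
  mrestr (lebesgue_tuple R d) measurable_unit_cube.
HB.instance Definition _ := Measure.on unif_cube.

Lemma unif_cube_box (A : 'I_d -> set R) : (forall k, measurable (A k)) ->
  unif_cube (box A) = \prod_(k < d) unif01 (A k).
Proof.
move=> mA; rewrite /unif_cube /mrestr unit_cube_box.
rewrite (_ : box A `&` _ = box (fun k => A k `&` `[0%R, 1%R])); last first.
  apply/seteqP; split => t /=; first by move=> [h h'] k; split; [exact: h|exact: h'].
  by move=> h; split=> k; have [] := h k.
rewrite [LHS]lebesgue_tuple_box // => k.
by apply: measurableI.
Qed.

Let unif_cube_setT : unif_cube setT = 1.
Proof.
have -> : [set: d.-tuple R] = @box _ R d (fun=> setT).
  by apply/seteqP; split.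
rewrite unif_cube_box // big1 // => k _; exact: unif01_setT.
Qed.
HB.instance Definition _ := Measure_isProbability.Build _ _ _ unif_cube unif_cube_setT.

End Unif01.

(** * Comparison of a perturbed instance with uniform vertices *)

Section Sampling.
Local Open Scope ereal_scope.
Variables (R : realType) (d : nat) (disp : measure_display).
Variables (Omega : measurableType disp) (P : probability Omega R).

Lemma has_bounded_density_le (phi : R) (X : {RV P >-> d.-tuple R}) A :
  has_bounded_density phi X -> measurable A ->
  distribution P X A <= phi%:E * @unif_cube R d A.
Proof.
case=> f [mf fphi fA] mA; rewrite fA // /unif_cube /mrestr.
have mAc : measurable (A `&` @unit_cube R d).
  by apply: measurableI => //; exact: measurable_unit_cube.
rewrite -integral_cst //; apply: ge0_le_integral => //.
- by move=> t [_ /fphi /andP[]]; rewrite lee_fin.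
- apply/measurable_EFinP; apply: measurable_funS mf => //.
    exact: measurable_unit_cube.
- by move=> t [_ /fphi /andP[]]; rewrite lee_fin.
Qed.

Lemma ge0_integral_distribution_le (phi : R) (X : {RV P >-> d.-tuple R})
    (f : d.-tuple R -> \bar R) : (0 <= phi)%R ->
  has_bounded_density phi X ->
  measurable_fun [set: d.-tuple R] f -> (forall t, 0 <= f t) ->
  \int[distribution P X]_t f t <= phi%:E * \int[@unif_cube R d]_t f t.
Proof.
move=> phi0 dX mf f0.
rewrite -(@ge0_integral_mscale _ _ R (@unif_cube R d) setT measurableT (NngNum phi0) f) //.
apply: ge0_le_measure_integral => // A mA.
by rewrite /mscale /=; exact: has_bounded_density_le.
Qed.

Variables (n : nat) (v : 'I_n -> {RV P >-> d.-tuple R}).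

Definition sample (w : Omega) : n.-tuple (d.-tuple R) := [tuple v i w | i < n].

Lemma tnth_sample w i : tnth (sample w) i = v i w.
Proof. by rewrite tnth_mktuple. Qed.

Lemma measurable_sample : measurable_fun [set: Omega] sample.
Proof.
apply/measurable_fun_tnthP => i.
rewrite (_ : _ \o _ = v i); first exact: measurable_funPT.
by apply/funext => w /=; rewrite tnth_sample.
Qed.

Let sample_mfun_mixin := isMeasurableFun.Build _ _ _ _ _ measurable_sample.
HB.instance Definition _ := sample_mfun_mixin.

Definition sample_law : probability (n.-tuple (d.-tuple R)) R :=
  distribution P sample.

Lemma sample_law_box : mutually_independent v ->
  forall A, (forall i, measurable (A i)) ->
  sample_law (box A) = \prod_(i < n) distribution P (v i) (A i).
Proof.
move=> vind A mA; have := vind finset.setT A mA.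
move=> H.
transitivity (P (\bigcap_(i in [set` [set: 'I_n]%SET]) (v i @^-1` A i))).
  congr (P _); apply/seteqP; split => w /= h i.
    by move=> _; have := h i; rewrite tnth_sample.
  by rewrite tnth_sample; apply: h => /=; rewrite inE.
by rewrite H; apply: eq_bigl => i; rewrite inE.
Qed.

(** Only vertex i becomes uniform while the outer integral keeps the law of the whole instance, so
    the step can be iterated over chosen vertices, each at the price of one factor phi. *)
Lemma resample_vertex (phi : R) (f : n.-tuple (d.-tuple R) -> \bar R) i :
  (0 <= phi)%R -> perturbed_instance phi v ->
  measurable_fun [set: n.-tuple (d.-tuple R)] f -> (forall c, 0 <= f c) ->
  \int[sample_law]_c f c <=
    phi%:E * \int[sample_law]_c \int[@unif_cube R d]_x f (upd c i x).
Proof.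
move=> phi0 [vind dv] mf f0.
rewrite (resample (sample_law_box vind) i mf f0).
have mfu c : measurable_fun [set: d.-tuple R] (fun x => f (upd c i x)).
  exact: measurableT_comp mf (measurable_upd c i).
rewrite -ge0_integralZl //; last 2 first.
- exact: measurable_resample.
- by move=> c _; exact: integral_ge0.
apply: ge0_le_integral => //.
- by move=> c _; exact: integral_ge0.
- exact: measurable_resample.
- by apply: measurable_funeM; exact: measurable_resample.
- by move=> c _; apply: ge0_integral_distribution_le.
Qed.

Lemma resample_coord (f : d.-tuple R -> \bar R) k :
  measurable_fun [set: d.-tuple R] f -> (forall t, 0 <= f t) ->
  \int[@unif_cube R d]_t f t =
  \int[@unif_cube R d]_t \int[@unif01 R]_y f (upd t k y).
Proof.
move=> mf f0.
exact: (@resample _ R R d (@unif_cube R d) (fun _ => @unif01 R) (@unif_cube_box R d) f k mf f0).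
Qed.

End Sampling.

(** * Integrals over an interval with a peak or a singularity *)

Section Slices.
Local Open Scope ereal_scope.
Variable R : realType.

Lemma le_integral_off_null d (T : measurableType d) (mu : {measure set T -> \bar R})
    (N : set T) (f g : T -> \bar R) :
  measurable N -> mu N = 0 ->
  measurable_fun [set: T] f -> measurable_fun [set: T] g ->
  (forall x, 0 <= f x) -> (forall x, 0 <= g x) ->
  (forall x, ~ N x -> f x <= g x) -> \int[mu]_x f x <= \int[mu]_x g x.
Proof.
move=> mN N0 mf mg f0 g0 fg; apply: ae_ge0_le_integral => //.
exists N; split => // x /= h; apply: contrapT => nN; apply: h => _; exact: fg.
Qed.

Lemma integral_prob_cst d (T : measurableType d) (m : probability T R) (k : \bar R) :
  \int[m]_x k = k.
Proof.
transitivity (k * m setT); first exact: integral_cst.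
transitivity (k * 1); last by rewrite mule1.
by congr (_ * _); exact: probability_setT.
Qed.

Lemma unif01_out : @unif01 R (~` `[0%R, 1%R]) = 0.
Proof. by rewrite /unif01 /mrestr setICl measure0. Qed.

Lemma unif01_set1 (c : R) : @unif01 R [set c] = 0.
Proof.
apply/eqP; rewrite eq_le measure_ge0 andbT -(@lebesgue_measure_set1 R c).
apply: le_measure; rewrite ?inE; last exact: subIsetl.
  exact: measurableI.
exact: measurable_set1.
Qed.

Lemma unif01_itv_le (A : set R) (a b : R) : (a <= b)%R -> measurable A ->
  A `<=` `[a, b] -> @unif01 R A <= (b - a)%:E.
Proof.
move=> ab mA Aab; apply: (@le_trans _ _ (@lebesgue_measure R `[a, b])).
  apply: le_measure; rewrite ?inE; last by move=> x [/Aab].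
    exact: measurableI.
  exact: measurable_itv.
rewrite lebesgue_measure_itv /= lte_fin.
by case: ltP => //; rewrite lee_fin subr_ge0.
Qed.

Lemma unif01_ball_le (c r : R) : (0 <= r)%R ->
  @unif01 R [set y | `|y - c| <= r]%R <= (2 * r)%:E.
Proof.
move=> r0; have -> : [set y | `|y - c| <= r]%R = `[(c - r)%R, (c + r)%R]%classic.
  by apply/seteqP; split => y /=; rewrite in_itv /= ler_distl.
have h : (c - r <= c + r)%R by lra.
apply: le_trans (unif01_itv_le h (measurable_itv _) (@subset_refl _ _)) _.
by rewrite lee_fin; lra.
Qed.

(** Off the null set of c and the complement of [0, 1], f is dominated by B plus the sum of the step
    functions of height [w l] on the balls of radius [r l] around c. Their integrals form a
    geometric series with sum at most M / (1 - q). *)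
Lemma integral_unif01_dyadic (f : R -> \bar R) (c B M q : R) (w r : nat -> R) :
  measurable_fun [set: R] f -> (forall y, 0 <= f y) ->
  (0 <= B)%R -> (0 <= M)%R -> (0 <= q < 1)%R ->
  (forall l, 0 <= w l)%R -> (forall l, 0 <= r l)%R ->
  (forall l, 2 * (w l * r l) <= M * q ^+ l)%R ->
  (forall y, (0 <= y <= 1)%R -> y != c ->
    f y <= B%:E \/ exists l, f y <= (w l)%:E /\ (`|y - c| <= r l)%R) ->
  \int[@unif01 R]_y f y <= (B + M / (1 - q))%:E.
Proof.
move=> mf f0 B0 M0 /andP[q0 q1] w0 r0 wr fwr.
pose S l := [set y : R | `|y - c| <= r l]%R.
have mS l : measurable (S l).
  have -> : S l = `[(c - r l)%R, (c + r l)%R]%classic.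
    by apply/seteqP; split => y; rewrite /S /= in_itv /= ler_distl.
  exact: measurable_itv.
pose g l y := (w l * \1_(S l) y)%:E.
have g0 l y : 0 <= g l y by rewrite lee_fin mulr_ge0.
have mg l : measurable_fun [set: R] (g l).
  by apply/measurable_EFinP; apply: measurable_funM => //; exact: measurable_indic.
have G0 y : 0 <= \sum_(l <oo) g l y by exact: nneseries_ge0.
have mG : measurable_fun [set: R] (fun y => \sum_(l <oo) g l y).
  exact: ge0_emeasurable_sum.
apply: (@le_trans _ _ (\int[@unif01 R]_y (B%:E + \sum_(l <oo) g l y))).
  apply: (@le_integral_off_null _ _ (@unif01 R) (~` `[0%R, 1%R] `|` [set c])) => //.
  - by apply: measurableU => //; exact: measurableC.
  - apply/eqP; rewrite -measure_le0.
    have e0 : @unif01 R (~` `[0%R, 1%R]) + @unif01 R [set c] = 0.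
      by rewrite unif01_out unif01_set1 adde0.
    apply: le_trans (eq_ind_r (fun z => z <= 0) (lexx 0) e0).
    by apply: measureU2 => //; exact: measurableC.
  - by apply: emeasurable_funD.
  - by move=> y; rewrite adde_ge0.
  - move=> y /= /not_orP[/contrapT]; rewrite in_itv /= => y01 /eqP yc.
    have [fB|[l [fw yr]]] := fwr y y01 yc.
      by rewrite (le_trans fB) // leeDl.
    apply: (le_trans fw); rewrite -[leLHS]add0e leeD //.
    have -> : (w l)%:E = g l y by rewrite /g indicE mem_set // mulr1.
    apply: le_trans (nneseries_lim_ge l.+1 _) => //.
    by rewrite big_nat_recr //= leeDr // sume_ge0.
rewrite ge0_integralD //.
rewrite integral_prob_cst EFinD leeD2l //.
rewrite integral_nneseries //.
apply: lime_le.
  by apply: is_cvg_nneseries => l _ _; exact: integral_ge0.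
apply: nearW => n; apply: (@le_trans _ _ (\sum_(0 <= l < n) (M * q ^+ l)%:E)).
  apply: lee_sum => l _.
  have -> : \int[@unif01 R]_y g l y = (w l)%:E * \int[@unif01 R]_y (\1_(S l) y)%:E.
    rewrite -ge0_integralZl //=; last by rewrite lee_fin.
    by apply/measurable_EFinP; exact: measurable_indic.
  rewrite integral_indic // setIT.
  apply: le_trans (lee_wpmul2l _ (unif01_ball_le c (r0 l))) _; first by rewrite lee_fin.
  by rewrite -EFinM lee_fin mulrCA.
rewrite sumEFin lee_fin -mulr_sumr ler_wpM2l //.
rewrite -[leRHS]mul1r ler_pdivlMr ?subr_gt0 // big_mkord mulrC.
by rewrite -opprB mulNr -subrX1 opprB gerBl exprn_ge0.
Qed.

Lemma exists_expn_lt (z : R) : (0 < z)%R -> exists n, (2 ^- n < z)%R.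
Proof.
move=> z0; exists (Num.truncn z^-1).+1.
rewrite invf_plt ?posrE ?exprn_gt0 //.
apply: (lt_trans (truncnS_gt z^-1)); rewrite -natrX ltr_nat; exact: ltn_expl.
Qed.

(** On the layer 2^-(l+1) < |y - c| <= 2^-l the function is at most K * b^(l+1) with b = 2^g < 2, so
    the layers contribute a geometric series of ratio b / 2. The bound on f is stated as a product
    to make sense at y = c. *)
Lemma integral_unif01_powR (g : R) : (0 < g < 1)%R ->
  exists2 C : R, (0 < C)%R & forall (f : R -> \bar R) (c K : R),
  measurable_fun [set: R] f -> (forall y, 0 <= f y) -> (0 <= K)%R ->
  (forall y, (0 <= y <= 1)%R -> f y * (`|y - c| `^ g)%:E <= K%:E) ->
  \int[@unif01 R]_y f y <= (C * K)%:E.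
Proof.
move=> /andP[g0 g1].
pose b : R := (2 `^ g)%R.
have b0 : (0 < b)%R by rewrite powR_gt0.
have b2 : (b < 2)%R.
  rewrite /b /powR gt_eqF // -[X in (_ < X)%R]lnK ?posrE // ltr_expR.
  by rewrite gtr_pMl // ln_gt0 // ltr1n.
pose q := (b / 2)%R.
have q01 : (0 <= q < 1)%R by rewrite /q; apply/andP; split; lra.
exists (1 + 2 * b / (1 - q))%R.
  have : (0 <= 2 * b / (1 - q))%R by rewrite divr_ge0 //; lra.
  by lra.
move=> f c K mf f0 K0 fK.
have -> : ((1 + 2 * b / (1 - q)) * K = K + (2 * b * K) / (1 - q))%R by lra.
apply: (@integral_unif01_dyadic f c K (2 * b * K) q (fun l => K * b ^+ l.+1)%R
  (fun l => 2 ^- l)%R) => //.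
- by rewrite !mulr_ge0 // ltW.
- by move=> l; rewrite mulr_ge0 // exprn_ge0 // ltW.
- move=> l; rewrite /q expr_div_n exprS.
  by rewrite le_eqVlt; apply/orP; left; apply/eqP; field; rewrite expf_neq0.
- move=> y y01 yc; set z := `|y - c|%R.
  have z0 : (0 < z)%R by rewrite normr_gt0 subr_eq0.
  have fz := fK y y01.
  have [z1|z1] := ltP 1%R z.
    left; apply: le_trans fz; rewrite -/z -[leLHS]mule1; apply: lee_wpmul2l => //.
    rewrite lee_fin -[leLHS](congr1 (fun h => h g) (powR1 R)).
    by rewrite ge0_ler_powR ?nnegrE // ltW.
  right; case: (ex_minnP (exists_expn_lt z0)) => -[|l] hl lmin.
    by move: hl; rewrite expr0 invr1 ltNge z1.
  have zl : (z <= 2 ^- l)%R.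
    by rewrite leNgt; apply/negP => /lmin; rewrite ltnn.
  exists l; split => //.
  have -> : (K * b ^+ l.+1)%:E = K%:E * ((b ^- l.+1)^-1)%:E by rewrite invrK.
  rewrite lee_pdivlMr ?invr_gt0 ?exprn_gt0 //.
  apply: le_trans fz; apply: lee_wpmul2l => //; rewrite lee_fin -/z.
  rewrite -(powR_invn _ (ltW b0)) /b powRAC powR_invn //.
  by rewrite ge0_ler_powR ?nnegrE ?invr_ge0 ?exprn_ge0 // ltW.
Qed.

(** The two bounds describe a peak of height A and width h with quadratic decay. The layers have
    radius 2^(l+1) * h and height A / 4^l. *)
Lemma integral_unif01_sq (f : R -> \bar R) (c A h : R) :
  measurable_fun [set: R] f -> (forall y, 0 <= f y) -> (0 <= A)%R -> (0 < h)%R ->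
  (forall y, (0 <= y <= 1)%R -> f y <= A%:E) ->
  (forall y, (0 <= y <= 1)%R -> f y * ((y - c) ^+ 2)%:E <= (A * h ^+ 2)%:E) ->
  \int[@unif01 R]_y f y <= (8 * (A * h))%:E.
Proof.
move=> mf f0 A0 h0 fA fh.
have -> : (8 * (A * h) = 0 + (4 * (A * h)) / (1 - 2^-1))%R.
  by rewrite add0r (_ : 1 - 2^-1 = 2^-1)%R ?invrK; lra.
apply: (@integral_unif01_dyadic f c 0 (4 * (A * h)) 2^-1 (fun l => A * 4 ^- l)%R
  (fun l => 2 ^+ l.+1 * h)%R) => //.
- by rewrite !mulr_ge0 // ltW.
- by apply/andP; split; lra.
- by move=> l; rewrite mulr_ge0 // invr_ge0 exprn_ge0.
- by move=> l; rewrite mulr_ge0 ?exprn_ge0 // ltW.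
- move=> l; rewrite exprVn exprS (_ : 4 = 2 * 2)%R; last by rewrite -natrM.
  rewrite exprMn le_eqVlt; apply/orP; left; apply/eqP; field.
  by rewrite expf_neq0.
- move=> y y01 yc; right; set z := `|y - c|%R.
  have z0 : (0 < z)%R by rewrite normr_gt0 subr_eq0.
  have [l0 hl0] := exists_expn_lt (divr_gt0 h0 z0).
  have ex : exists l, (z <= 2 ^+ l.+1 * h)%R.
    exists l0; move: hl0; rewrite ltr_pdivlMr // -ltr_pdivlMl ?invr_gt0 ?exprn_gt0 //.
    rewrite invrK => /ltW zl; apply: (le_trans zl); rewrite ler_wpM2r ?(ltW h0) //.
    by rewrite exprS ler_peMl ?exprn_ge0 // ler1n.
  case: (ex_minnP ex) => l zl lmin; exists l; split => //.
  case: l zl lmin => [|l] zl lmin; first by rewrite expr0 invr1 mulr1; exact: fA.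
  have zl2 : (2 ^+ l.+1 * h < z)%R.
    by rewrite ltNge; apply/negP => /lmin; rewrite ltnn.
  have -> : (A * 4 ^- l.+1)%:E = (A * h ^+ 2)%:E * ((2 ^+ l.+1 * h) ^+ 2)^-1%:E.
    rewrite -EFinM; congr EFin; rewrite (_ : 4 = 2 * 2)%R; last by rewrite -natrM.
    rewrite !exprMn; field; rewrite expf_neq0 //=; lra.
  have p0 : (0 < (2 ^+ l.+1 * h))%R by rewrite mulr_gt0 // exprn_gt0.
  rewrite lee_pdivlMr ?exprn_gt0 //.
  apply: le_trans (fh y y01); apply: lee_wpmul2l => //.
  rewrite lee_fin -(real_normK (num_real (y - c))) ler_sqr ?nnegrE //; exact: ltW.
Qed.

End Slices.

(** * Manhattan distances *)

Section SignPatterns.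
Variables (R : realType) (n : nat).

Definition sgb (b : bool) : int := if b then 1 else -1.

(** The coefficients of |x a - x b| as a linear form in x, once the truth value s of x a <= x b is
    fixed. *)
Definition edge_coef (s : bool) (a b i : 'I_n) : int :=
  sgb s * ((i == b)%:Z - (i == a)%:Z).

Definition gain_coef (sab sce sac sbe : bool) (a b c e i : 'I_n) : int :=
  edge_coef sab a b i + edge_coef sce c e i
    - edge_coef sac a c i - edge_coef sbe b e i.

Lemma edge_coefE (x : 'I_n -> R) a b :
  \sum_(i < n) (edge_coef (x a <= x b) a b i)%:~R * x i = `|x a - x b|.
Proof.
under eq_bigr do rewrite /edge_coef intrM intrD intrN mulrBr mulrBl -!mulrA.
rewrite sumrB -!mulr_sumr.
have E j : \sum_(i < n) (i == j)%:Z%:~R * x i = x j.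
  rewrite (bigD1 j) //= eqxx mul1r big1 ?addr0 // => i /negbTE ->.
  by rewrite mul0r.
rewrite !E -mulrBr /sgb; case: ifPn => ab; first by rewrite mul1r distrC ger0_norm ?subr_ge0.
by rewrite mulrN1z gtr0_norm ?subr_gt0 ?ltNge //= mulN1r opprB.
Qed.

Lemma gain_coefE (x : 'I_n -> R) a b c e :
  \sum_(i < n) (gain_coef (x a <= x b) (x c <= x e) (x a <= x c) (x b <= x e)
    a b c e i)%:~R * x i = gain (fun i j => `|x i - x j|) a b c e.
Proof.
under eq_bigr do rewrite /gain_coef !rmorphB /= intrD !mulrBl mulrDl.
by rewrite !sumrB big_split /= !edge_coefE.
Qed.

Lemma gain_coef_vertices sab sce sac sbe a b c e : uniq [:: a; b; c; e] ->
  [/\ gain_coef sab sce sac sbe a b c e a = sgb sac - sgb sab,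
      gain_coef sab sce sac sbe a b c e b = sgb sab + sgb sbe,
      gain_coef sab sce sac sbe a b c e c = - sgb sce - sgb sac &
      gain_coef sab sce sac sbe a b c e e = sgb sce - sgb sbe].
Proof.
rewrite /= !inE !negb_or => /and4P[/and3P[ab ac ae] /andP[bc be] ce _].
have H (i j : 'I_n) : i != j -> ((i == j) = false) * ((j == i) = false).
  by move=> h; rewrite [j == i]eq_sym (negbTE h).
rewrite /gain_coef /edge_coef !eqxx !(H _ _ ab) !(H _ _ ac) !(H _ _ ae) !(H _ _ bc) !(H _ _ be) !(H _ _ ce).
by split; lia.
Qed.

Lemma gain_coef_out sab sce sac sbe a b c e i : i \notin [:: a; b; c; e] ->
  gain_coef sab sce sac sbe a b c e i = 0.
Proof.
rewrite !inE !negb_or => /and4P[/negbTE h1 /negbTE h2 /negbTE h3 /negbTE h4].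
by rewrite /gain_coef /edge_coef h1 h2 h3 h4; lia.
Qed.

Lemma gain_coef_val sab sce sac sbe a b c e i : uniq [:: a; b; c; e] ->
  gain_coef sab sce sac sbe a b c e i \in [:: 0; 2; -2 : int].
Proof.
move=> u; have [h1 h2 h3 h4] := gain_coef_vertices sab sce sac sbe u.
have [|/gain_coef_out -> //] := boolP (i \in [:: a; b; c; e]).
rewrite !in_cons in_nil orbF => /or4P[]/eqP ->; rewrite ?h1 ?h2 ?h3 ?h4;
  by case: sab {h1 h2 h3 h4}; case: sce; case: sac; case: sbe.
Qed.

Ltac bool_coef c1 c2 c3 c4 c5 c6 :=
  try (vm_compute in c1; discriminate c1);
  try (vm_compute in c2; discriminate c2);
  try (vm_compute in c3; discriminate c3);
  try (vm_compute in c4; discriminate c4);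
  try (vm_compute in c5; discriminate c5);
  try (vm_compute in c6; discriminate c6);
  clear c1 c2 c3 c4 c5 c6.

(** If {v5, v6} meets {v2, v4}, a finite check of the order bits shows that all coefficients vanish.
    Otherwise those at v2 and v4 vanish, and the gain reduces to x v3 - x v1 - |x v1 - x v3| or its
    mirror image. Summed over the coordinates, this shows that a positive first gain excludes that
    both gains are the same linear form. *)
Lemma equal_coef_gain_le0 (x : 'I_n -> R) v1 v2 v3 v4 v5 v6 :
  uniq [:: v1; v2; v3; v4] -> uniq [:: v1; v3; v5; v6] ->
  [set v5; v6]%SET != [set v2; v4]%SET ->
  (forall i, gain_coef (x v1 <= x v2) (x v3 <= x v4) (x v1 <= x v3) (x v2 <= x v4)
     v1 v2 v3 v4 i =
   gain_coef (x v1 <= x v3) (x v5 <= x v6) (x v1 <= x v5) (x v3 <= x v6)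
     v1 v3 v5 v6 i) ->
  gain (fun i j => `|x i - x j|) v1 v2 v3 v4 <= 0.
Proof.
move=> u1 u2 ne co.
have [a1 a2 a3 a4] := gain_coef_vertices (x v1 <= x v2) (x v3 <= x v4) (x v1 <= x v3) (x v2 <= x v4) u1.
have [b1 b3 b5 b6] := gain_coef_vertices (x v1 <= x v3) (x v5 <= x v6) (x v1 <= x v5) (x v3 <= x v6) u2.
have out1 i := @gain_coef_out (x v1 <= x v2) (x v3 <= x v4) (x v1 <= x v3) (x v2 <= x v4) v1 v2 v3 v4 i.
have out2 i := @gain_coef_out (x v1 <= x v3) (x v5 <= x v6) (x v1 <= x v5) (x v3 <= x v6) v1 v3 v5 v6 i.
have zero : [/\ sgb (x v1 <= x v3) = sgb (x v1 <= x v2),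
    sgb (x v2 <= x v4) = - sgb (x v1 <= x v2) & sgb (x v3 <= x v4) = - sgb (x v1 <= x v2)] ->
    gain (fun i j => `|x i - x j|) v1 v2 v3 v4 <= 0.
  case=> e13 e24 e34; rewrite -gain_coefE big1 // => i _.
  have [|/out1 ->] := boolP (i \in [:: v1; v2; v3; v4]); last by rewrite mul0r.
  rewrite !in_cons in_nil orbF => /or4P[]/eqP ->; rewrite ?a1 ?a2 ?a3 ?a4 ?e13 ?e24 ?e34;
  by rewrite [X in X%:~R](_ : _ = 0) ?mul0r //; lia.
have c1 := co v1; have c2 := co v2; have c3 := co v3.
have c4 := co v4; have c5 := co v5; have c6 := co v6.
rewrite a1 b1 in c1; rewrite a2 in c2; rewrite a3 b3 in c3; rewrite a4 in c4.
rewrite b5 in c5; rewrite b6 in c6.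
move: {co} u1 u2; rewrite /= !inE !negb_or.
move=> /and4P[/and3P[n12 n13 n14] /andP[n23 n24] n34 _].
move=> /and4P[/and3P[_ n15 n16] /andP[n35 n36] n56 _].
have H (i j : 'I_n) : i != j -> ((i == j) = false) * ((j == i) = false).
  by move=> h; rewrite [j == i]eq_sym (negbTE h).
pose nh := (H _ _ n12, H _ _ n13, H _ _ n14, H _ _ n23, H _ _ n24, H _ _ n34,
  H _ _ n15, H _ _ n16, H _ _ n35, H _ _ n36, H _ _ n56).
have C (i j : 'I_n) : [set i; j]%SET = [set j; i]%SET by exact: finset.setUC.
move: c1 c2 c3 c4 c5 c6.
have [e52|n52] := eqVneq v5 v2.
  have n46 : v4 != v6 by apply: contra_neq ne => <-; rewrite e52.
  subst v5; rewrite (out2 v4) ?inE ?nh ?(H _ _ n46) // (out1 v6) ?inE ?nh ?(H _ _ n46) // b5.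
  move=> c1 c2 c3 c4 c5 c6; apply: zero; move: c1 c2 c3 c4 c5 c6; clear.
  by do 6!case: (_ <= _); vm_compute => *; first [discriminate | split].
have [e54|n54] := eqVneq v5 v4.
  have n26 : v2 != v6 by apply: contra_neq ne => <-; rewrite e54 C.
  subst v5; rewrite (out2 v2) ?inE ?nh ?(H _ _ n26) // (out1 v6) ?inE ?nh ?(H _ _ n26) // b5.
  move=> c1 c2 c3 c4 c5 c6; apply: zero; move: c1 c2 c3 c4 c5 c6; clear.
  by do 7!case: (_ <= _); vm_compute => *; first [discriminate | split].
have [e62|n62] := eqVneq v6 v2.
  subst v6; rewrite (out2 v4) ?inE ?nh ?(H _ _ n54) // (out1 v5) ?inE ?nh ?(H _ _ n54) // b6.
  move=> c1 c2 c3 c4 c5 c6; apply: zero; move: c1 c2 c3 c4 c5 c6; clear.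
  by do 7!case: (_ <= _); vm_compute => *; first [discriminate | split].
have [e64|n64] := eqVneq v6 v4.
  subst v6; rewrite (out2 v2) ?inE ?nh ?(H _ _ n52) // (out1 v5) ?inE ?nh ?(H _ _ n52) // b6.
  move=> c1 c2 c3 c4 c5 c6; apply: zero; move: c1 c2 c3 c4 c5 c6; clear.
  by do 6!case: (_ <= _); vm_compute => *; first [discriminate | split].
rewrite (out2 v2) ?inE ?nh ?(H _ _ n52) ?(H _ _ n62) // (out2 v4) ?inE ?nh ?(H _ _ n54) ?(H _ _ n64) //.
move=> _ + _ + _ _; clear.
have nrm (p q : R) : `|p - q| = if p <= q then q - p else p - q.
  by case: (leP p q) => h; [rewrite ler0_norm ?subr_le0 ?opprB|rewrite gtr0_norm ?subr_gt0].
rewrite /gain !nrm.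
by case: (leP (x v1) (x v2)) => h12; case: (leP (x v3) (x v4)) => h34;
   case: (leP (x v2) (x v4)) => h24 // _ _;
   case: (leP (x v1) (x v3)) => h13; lra.
Qed.

End SignPatterns.

(** * Linear forms with small positive values *)

Section LinearForms.
Local Open Scope ereal_scope.
Variables (R : realType) (d n : nat).
Notation V := (d.-tuple R).
Notation config := (n.-tuple (d.-tuple R)).

Definition coord (c : config) i k : R := tnth (tnth c i) k.

Lemma measurable_coord i k : measurable_fun [set: config] (fun c => coord c i k).
Proof.
exact: (measurableT_comp (@measurable_tnth _ R d k) (@measurable_tnth _ V n i)).
Qed.

Definition lin_form (co : 'I_n -> 'I_d -> R) (c : config) : R :=
  (\sum_(i < n) \sum_(k < d) co i k * coord c i k)%R.

Lemma measurable_lin_form co : measurable_fun [set: config] (lin_form co).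
Proof.
apply: measurable_sum => i; apply: measurable_sum => k.
by apply: measurable_funM => //; exact: measurable_coord.
Qed.

Lemma lin_form_upd co c i k x y :
  lin_form co (upd c i (upd x k y)) =
  (lin_form co (upd c i x) + co i k * (y - tnth x k))%R.
Proof.
rewrite /lin_form (bigD1 i) //= [in RHS](bigD1 i) //= addrAC; congr (_ + _)%R.
  rewrite (bigD1 k) //= [in RHS](bigD1 k) //= /coord !upd_same.
  rewrite [in RHS]addrAC; congr (_ + _)%R; first by ring.
  by apply: eq_bigr => j jk; rewrite upd_other.
apply: eq_bigr => j ji; apply: eq_bigr => l _.
by rewrite /coord !(upd_other _ _ ji).
Qed.

Definition band co (e : R) : set config := [set c | (0 < lin_form co c <= e)%R].

Lemma measurable_band co e : measurable (band co e).
Proof.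
have -> : band co e = lin_form co @^-1` `]0%R, e].
  by apply/seteqP; split => c; rewrite /band /= in_itv.
rewrite -[X in measurable X]setTI; exact: measurable_lin_form.
Qed.

Lemma measurable_affine_band (a b e : R) :
  measurable [set y : R | (0 < b + a * y <= e)%R].
Proof.
have -> : [set y : R | (0 < b + a * y <= e)%R] = (fun y => b + a * y)%R @^-1` `]0%R, e].
  by apply/seteqP; split => c; rewrite /= in_itv.
rewrite -[X in measurable X]setTI.
have : measurable_fun [set: R] (fun y : R => b + a * y)%R.
  by apply: measurable_funD => //; apply: measurable_funM.
by move=> /(_ measurableT) ; apply.
Qed.

Lemma unif01_band_le (a b e : R) : (1 <= `|a|)%R -> (0 <= e)%R ->
  @unif01 R [set y | (0 < b + a * y <= e)%R] <= e%:E.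
Proof.
move=> a1 e0.
have a0 : a != 0%R by rewrite -normr_gt0; lra.
have mS := measurable_affine_band a b e.
have := ler_norm a; have := ler_norm (- a)%R; rewrite normrN => n1 n2.
have ea : (e / `|a| <= e)%R by rewrite ler_pdivrMr ?ler_peMr; lra.
apply: (@le_trans _ _ (e / `|a|)%:E); last by rewrite lee_fin.
have e1 : (0 <= e / `|a|)%R by rewrite divr_ge0.
have [ap|an] := ltP 0%R a.
  have ab : (- b / a <= - b / a + e / `|a|)%R by lra.
  have H : [set y : R | (0 < b + a * y <= e)%R] `<=` `[(- b / a)%R, (- b / a + e / `|a|)%R].
    move=> y /= /andP[h1 h2]; rewrite in_itv /= gtr0_norm //.
    by rewrite -mulrDl ler_pdivrMr // ler_pdivlMr //; apply/andP; split; lra.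
  by apply: (le_trans (unif01_itv_le ab mS H)); rewrite lee_fin; lra.
have {}an : (a < 0)%R by rewrite lt_neqAle a0.
have ab : (- b / a - e / `|a| <= - b / a)%R by lra.
have H : [set y : R | (0 < b + a * y <= e)%R] `<=` `[(- b / a - e / `|a|)%R, (- b / a)%R].
  move=> y /= /andP[h1 h2]; rewrite in_itv /= ltr0_norm // invrN mulrN opprK.
  by rewrite -mulrDl ler_ndivlMr // ler_ndivrMr //; apply/andP; split; lra.
by apply: (le_trans (unif01_itv_le ab mS H)); rewrite lee_fin; lra.
Qed.

Lemma integral_cube_band co e c i k : (1 <= `|co i k|)%R -> (0 <= e)%R ->
  \int[@unif_cube R d]_x (\1_(band co e) (upd c i x))%:E <= e%:E.
Proof.
move=> co1 e0.
have mi : measurable_fun [set: V] (fun x => (\1_(band co e) (upd c i x))%:E : \bar R).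
  apply/measurable_EFinP.
  exact: measurableT_comp (measurable_indic (measurable_band co e)) (measurable_upd c i).
rewrite (resample_coord k mi) //.
rewrite -[leRHS](integral_prob_cst (@unif_cube R d) e%:E).
apply: ge0_le_integral => //.
- by move=> x _; apply: integral_ge0 => y _; rewrite lee_fin.
- apply: (@measurable_resample _ R R d (@unif01 R) _ k mi).
  by [].
- move=> x _.
  have E y : \1_(band co e) (upd c i (upd x k y)) =
     \1_[set y | (0 < (lin_form co (upd c i x) - co i k * tnth x k) + co i k * y <= e)%R] y :> R.
    rewrite !indicE; congr (_ (nat_of_bool _)); apply/idP/idP; rewrite !inE /band /= lin_form_upd.
      by move=> /andP[? ?]; apply/andP; split; lra.
    by move=> /andP[? ?]; apply/andP; split; lra.
  under eq_integral do rewrite E.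
  rewrite integral_indic ?setIT //; first exact: unif01_band_le.
  exact: measurable_affine_band.
Qed.

(** Coordinate k of vertex i moves the first form with slope at least 1 in absolute value and does
    not move the second, so integrating over it costs e1 and leaves the second band untouched. *)
Lemma integral_cube_two_bands co1 co2 e1 e2 c i k :
  (1 <= `|co1 i k|)%R -> co2 i k = 0%R -> (0 <= e1)%R ->
  \int[@unif_cube R d]_x (\1_(band co1 e1 `&` band co2 e2) (upd c i x))%:E <=
  e1%:E * \int[@unif_cube R d]_x (\1_(band co2 e2) (upd c i x))%:E.
Proof.
move=> h1 h2 e10.
have m2 : measurable_fun [set: V] (fun x => (\1_(band co2 e2) (upd c i x))%:E : \bar R).
  apply/measurable_EFinP.
  exact: measurableT_comp (measurable_indic (measurable_band co2 e2)) (measurable_upd c i).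
have mi : measurable_fun [set: V] (fun x => (\1_(band co1 e1 `&` band co2 e2) (upd c i x))%:E : \bar R).
  apply/measurable_EFinP.
  apply: (measurableT_comp _ (measurable_upd c i)); apply: measurable_indic.
  by apply: measurableI; exact: measurable_band.
rewrite (resample_coord k mi) // -ge0_integralZl //.
apply: ge0_le_integral => //.
- by move=> x _; apply: integral_ge0 => y _; rewrite lee_fin.
- by apply: (@measurable_resample _ R R d (@unif01 R) _ k mi).
- exact: measurable_funeM.
- move=> x _.
  pose S := [set y | (0 < (lin_form co1 (upd c i x) - co1 i k * tnth x k) + co1 i k * y <= e1)%R].
  have mS : measurable S by exact: measurable_affine_band.
  have E y : (\1_(band co1 e1 `&` band co2 e2) (upd c i (upd x k y)))%:E =
     (\1_S y)%:E * (\1_(band co2 e2) (upd c i x))%:E :> \bar R.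
    rewrite -EFinM; congr EFin; rewrite indicI /=; congr (_ * _)%R.
      rewrite !indicE; congr (_ (nat_of_bool _)); apply/idP/idP; rewrite !inE /band /S /= lin_form_upd.
        by move=> /andP[? ?]; apply/andP; split; lra.
      by move=> /andP[? ?]; apply/andP; split; lra.
    rewrite !indicE; congr (_ (nat_of_bool _)); apply/idP/idP; rewrite !inE /band /= lin_form_upd h2;
    by rewrite mul0r addr0.
  under eq_integral do rewrite E.
  rewrite ge0_integralZr //; last by apply/measurable_EFinP; exact: measurable_indic.
  rewrite integral_indic // setIT lee_wpmul2r //.
  exact: unif01_band_le.
Qed.

Variables (disp : measure_display) (Omega : measurableType disp).
Variables (P : probability Omega R) (v : 'I_n -> {RV P >-> d.-tuple R}) (phi : R).
Hypothesis phi1 : (1 <= phi)%R.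
Hypothesis vP : perturbed_instance phi v.

Lemma measurable_resample_cube (f : config -> \bar R) i :
  measurable_fun [set: config] f -> (forall c, 0 <= f c) ->
  measurable_fun [set: config] (fun c => \int[@unif_cube R d]_x f (upd c i x)).
Proof. exact: (@measurable_resample _ V R n (@unif_cube R d)). Qed.

Lemma integral_swap_resample (f : config -> \bar R) i j c :
  measurable_fun [set: config] f -> (forall c, 0 <= f c) -> i != j ->
  \int[@unif_cube R d]_x \int[@unif_cube R d]_y f (upd (upd c i x) j y) =
  \int[@unif_cube R d]_y \int[@unif_cube R d]_x f (upd (upd c j y) i x).
Proof.
move=> mf f0 ij.
pose F (p : V * V) := f (upd (upd c i p.1) j p.2).
have mF : measurable_fun [set: V * V] F.
  apply: (measurableT_comp mf).
  have m1 : measurable_fun [set: V * V] (fun p : V * V => (upd c i p.1, p.2)).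
    apply/measurable_fun_pair => /=; last exact: measurable_snd.
    exact: measurableT_comp (measurable_upd c i) measurable_fst.
  exact: (measurableT_comp (measurable_updp j) m1).
have := @fubini_tonelli _ _ _ _ R (@unif_cube R d) (@unif_cube R d) F mF (fun=> f0 _).
move=> H; apply: (etrans H); apply: eq_integral => y _; apply: eq_integral => x _.
by rewrite /F /= upd_comm.
Qed.

(** The hypotheses make the two forms a triangular system. If i' = i, the vertex is already uniform
    and a second factor phi >= 1 is only added; otherwise i' is resampled as well, and the two
    integrals are exchanged so that vertex i' is integrated first. *)
Lemma two_bands_le co1 co2 e1 e2 i k i' k' :
  (1 <= `|co1 i k|)%R -> co2 i k = 0%R -> (1 <= `|co2 i' k'|)%R ->
  (0 <= e1)%R -> (0 <= e2)%R ->
  sample_law v (band co1 e1 `&` band co2 e2) <= (phi ^+ 2 * (e1 * e2))%:E.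
Proof.
move=> h1 h2 h3 e10 e20; have phi0 : (0 <= phi)%R by exact: le_trans ler01 phi1.
set A := _ `&` _.
have mA : measurable A by apply: measurableI; exact: measurable_band.
have m2 : measurable_fun [set: config] (fun c => (\1_(band co2 e2) c)%:E : \bar R).
  by apply/measurable_EFinP; apply: measurable_indic; exact: measurable_band.
have mf : measurable_fun [set: config] (fun c => (\1_A c)%:E : \bar R).
  by apply/measurable_EFinP; exact: measurable_indic.
have -> : sample_law v A = \int[sample_law v]_c (\1_A c)%:E.
  by rewrite integral_indic // setIT.
apply: (le_trans (resample_vertex i phi0 vP mf _)).
  by move=> c; rewrite lee_fin.
have mg : measurable_fun [set: config]
    (fun c => \int[@unif_cube R d]_x (\1_(band co2 e2) (upd c i x))%:E).
  by apply: (measurable_resample_cube i m2) => c; rewrite lee_fin.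
rewrite expr2 -mulrA EFinM lee_wpmul2l ?lee_fin //.
apply: (@le_trans _ _ (\int[sample_law v]_c
    (e1%:E * \int[@unif_cube R d]_x (\1_(band co2 e2) (upd c i x))%:E))).
  apply: ge0_le_integral => //.
  - by move=> c _; apply: integral_ge0 => x _; rewrite lee_fin.
  - by apply: (measurable_resample_cube i mf) => c; rewrite lee_fin.
  - exact: measurable_funeM.
  - by move=> c _; exact: (integral_cube_two_bands e2 c h1 h2 e10).
rewrite ge0_integralZl //; last first.
  by move=> c _; apply: integral_ge0 => x _; rewrite lee_fin.
rewrite mulrCA EFinM lee_wpmul2l ?lee_fin //.
have [ii|ii] := eqVneq i i'.
  apply: (@le_trans _ _ e2%:E); last by rewrite lee_fin ler_peMl.
  rewrite -[leRHS](integral_prob_cst (sample_law v) e2%:E).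
  apply: ge0_le_integral => //.
    by move=> c _; apply: integral_ge0 => x _; rewrite lee_fin.
  by move=> c _; rewrite ii; exact: integral_cube_band h3 e20.
apply: (le_trans (resample_vertex i' phi0 vP mg _)).
  by move=> c; apply: integral_ge0 => x _; rewrite lee_fin.
rewrite EFinM lee_wpmul2l ?lee_fin //.
rewrite -[leRHS](integral_prob_cst (sample_law v) e2%:E).
apply: ge0_le_integral => //.
- by move=> c _; do 2 (apply: integral_ge0 => ? _); rewrite lee_fin.
- by apply: (measurable_resample_cube i' mg) => c; apply: integral_ge0 => x _; rewrite lee_fin.
- move=> c _; rewrite (integral_swap_resample (f := fun c => (\1_(band co2 e2) c)%:E)) //; last by rewrite eq_sym.
  rewrite -[leRHS](integral_prob_cst (@unif_cube R d) e2%:E).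
  apply: ge0_le_integral => //.
  + by move=> x _; apply: integral_ge0 => y _; rewrite lee_fin.
  + apply: (measurableT_comp (measurable_resample_cube i' m2 _) (measurable_upd c i)).
    by move=> c'; rewrite lee_fin.
  + by move=> x _; exact: integral_cube_band h3 e20.
Qed.

End LinearForms.

Section FiniteUnion.
Local Open Scope ereal_scope.
Context d (T : measurableType d) (R : realType) (mu : {measure set T -> \bar R}).

Lemma measure_finite_cover (I : finType) (Q : pred I) (A : I -> set T) (B : set T)
    (K : R) :
  (forall i, measurable (A i)) -> measurable B -> (0 <= K)%R ->
  (forall x, B x -> exists2 i, Q i & A i x) ->
  (forall i, Q i -> mu (A i) <= K%:E) -> mu B <= (#|I|%:R * K)%:E.
Proof.
move=> mA mB K0 BA AK.
have mU : measurable (\big[setU/set0]_(i | Q i) A i) by exact: bigsetU_measurable.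
apply: (@le_trans _ _ (mu (\big[setU/set0]_(i | Q i) A i))).
  apply: le_measure; rewrite ?inE //.
  move=> x /BA[i Qi Aix]; rewrite -bigcup_seq_cond; exists i => //=.
  by rewrite mem_index_enum.
apply: (@le_trans _ _ (\sum_(i | Q i) mu (A i))).
  have [] : measurable (\big[setU/set0]_(i | Q i) A i) /\
      mu (\big[setU/set0]_(i | Q i) A i) <= \sum_(i | Q i) mu (A i).
    elim/big_rec2 : _ => [|i y1 y2 _ [m1 h1]]; first by rewrite measure0.
    have m2 : measurable (A i `|` y2) by exact: measurableU.
    split=> //; apply: (le_trans (measureU2 _ _ _)) => //.
    by rewrite leeD2l.
  by [].
apply: (@le_trans _ _ (\sum_(i | Q i) K%:E)); first by apply: lee_sum.
rewrite sumEFin lee_fin mulr_natl -sumr_const big_mkcond /=; apply: ler_sum => i _.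
by case: ifP.
Qed.

End FiniteUnion.

(** This makes elimination possible: distinct nonzero coefficients are opposite, so the sum of the
    two forms loses the variable. *)
Lemma sum_eq0_of_val (x y : int) : x \in [:: 0; 2; -2 : int] ->
  y \in [:: 0; 2; -2 : int] -> x != y -> x != 0 -> y != 0 -> x + y = 0.
Proof. by rewrite !inE => /or3P[]/eqP -> /or3P[]/eqP ->. Qed.

Lemma measurable_dist_L1 (R : realType) (d : nat) :
  measurable_fun [set: d.-tuple R * d.-tuple R] (fun p => dist_L1 p.1 p.2).
Proof.
apply: measurable_sum => k; apply: (measurableT_comp (@normr_measurable R setT)).
apply: measurable_funB.
  exact: (measurableT_comp (measurable_tnth k) measurable_fst).
exact: (measurableT_comp (measurable_tnth k) measurable_snd).
Qed.

(** * Linked gains in the Manhattan metric *)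

Section Manhattan.
Local Open Scope ereal_scope.
Variables (R : realType) (d n : nat).
Notation config := (n.-tuple (d.-tuple R)).
Variables (disp : measure_display) (Omega : measurableType disp).
Variables (P : probability Omega R) (v : 'I_n -> {RV P >-> d.-tuple R}) (phi : R).
Hypothesis phi1 : (1 <= phi)%R.
Hypothesis vP : perturbed_instance phi v.

Definition gain_event (dist : d.-tuple R -> d.-tuple R -> R) (e : R)
    (v1 v2 v3 v4 v5 v6 : 'I_n) : set config :=
  [set c | (0 < gain (fun i j => dist (tnth c i) (tnth c j)) v1 v2 v3 v4 <= e)%R /\
           (0 < gain (fun i j => dist (tnth c i) (tnth c j)) v1 v3 v5 v6 <= e)%R].

Lemma measurable_gain_event dist e v1 v2 v3 v4 v5 v6 :
  measurable_fun [set: d.-tuple R * d.-tuple R] (fun p => dist p.1 p.2) ->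
  measurable (gain_event dist e v1 v2 v3 v4 v5 v6).
Proof.
move=> mdist.
have mD i j : measurable_fun [set: config] (fun c => dist (tnth c i) (tnth c j)).
  have m2 : measurable_fun [set: config] (fun c : config => (tnth c i, tnth c j)).
    by apply/measurable_fun_pair; exact: measurable_tnth.
  exact: measurableT_comp mdist m2.
have mg a b c' e' : measurable_fun [set: config]
    (fun c : config => gain (fun i j => dist (tnth c i) (tnth c j)) a b c' e').
  by rewrite /gain; apply: measurable_funB; [apply: measurable_funB; [exact: measurable_funD|]|].
have mS a b c' e' : measurable [set c : config |
    (0 < gain (fun i j => dist (tnth c i) (tnth c j)) a b c' e' <= e)%R].
  have -> : [set c : config |
      (0 < gain (fun i j => dist (tnth c i) (tnth c j)) a b c' e' <= e)%R] =
    (fun c : config => gain (fun i j => dist (tnth c i) (tnth c j)) a b c' e') @^-1` `]0%R, e].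
    by apply/seteqP; split => c; rewrite /= in_itv.
  rewrite -[X in measurable X]setTI; exact: mg.
have := measurableI _ _ (mS v1 v2 v3 v4) (mS v1 v3 v5 v6); exact.
Qed.

Section Pattern.
Variables (v1 v2 v3 v4 v5 v6 : 'I_n).
Hypothesis u1 : uniq [:: v1; v2; v3; v4].
Hypothesis u2 : uniq [:: v1; v3; v5; v6].
Hypothesis ne : [set v5; v6]%SET != [set v2; v4]%SET.
Notation pattern := {ffun 'I_d -> 7.-tuple bool}.
Let bit (s : pattern) k j := nth false (s k) j.
Definition coef1 (s : pattern) i k : int :=
  gain_coef (bit s k 0) (bit s k 1) (bit s k 2) (bit s k 3) v1 v2 v3 v4 i.
Definition coef2 (s : pattern) i k : int :=
  gain_coef (bit s k 2) (bit s k 4) (bit s k 5) (bit s k 6) v1 v3 v5 v6 i.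

(** Each gain compares four pairs of vertices; the pair v1, v3 is common to both and sits at index
    2, which leaves seven bits per coordinate. *)
Definition pattern_of (c : config) : pattern :=
  [ffun k => [tuple of [::
    (coord c v1 k <= coord c v2 k)%R; (coord c v3 k <= coord c v4 k)%R;
    (coord c v1 k <= coord c v3 k)%R; (coord c v2 k <= coord c v4 k)%R;
    (coord c v5 k <= coord c v6 k)%R; (coord c v1 k <= coord c v5 k)%R;
    (coord c v3 k <= coord c v6 k)%R]]].

Let D (c : config) i j := dist_L1 (tnth c i) (tnth c j).

Lemma gain_coordE c a b c' e' : gain (D c) a b c' e' =
  (\sum_(k < d) gain (fun i j => `|coord c i k - coord c j k|) a b c' e')%R.
Proof. by rewrite /gain !sumrB big_split. Qed.

Lemma lin_form_coef1 c :
  lin_form (fun i k => (coef1 (pattern_of c) i k)%:~R) c = gain (D c) v1 v2 v3 v4.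
Proof.
rewrite gain_coordE /lin_form exchange_big; apply: eq_bigr => k _ /=.
by rewrite -gain_coefE; apply: eq_bigr => i _; rewrite /coef1 /bit ffunE.
Qed.

Lemma lin_form_coef2 c :
  lin_form (fun i k => (coef2 (pattern_of c) i k)%:~R) c = gain (D c) v1 v3 v5 v6.
Proof.
rewrite gain_coordE /lin_form exchange_big; apply: eq_bigr => k _ /=.
by rewrite -gain_coefE; apply: eq_bigr => i _; rewrite /coef2 /bit ffunE.
Qed.

Let vs := [tuple v1; v2; v3; v4; v5; v6].
(** The three ways to reach a triangular system: the second form vanishes at the pivot, the first
    one does, or both are nonzero there and cancel in their sum. *)
Definition form (m : 'I_3) (s : pattern) : ('I_n -> 'I_d -> int) * ('I_n -> 'I_d -> int) :=
  if m == 0%N :> nat then (coef1 s, coef2 s)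
  else if m == 1%N :> nat then (coef2 s, coef1 s)
  else (coef1 s, fun i k => coef1 s i k + coef2 s i k)%R.
(** Pivots are recorded as positions among v1, ..., v6 instead of vertices, so that the number of
    parameters depends on d only. *)
Notation param := (pattern * ('I_6 * 'I_d) * ('I_6 * 'I_d) * 'I_3)%type.

Definition triangular (p : param) : bool :=
  let: (s, (a, k), (a', k'), m) := p in
  let: (F, F') := form m s in
  [&& F (tnth vs a) k != 0%R, F' (tnth vs a) k == 0%R & F' (tnth vs a') k' != 0%R].

Definition param_event (e : R) (p : param) : set config :=
  let: (s, _, _, m) := p in
  let: (F, F') := form m s in
  band (fun i k => (F i k)%:~R) e `&` band (fun i k => (F' i k)%:~R) (2 * e).

(** The two forms differ at some vertex and coordinate, which becomes the first pivot. The remaining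
    form is positive on the event, hence has a nonzero coefficient, the second pivot. The sum of
    both gains can reach 2 * e, whence the wider second band. *)
Lemma gain_event_cover e c : gain_event (@dist_L1 R d) e v1 v2 v3 v4 v5 v6 c ->
  exists2 p, triangular p & param_event e p c.
Proof.
move=> [g1 g2]; set s := pattern_of c.
have L1 := lin_form_coef1 c; have L2 := lin_form_coef2 c.
rewrite -/s in L1 L2.
have slot i k : coef1 s i k != 0%R \/ coef2 s i k != 0%R -> exists a, i = tnth vs a.
  move=> h; apply/tnthP; apply: contrapT => /negP; rewrite !inE !negb_or.
  move=> /and5P[h1 h2 h3 h4 /andP[h5 h6]].
  by case: h; rewrite /coef1 /coef2 gain_coef_out ?eqxx // !inE !negb_or ?h1 ?h2 ?h3 ?h4 ?h5 ?h6.
have [i [k ik]] : exists i k, coef1 s i k != coef2 s i k.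
  apply: contrapT => nex.
  have : (gain (D c) v1 v2 v3 v4 <= 0)%R.
    rewrite gain_coordE; apply: sumr_le0 => k _.
    apply: (@equal_coef_gain_le0 R n (fun i => coord c i k) v1 v2 v3 v4 v5 v6) => // i.
    apply: contrapT => /eqP h; apply: nex; exists i, k; move: h.
    by rewrite /coef1 /coef2 /bit /s ffunE.
  by case/andP: g1 => g1 _; rewrite leNgt g1.
have active (F : 'I_n -> 'I_d -> int) :
    (0 < lin_form (fun i k => (F i k)%:~R) c)%R -> exists i k, F i k != 0%R.
  move=> L0; apply: contrapT => nex; move: L0; rewrite /lin_form big1 ?ltxx // => j _.
  apply: big1 => l _; have [->|h] := eqVneq (F j l) 0%R; first by rewrite mul0r.
  by exfalso; apply: nex; exists j, l.
have e0 : (0 <= e)%R by case/andP: g1 => h1 h2; exact: ltW (lt_le_trans h1 h2).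
have g1' : (0 < lin_form (fun i k => (coef1 s i k)%:~R) c <= e)%R by rewrite L1.
have g2' : (0 < lin_form (fun i k => (coef2 s i k)%:~R) c <= e)%R by rewrite L2.
have w (F : 'I_n -> 'I_d -> int) : (0 < lin_form (fun i k => (F i k)%:~R) c <= e)%R ->
    (0 < lin_form (fun i k => (F i k)%:~R) c <= 2 * e)%R.
  by move=> /andP[-> h] /=; lra.
have [z2|n2] := eqVneq (coef2 s i k) 0%R.
  have n1 : coef1 s i k != 0%R by rewrite z2 in ik.
  have [|i' [k' h']] := active (coef2 s); first by case/andP: g2'.
  have [a ea] := slot _ _ (or_introl n1); have [a' ea'] := slot _ _ (or_intror h').
  exists (s, (a, k), (a', k'), inord 0); rewrite /triangular /param_event /form inordK //=.
    by rewrite -ea -ea' n1 z2 eqxx.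
  by split; [|exact: w].
have [z1|n1] := eqVneq (coef1 s i k) 0%R.
  have [|i' [k' h']] := active (coef1 s); first by case/andP: g1'.
  have [a ea] := slot _ _ (or_intror n2); have [a' ea'] := slot _ _ (or_introl h').
  exists (s, (a, k), (a', k'), inord 1); rewrite /triangular /param_event /form inordK //=.
    by rewrite -ea -ea' n2 z1 eqxx.
  by split; [|exact: w].
have sum0 : (coef1 s i k + coef2 s i k = 0)%R.
  have := gain_coef_val (bit s k 0) (bit s k 1) (bit s k 2) (bit s k 3) i u1.
  have := gain_coef_val (bit s k 2) (bit s k 4) (bit s k 5) (bit s k 6) i u2.
  by move=> h2 h1; exact: sum_eq0_of_val h1 h2 ik n1 n2.
have gs : (0 < lin_form (fun i k => (coef1 s i k + coef2 s i k)%:~R) c <= 2 * e)%R.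
  have -> : lin_form (fun i k => (coef1 s i k + coef2 s i k)%:~R) c =
     (gain (D c) v1 v2 v3 v4 + gain (D c) v1 v3 v5 v6)%R.
    rewrite -L1 -L2 /lin_form -big_split; apply: eq_bigr => j _.
    by rewrite -big_split; apply: eq_bigr => l _; rewrite /= intrD mulrDl.
  by move: g1 g2 => /andP[? ?] /andP[? ?]; apply/andP; split; lra.
have [|i' [k' h']] := active (fun i k => coef1 s i k + coef2 s i k)%R.
  by case/andP: gs.
have [a ea] := slot _ _ (or_introl n1).
have h'' : coef1 s i' k' != 0%R \/ coef2 s i' k' != 0%R.
  have [h0|] := eqVneq (coef1 s i' k') 0%R; last by left.
  by right; apply: contra_neq h' => ->; rewrite h0.
have [a' ea'] := slot _ _ h''.
exists (s, (a, k), (a', k'), inord 2); rewrite /triangular /param_event /form inordK //=.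
  by rewrite -ea -ea' n1 sum0 eqxx.
Qed.

Lemma manhattan_gain_event_le (e : R) : (0 <= e)%R ->
  sample_law v (gain_event (@dist_L1 R d) e v1 v2 v3 v4 v5 v6) <=
  (#|{: param}|%:R * (2 * phi ^+ 2 * e ^+ 2))%:E.
Proof.
move=> e0.
have mL1 := @measurable_dist_L1 R d.
have K0 : (0 <= 2 * phi ^+ 2 * e ^+ 2)%R.
  exact: (mulr_ge0 (mulr_ge0 (ler0n _ 2) (sqr_ge0 _)) (sqr_ge0 _)).
have H := @measure_finite_cover _ _ R (sample_law v) _ triangular (param_event e)
  (gain_event (@dist_L1 R d) e v1 v2 v3 v4 v5 v6) (2 * phi ^+ 2 * e ^+ 2).
apply: H => //; last 2 first.
- exact: gain_event_cover.
- move=> [[[s [a k]] [a' k']] m]; rewrite /param_event /triangular; case: form => F F'.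
  move=> /and3P[h1 /eqP h2 h3].
  have int1 (z : int) : z != 0%R -> (1 <= `|z%:~R : R|)%R.
    by move=> z0; rewrite -intr_norm ler1z; lia.
  apply: le_trans (two_bands_le phi1 vP (int1 _ h1) _ (int1 _ h3) e0 (mulr_ge0 (ler0n _ 2) e0)) _.
    by rewrite h2.
  by rewrite lee_fin; lra.
- move=> [[[s [a k]] [a' k']] m]; rewrite /param_event; case: form => F F'.
  by apply: measurableI; exact: measurable_band.
- exact: measurable_gain_event.
Qed.

End Pattern.

End Manhattan.

(** * Neighbourhoods of hyperboloids *)

Section Geometry.
Variables (R : realType) (d : nat).
Implicit Types (a b : 'I_d -> R) (O P Q : d.-tuple R).

Definition dot a b : R := \sum_(k < d) a k * b k.

Lemma lagrange_identity a b :
  \sum_(i < d) \sum_(l < d) (a i * b l - a l * b i) ^+ 2 =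
  2 * (dot a a * dot b b - dot a b ^+ 2).
Proof.
have -> : \sum_(i < d) \sum_(l < d) (a i * b l - a l * b i) ^+ 2 =
   \sum_(i < d) \sum_(l < d) ((a i * a i) * (b l * b l) + (b i * b i) * (a l * a l)
     - 2 * ((a i * b i) * (a l * b l))).
  by apply: eq_bigr => i _; apply: eq_bigr => l _; ring.
under eq_bigr do rewrite sumrB big_split /= -!mulr_sumr -/(dot b b) -/(dot a a) -/(dot a b).
rewrite sumrB big_split /= -mulr_sumr -!mulr_suml -/(dot b b) -/(dot a a) -/(dot a b).
by ring.
Qed.

Lemma cauchy_dot a b : dot a b ^+ 2 <= dot a a * dot b b.
Proof.
have : 0 <= 2 * (dot a a * dot b b - dot a b ^+ 2).
  by rewrite -lagrange_identity; apply: sumr_ge0 => i _; apply: sumr_ge0 => l _; exact: sqr_ge0.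
by lra.
Qed.

(** The Gram determinant is the sum of the squared minors over all pairs of coordinates, so it
    dominates each of them. *)
Lemma lagrange_minor a b j k :
  (a j * b k - a k * b j) ^+ 2 <= dot a a * dot b b - dot a b ^+ 2.
Proof.
have [<-|jk] := eqVneq j k.
  by rewrite subrr expr0n /= subr_ge0 cauchy_dot.
pose m i l := (a i * b l - a l * b i) ^+ 2.
have m0 i l : 0 <= m i l by exact: sqr_ge0.
have : m j k + m k j <= 2 * (dot a a * dot b b - dot a b ^+ 2).
  rewrite -lagrange_identity (bigD1 j) //=; apply: lerD.
    by rewrite (bigD1 k) //= lerDl; apply: sumr_ge0 => l _; exact: sqr_ge0.
  rewrite (bigD1 k) 1?eq_sym //= (bigD1 j) //= -addrA lerDl addr_ge0 //.
    by apply: sumr_ge0 => l _; exact: sqr_ge0.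
  by apply: sumr_ge0 => i _; apply: sumr_ge0 => l _; exact: sqr_ge0.
have -> : m k j = m j k by rewrite /m; ring.
by rewrite /m; lra.
Qed.

Definition vec O P : 'I_d -> R := fun k => tnth P k - tnth O k.

Lemma dist_L2E O P : dist_L2 O P = Num.sqrt (dot (vec O P) (vec O P)).
Proof.
rewrite /dist_L2 /dot; congr (Num.sqrt _).
by apply: eq_bigr => k _; rewrite /vec; ring.
Qed.

Lemma dist_L2_ge0 O P : 0 <= dist_L2 O P.
Proof. exact: sqrtr_ge0. Qed.

Lemma dot_ge0 a : 0 <= dot a a.
Proof. by apply: sumr_ge0 => k _; rewrite -expr2 sqr_ge0. Qed.

Lemma dist_L2_sqr O P : dist_L2 O P ^+ 2 = dot (vec O P) (vec O P).
Proof. by rewrite dist_L2E sqr_sqrtr // dot_ge0. Qed.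

Lemma dist_L2C O P : dist_L2 O P = dist_L2 P O.
Proof.
by rewrite /dist_L2; congr (Num.sqrt _); apply: eq_bigr => k _; ring.
Qed.

Lemma law_of_cosines O P Q : dist_L2 P Q ^+ 2 =
  dist_L2 O P ^+ 2 + dist_L2 O Q ^+ 2 - 2 * dot (vec O P) (vec O Q).
Proof.
rewrite !dist_L2_sqr /dot -big_split mulr_sumr -sumrB; apply: eq_bigr => k _.
by rewrite /vec /=; ring.
Qed.

(** Equal to 2 |OP| |OQ| (1 - cos u), where u is the angle at O. It is small when P and Q are seen
    from O in nearly the same direction. *)
Definition defect O P Q : R := dist_L2 P Q ^+ 2 - (dist_L2 O P - dist_L2 O Q) ^+ 2.

Lemma defectE O P Q : defect O P Q =
  2 * (dist_L2 O P * dist_L2 O Q - dot (vec O P) (vec O Q)).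
Proof. by rewrite /defect (law_of_cosines O); ring. Qed.

(** Twice the signed area of the triangle O, P, Q projected to the plane of the coordinates j and k;
    hence its invariance under rotating the three points. *)
Definition minor O P Q j k : R := vec O P j * vec O Q k - vec O P k * vec O Q j.

Lemma cauchy_dist O P Q : `|dot (vec O P) (vec O Q)| <= dist_L2 O P * dist_L2 O Q.
Proof.
rewrite -ler_sqr ?nnegrE ?mulr_ge0 ?dist_L2_ge0 // real_normK ?num_real //.
by rewrite exprMn !dist_L2_sqr cauchy_dot.
Qed.

Lemma defect_minor O P Q j k :
  minor O P Q j k ^+ 2 <= defect O P Q * (dist_L2 O P * dist_L2 O Q).
Proof.
have := lagrange_minor (vec O P) (vec O Q) j k; rewrite -/(minor O P Q j k).
rewrite -!dist_L2_sqr defectE => h; apply: (le_trans h).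
have := cauchy_dist O P Q; rewrite ler_norml.
set p := dist_L2 O P; set q := dist_L2 O Q; set t := dot _ _ => /andP[h1 h2].
have -> : p ^+ 2 * q ^+ 2 - t ^+ 2 = (p * q - t) * (p * q + t) by ring.
have -> : 2 * (p * q - t) * (p * q) = (p * q - t) * (2 * (p * q)) by ring.
by apply: ler_wpM2l; lra.
Qed.

Lemma defect_ge0 O P Q : 0 <= defect O P Q.
Proof. by have := cauchy_dist O P Q; rewrite defectE ler_norml => /andP[]; lra. Qed.

Lemma dist_L2_triangle O P Q : `|dist_L2 O P - dist_L2 O Q| <= dist_L2 P Q.
Proof.
rewrite -ler_sqr ?nnegrE ?dist_L2_ge0 // real_normK ?num_real //.
by rewrite -subr_ge0; exact: defect_ge0.
Qed.

Lemma minor_rot O P Q j k : minor O P Q j k = minor P Q O j k.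
Proof. by rewrite /minor /vec; ring. Qed.

Lemma minorC O P Q j k : minor O P Q j k = - minor O Q P j k.
Proof. by rewrite /minor /vec; ring. Qed.

Lemma dist_L2_cube O P : unit_cube O -> unit_cube P -> dist_L2 O P <= d%:R.
Proof.
move=> cO cP.
have h : dot (vec O P) (vec O P) <= d%:R.
  rewrite /dot -[X in _ <= X%:R]card_ord -sumr_const; apply: ler_sum => k _.
  rewrite /vec -expr2 -real_normK ?num_real // exprn_ile1 //.
  by have := cO k; have := cP k; rewrite ler_norml => /andP[? ?] /andP[? ?]; apply/andP; split; lra.
have d0 : 0 <= d%:R :> R by [].
rewrite -ler_sqr ?nnegrE ?dist_L2_ge0 // dist_L2_sqr (le_trans h) //.
by rewrite -natrX ler_nat; case: (d) => // m; rewrite expnS leq_pmulr // expn_gt0.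
Qed.

(** Coordinate k carries a fixed share of |OP|. The other coordinate j, which exists since d >= 2,
    is the direction of later slices: along it the minor (j, k) of O, P and the moving point is
    affine with slope [vec O P k] up to sign. *)
Lemma exists_main_coord O P : (2 <= d)%N -> exists j k, j != k /\
  dist_L2 O P <= d%:R * `|vec O P k|.
Proof.
move=> d2.
have [k hk] : exists k, dist_L2 O P <= d%:R * `|vec O P k|.
  apply: contrapT => nex.
  have h k : d%:R * `|vec O P k| < dist_L2 O P.
    by rewrite ltNge; apply/negP => h; apply: nex; exists k.
  have d0 : 0 < d%:R :> R by rewrite ltr0n; lia.
  have : d%:R ^+ 2 * dist_L2 O P ^+ 2 < d%:R * dist_L2 O P ^+ 2.
    rewrite {1}dist_L2_sqr /dot mulr_sumr.
    rewrite [X in _ < X * _](_ : d%:R = \sum_(k < d) 1); last by rewrite sumr_const card_ord.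
    rewrite mulr_suml; apply: ltr_sum.
      by apply/hasP; exists (Ordinal d2 : 'I_d); rewrite ?mem_index_enum.
    move=> k _; rewrite mul1r -expr2 -exprMn -[X in X < _]real_normK ?num_real // normrM.
    by rewrite ger0_norm ?ler0n // ltr_sqr ?nnegrE ?mulr_ge0 ?dist_L2_ge0.
  rewrite ltNge => /negP; apply; rewrite ler_wpM2r ?sqr_ge0 //.
  by rewrite -natrX ler_nat; move: d2; case: (d) => // m _; rewrite expnS leq_pmulr // expn_gt0.
pose i0 : 'I_d := Ordinal (ltnW d2 : (0 < d)%N); pose i1 : 'I_d := Ordinal d2.
have [e|ne] := eqVneq i0 k; last by exists i0, k.
by exists i1, k; split => //; rewrite -e.
Qed.

Lemma dist_L2_ge_coord O P k : `|vec O P k| <= dist_L2 O P.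
Proof.
rewrite -ler_sqr ?nnegrE ?dist_L2_ge0 // dist_L2_sqr real_normK ?num_real //.
rewrite /dot (bigD1 k) //= -expr2 lerDl; apply: sumr_ge0 => i _.
by rewrite -expr2 sqr_ge0.
Qed.

(** The partial derivative of |YA| - |YB| in the coordinate k of Y. *)
Definition dgap (A B Y : d.-tuple R) k : R :=
  vec A Y k / dist_L2 Y A - vec B Y k / dist_L2 Y B.

(** The gradient of |YA| - |YB| is a difference of unit vectors, with squared norm 2 - 2 cos u for
    the angle u at Y. This is how the defect controls steepness. *)
Lemma sum_dgap_sqr A B Y : 0 < dist_L2 Y A -> 0 < dist_L2 Y B ->
  \sum_(k < d) dgap A B Y k ^+ 2 * (dist_L2 Y A * dist_L2 Y B) = defect Y A B.
Proof.
move=> pA pB; rewrite -mulr_suml.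
have -> : \sum_(k < d) dgap A B Y k ^+ 2 =
   dot (vec Y A) (vec Y A) / dist_L2 Y A ^+ 2 + dot (vec Y B) (vec Y B) / dist_L2 Y B ^+ 2
   - 2 * (dot (vec Y A) (vec Y B) / (dist_L2 Y A * dist_L2 Y B)).
  rewrite /dot !mulr_suml mulr_sumr -big_split -sumrB; apply: eq_bigr => k _.
  by rewrite /dgap /vec /=; field; rewrite !gt_eqF.
rewrite -!dist_L2_sqr defectE !divff ?expf_neq0 ?gt_eqF //.
by field; rewrite !gt_eqF.
Qed.

End Geometry.

(** * The difference of two distances along a line *)

Section OneDim.
Variable R : realType.

(** The left quotients are the same increasing function of w / q and of u / p. This turns the sign
    of a derivative into that of an affine function. *)
Lemma slope_cmp (u w p q : R) : 0 < p -> 0 < q ->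
  (w / Num.sqrt (w ^+ 2 + q ^+ 2) <= u / Num.sqrt (u ^+ 2 + p ^+ 2)) = (w * p <= u * q).
Proof.
move=> p0 q0.
have U0 : 0 < u ^+ 2 + p ^+ 2 by rewrite ltr_wpDl ?sqr_ge0 // exprn_gt0.
have W0 : 0 < w ^+ 2 + q ^+ 2 by rewrite ltr_wpDl ?sqr_ge0 // exprn_gt0.
set U := Num.sqrt (u ^+ 2 + _); set W := Num.sqrt _.
have U1 : 0 < U by rewrite sqrtr_gt0.
have W1 : 0 < W by rewrite sqrtr_gt0.
have U2 : U ^+ 2 = u ^+ 2 + p ^+ 2 by rewrite sqr_sqrtr // ltW.
have W2 : W ^+ 2 = w ^+ 2 + q ^+ 2 by rewrite sqr_sqrtr // ltW.
rewrite ler_pdivrMr // mulrAC ler_pdivlMr //.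
have E : (u * W) ^+ 2 - (w * U) ^+ 2 = (u * q) ^+ 2 - (w * p) ^+ 2.
  by rewrite !exprMn U2 W2; ring.
have [u0|u0] := leP 0 u; have [w0|w0] := leP 0 w.
- rewrite -[LHS]ler_sqr ?nnegrE ?mulr_ge0 ?(ltW U1) ?(ltW W1) //.
  rewrite -[RHS]ler_sqr ?nnegrE ?mulr_ge0 ?(ltW p0) ?(ltW q0) //.
  by rewrite -subr_ge0 E subr_ge0.
- have -> : w * U <= u * W by apply: (le_trans (ltW _ : _ <= 0)); rewrite ?nmulr_rlt0 // mulr_ge0 // ltW.
  by apply/esym; apply: (le_trans (ltW _ : _ <= 0)); rewrite ?nmulr_rlt0 // mulr_ge0 // ltW.
- have -> : (w * U <= u * W) = false.
    by apply/negbTE; rewrite -ltNge; apply: (lt_le_trans (_ : _ < 0)); rewrite ?nmulr_rlt0 // mulr_ge0 // ltW.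
  by apply/esym/negbTE; rewrite -ltNge; apply: (lt_le_trans (_ : _ < 0)); rewrite ?nmulr_rlt0 // mulr_ge0 // ltW.
- rewrite -[LHS]lerN2 -[RHS]lerN2 -!mulNr.
  rewrite -[LHS]ler_sqr ?nnegrE ?mulr_ge0 ?oppr_ge0 ?(ltW U1) ?(ltW W1) ?(ltW u0) ?(ltW w0) //.
  rewrite -[RHS]ler_sqr ?nnegrE ?mulr_ge0 ?oppr_ge0 ?(ltW p0) ?(ltW q0) ?(ltW u0) ?(ltW w0) //.
  rewrite !mulNr !sqrrN; move: E; set x := _ ^+ 2; set y := (w * U) ^+ 2; set z := (u * q) ^+ 2 => E.
  by apply/idP/idP; lra.
Qed.

Lemma is_derive_hypot (a p y : R) : 0 < p ->
  is_derive y 1 (fun y => Num.sqrt ((y - a) ^+ 2 + p ^+ 2))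
    ((y - a) / Num.sqrt ((y - a) ^+ 2 + p ^+ 2)).
Proof.
move=> p0.
have U0 : 0 < (y - a) ^+ 2 + p ^+ 2 by rewrite ltr_wpDl ?sqr_ge0 // exprn_gt0.
have U1 : 0 < Num.sqrt ((y - a) ^+ 2 + p ^+ 2) by rewrite sqrtr_gt0.
have H := is_derive1_sqrt U0.
pose g (y : R) := (y - a) ^+ 2 + p ^+ 2.
have Hg : is_derive y 1 g (2 * (y - a)).
  by rewrite /g; apply: is_derive_eq; rewrite /GRing.scale /=; ring.
have H2 := @is_derive1_comp R Num.sqrt g y _ _ H Hg.
apply: (is_derive_eq H2).
by rewrite /GRing.scale /= /g; field; rewrite gt_eqF.
Qed.

(** Relaxing h' >= l to h' >= 0 gives a compact set K with extreme points p and q. As h' has the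
    sign of an affine function, h' >= 0 on all of [p, q], and l times the measure is at most the
    integral of h' there, h q - h p <= e. *)
Lemma level_set_le (h h' : R -> R) (m k c e l : R) :
  (forall y : R, is_derive y 1 h (h' y)) -> continuous h' ->
  (forall y, (0 <= h' y) = (0 <= m * y + k)) -> 0 < l -> 0 <= e ->
  (@unif01 R [set y : R | (c <= h y <= c + e)%R && (l <= h' y)%R] <= (e / l)%:E)%E.
Proof.
move=> dh ch' sgn l0 e0.
have ch : continuous h.
  by move=> y; apply/differentiable_continuous/derivable1_diffP; case: (dh y).
pose K := `[0, 1] `&` (h @^-1` `[c, c + e] `&` (fun y => m * y + k) @^-1` `[0, +oo[).
have clK : closed K.
  apply: closedI; first exact: interval_closed.
  apply: closedI; apply: preimage_closed; try exact: interval_closed.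
    by move=> y _; exact: ch.
  move=> y _; apply: continuousD; last exact: cst_continuous.
  by apply: continuousM; [exact: cst_continuous|exact: cvg_id].
have cK : compact K by exact: (subclosed_compact clK (@segment_compact R 0 1) (fun y => @proj1 _ _)).
set E := [set y | _].
have EK : E `&` `[0, 1] `<=` K.
  move=> y [/andP[h1 h2] h3]; split => //; split; rewrite /= in_itv /=; first exact: h1.
  by rewrite -sgn andbT; exact: le_trans (ltW l0) h2.
have mE : measurable E.
  have -> : E = h @^-1` `[c, c + e] `&` h' @^-1` `[l, +oo[.
    by apply/seteqP; split => y; rewrite /E /= !in_itv /= ?andbT => /andP.
  apply: measurableI; rewrite -[X in measurable X]setTI.
    by apply: (continuous_measurable_fun ch) => //; exact: measurable_itv.
  by apply: (continuous_measurable_fun ch') => //; exact: measurable_itv.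
have [K0|/set0P K0] := eqVneq K set0.
  rewrite /unif01 /mrestr.
  have -> : E `&` `[0, 1] = set0 by apply/seteqP; split => // y /EK; rewrite K0.
  by rewrite measure0 lee_fin divr_ge0 // ltW.
have cid : {within K, continuous (@idfun R)} by apply: continuous_subspaceT => y; exact: cvg_id.
have [p pK pmin] := compact_EVT_min K0 cK cid.
have [q qK qmax] := compact_EVT_max K0 cK cid.
rewrite !inE in pK qK.
have Epq : E `&` `[0, 1] `<=` `[p, q].
  by move=> y /EK yK; rewrite /= in_itv /=; apply/andP; split; [apply: pmin|apply: qmax]; rewrite inE.
have pq : p <= q by apply: pmin; rewrite inE.
have [pq1|pq1] := eqVneq p q.
  rewrite pq1 set_itv1 in Epq.
  apply: le_trans (_ : (@lebesgue_measure R [set q] <= _)%E).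
    apply: le_measure; rewrite ?inE; last exact: Epq.
      exact: measurableI.
    exact: measurable_set1.
  by rewrite lebesgue_measure_set1 lee_fin divr_ge0 // ltW.
have {}pq1 : p < q by rewrite lt_neqAle pq1.
have h'0 y : y \in `[p, q] -> 0 <= h' y.
  case: pK qK => [_ [_]]; rewrite /= in_itv /= andbT => Lp [_ [_]].
  rewrite /= in_itv /= andbT => Lq; rewrite in_itv /= => /andP[y1 y2]; rewrite sgn.
  have [m0|m0] := leP 0 m.
    by apply: (le_trans Lp); rewrite lerD2r ler_wpM2l.
  by apply: (le_trans Lq); rewrite lerD2r ler_wnM2l // ltW.
have FTC : (\int[@lebesgue_measure R]_(y in `[p, q]) (h' y)%:E = (h q)%:E - (h p)%:E)%E.
  apply: continuous_FTC2 => //.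
  - by apply: continuous_subspaceT.
  - split.
    + by move=> y _; case: (dh y).
    + by apply: cvg_at_right_filter; exact: ch.
    + by apply: cvg_at_left_filter; exact: ch.
  - by move=> y _; rewrite derive1E; exact: derive_val.
rewrite /unif01 /mrestr EFinM lee_pdivlMr // muleC -integral_cst; last exact: measurableI.
have mh' (D : set R) : measurable D -> measurable_fun D (fun y => (h' y)%:E).
  by move=> mD; apply/measurable_EFinP; apply: measurable_funTS; exact: continuous_measurable_fun.
apply: (@le_trans _ _ (\int[@lebesgue_measure R]_(y in E `&` `[0%R, 1%R]) (h' y)%:E)%E).
  apply: ge0_le_integral => //.
  + exact: measurableI.
  + by move=> y _; rewrite lee_fin ltW.
  + by apply: mh'; exact: measurableI.
  + by move=> y [/andP[_ h2] _]; rewrite lee_fin.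
apply: (@le_trans _ _ (\int[@lebesgue_measure R]_(y in `[p, q]) (h' y)%:E)%E).
  apply: ge0_subset_integral => //.
    exact: measurableI.
  by apply: mh'; exact: measurable_itv.
rewrite FTC -EFinB lee_fin.
case: pK qK => [_ [+ _]] [_ [+ _]]; rewrite /= !in_itv /= => /andP[? ?] /andP[? ?].
lra.
Qed.

(** The difference of the distances from a point y of a line to two foci: a and b are the feet of
    the foci on the line, p and q their distances from it. *)
Definition hyp_gap (a p b q y : R) : R :=
  Num.sqrt ((y - a) ^+ 2 + p ^+ 2) - Num.sqrt ((y - b) ^+ 2 + q ^+ 2).

Definition hyp_slope (a p b q y : R) : R :=
  (y - a) / Num.sqrt ((y - a) ^+ 2 + p ^+ 2) - (y - b) / Num.sqrt ((y - b) ^+ 2 + q ^+ 2).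

Lemma continuous_hypot_slope (a p : R) : 0 < p ->
  continuous (fun y => (y - a) / Num.sqrt ((y - a) ^+ 2 + p ^+ 2)).
Proof.
move=> p0 y.
have U0 : 0 < (y - a) ^+ 2 + p ^+ 2 by rewrite ltr_wpDl ?sqr_ge0 // exprn_gt0.
have U1 : 0 < Num.sqrt ((y - a) ^+ 2 + p ^+ 2) by rewrite sqrtr_gt0.
have D := is_derive_hypot a y p0.
have c1 : {for y, continuous (fun y : R => y - a)}.
  by apply: continuousB; [exact: cvg_id|exact: cst_continuous].
have c2 : {for y, continuous (fun y : R => Num.sqrt ((y - a) ^+ 2 + p ^+ 2))}.
  by apply/differentiable_continuous/derivable1_diffP; case: D.
have c3 : {for y, continuous (fun y : R => (Num.sqrt ((y - a) ^+ 2 + p ^+ 2))^-1)}.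
  by apply: continuousV => //; rewrite gt_eqF.
exact: (continuousM c1 c3).
Qed.

Lemma hyp_slice_le (a p b q c e l : R) : 0 < p -> 0 < q -> 0 < l -> 0 <= e ->
  (@unif01 R [set y : R | (c <= hyp_gap a p b q y <= c + e)%R &&
     (l <= hyp_slope a p b q y)%R] <= (e / l)%:E)%E.
Proof.
move=> p0 q0 l0 e0.
apply: (@level_set_le _ _ (q - p) (b * p - a * q)) => //.
- move=> y; rewrite /hyp_gap /hyp_slope.
  have D1 := is_derive_hypot a y p0; have D2 := is_derive_hypot b y q0.
  exact: is_deriveB.
- move=> y; rewrite /hyp_slope.
  have c1 : {for y, continuous (fun y : R => (y - a) / Num.sqrt ((y - a) ^+ 2 + p ^+ 2))}.
    exact: continuous_hypot_slope.
  have c2 : {for y, continuous (fun y : R => (y - b) / Num.sqrt ((y - b) ^+ 2 + q ^+ 2))}.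
    exact: continuous_hypot_slope.
  exact: (continuousB c1 c2).
- move=> y; rewrite /hyp_slope subr_ge0 slope_cmp // -subr_ge0; congr (0 <= _); ring.
Qed.

End OneDim.

(** * Steep parts of the neighbourhood, by slicing along an axis *)

Section SliceBound.
Variables (R : realType) (d : nat).
Notation V := (d.-tuple R).
Implicit Types (A B Y O P Q : V).

Lemma measurable_indic_EFin d' (T : measurableType d') (W : set T) :
  measurable W -> measurable_fun [set: T] (fun x => (\1_W x : R)%:E).
Proof. by move=> mW; apply/measurable_EFinP; exact: measurable_indic. Qed.

Lemma preimage_upd_measurable (W : set V) Y k : measurable W ->
  measurable [set y : R | W (upd Y k y)].
Proof.
move=> mW; have := measurable_upd Y k => /(_ measurableT W mW).
by rewrite setTI.
Qed.

Lemma slice_bound (W N : set V) k (K : R) : measurable W -> measurable N ->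
  @unif_cube R d N = 0%E -> 0 <= K ->
  (forall Y, ~ N Y -> (@unif01 R [set y : R | W (upd Y k y)] <= K%:E)%E) ->
  (@unif_cube R d W <= K%:E)%E.
Proof.
move=> mW mN N0 K0 h.
have mf := measurable_indic_EFin mW.
have f0 Y : (0 <= (\1_W Y : R)%:E)%E by rewrite lee_fin.
have -> : @unif_cube R d W = (\int[@unif_cube R d]_Y (\1_W Y : R)%:E)%E.
  by rewrite integral_indic // setIT.
rewrite (resample_coord k mf f0) -[leRHS](integral_prob_cst (@unif_cube R d) K%:E).
apply: (le_integral_off_null mN N0) => //.
- exact: (@measurable_resample _ R R d (@unif01 R) _ k mf f0).
- by move=> Y; apply: integral_ge0 => y _; rewrite lee_fin.
- move=> Y nY; apply: le_trans (h Y nY).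
  rewrite (_ : (\int[_]_y _)%E = (\int[@unif01 R]_y (\1_[set y : R | W (upd Y k y)] y)%:E)%E).
    by rewrite integral_indic ?setIT //; exact: preimage_upd_measurable.
  by apply: eq_integral.
Qed.

Lemma measurable_tnth_eq k (a : R) : measurable [set Y : V | tnth Y k = a].
Proof.
have -> : [set Y : V | tnth Y k = a] = (fun Y => tnth Y k) @^-1` [set a] by [].
rewrite -[X in measurable X]setTI; exact: (@measurable_tnth _ R d k).
Qed.

Lemma unif_cube_tnth_eq k (a : R) : @unif_cube R d [set Y : V | tnth Y k = a] = 0%E.
Proof.
apply/eqP; rewrite -measure_le0.
apply: (@slice_bound _ set0 k 0) => //.
- exact: measurable_tnth_eq.
- move=> Y _; rewrite (_ : [set y | _] = [set a]) ?unif01_set1 //.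
  by apply/seteqP; split => y /=; rewrite upd_same.
Qed.

Lemma unif_cubeI_cube (W : set V) :
  @unif_cube R d (W `&` @unit_cube R d) = @unif_cube R d W.
Proof. by rewrite /unif_cube /mrestr -setIA setIid. Qed.

Lemma measurable_dist_L2 : measurable_fun [set: V * V] (fun p => dist_L2 p.1 p.2).
Proof.
have ms : measurable_fun [set: R] (@Num.sqrt R) by apply: continuous_measurable_fun; exact: sqrt_continuous.
apply: (measurableT_comp ms); apply: measurable_sum => k; apply: measurable_funX.
by apply: measurable_funB; [exact: (measurableT_comp (measurable_tnth k) measurable_fst)|
  exact: (measurableT_comp (measurable_tnth k) measurable_snd)].
Qed.

Lemma measurable_dist_L2l A : measurable_fun [set: V] (fun Y => dist_L2 Y A).
Proof.
have m2 : measurable_fun [set: V] (fun Y : V => (Y, A)).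
  by apply/measurable_fun_pair; [exact: measurable_id|exact: measurable_cst].
exact: measurableT_comp measurable_dist_L2 m2.
Qed.

Lemma measurable_vec A k : measurable_fun [set: V] (fun Y => vec A Y k).
Proof. by apply: measurable_funB => //; exact: (@measurable_tnth _ R d k). Qed.

(** The distance of A from the line through Y in direction k. *)
Definition rest Y A k : R := Num.sqrt (\sum_(l < d | l != k) (tnth Y l - tnth A l) ^+ 2).

Lemma dist_L2_upd Y A k y :
  dist_L2 (upd Y k y) A = Num.sqrt ((y - tnth A k) ^+ 2 + rest Y A k ^+ 2).
Proof.
rewrite /dist_L2 /rest sqr_sqrtr; last by apply: sumr_ge0 => l _; exact: sqr_ge0.
rewrite (bigD1 k) //= upd_same; congr (Num.sqrt (_ + _)).
by apply: eq_bigr => l lk; rewrite upd_other.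
Qed.

Lemma rest_gt0 Y A k j : j != k -> tnth Y j != tnth A j -> 0 < rest Y A k.
Proof.
move=> jk ne; rewrite /rest sqrtr_gt0 (bigD1 j) //= ltr_pwDl //.
  by rewrite lt_neqAle sqr_ge0 andbT eq_sym sqrf_eq0 subr_eq0.
by apply: sumr_ge0 => l _; exact: sqr_ge0.
Qed.

Lemma slope_le_cross (l u w p q : R) : 0 < p -> 0 < q ->
  (l * (p * q) <= u * q - w * p) = (l <= u / p - w / q).
Proof.
move=> p0 q0; have pq : 0 < p * q by rewrite mulr_gt0.
rewrite -(ler_pM2r pq (l) (u / p - w / q)); congr (_ <= _).
by field; rewrite !gt_eqF.
Qed.

(** The second condition is l <= [dgap A B Y k] cleared of denominators. *)
Definition steep_band A B (c e l : R) k : set V :=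
  [set Y | (c <= dist_L2 Y A - dist_L2 Y B <= c + e) /\
     l * (dist_L2 Y A * dist_L2 Y B) <= vec A Y k * dist_L2 Y B - vec B Y k * dist_L2 Y A].

Lemma measurable_steep_band A B c e l k : measurable (steep_band A B c e l k).
Proof.
have mg : measurable_fun [set: V] (fun Y => dist_L2 Y A - dist_L2 Y B).
  by apply: measurable_funB; exact: measurable_dist_L2l.
have ms : measurable_fun [set: V] (fun Y => vec A Y k * dist_L2 Y B - vec B Y k * dist_L2 Y A
    - l * (dist_L2 Y A * dist_L2 Y B)).
  by apply: measurable_funB; [apply: measurable_funB; apply: measurable_funM; do ?exact: measurable_dist_L2l; exact: measurable_vec|
    apply: measurable_funM => //; apply: measurable_funM; exact: measurable_dist_L2l].
have -> : steep_band A B c e l k = (fun Y => dist_L2 Y A - dist_L2 Y B) @^-1` `[c, c + e] `&`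
  (fun Y => vec A Y k * dist_L2 Y B - vec B Y k * dist_L2 Y A
    - l * (dist_L2 Y A * dist_L2 Y B)) @^-1` `[0, +oo[.
  by apply/seteqP; split => Y; rewrite /steep_band /= !in_itv /= andbT subr_ge0.
apply: measurableI; rewrite -[X in measurable X]setTI.
  by apply: mg => //; exact: measurable_itv.
by apply: ms => //; exact: measurable_itv.
Qed.

Lemma steep_band_le A B c e l k : (2 <= d)%N -> 0 <= e -> 0 < l ->
  (@unif_cube R d (steep_band A B c e l k) <= (e / l)%:E)%E.
Proof.
move=> d2 e0 l0.
have [j jk] : exists j : 'I_d, j != k.
  pose i0 : 'I_d := Ordinal (ltnW d2 : (0 < d)%N); pose i1 : 'I_d := Ordinal d2.
  by have [ek|ne] := eqVneq i0 k; [exists i1; rewrite -ek|exists i0].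
pose N := [set Y : V | tnth Y j = tnth A j] `|` [set Y : V | tnth Y j = tnth B j].
apply: (@slice_bound _ N k).
- exact: measurable_steep_band.
- by apply: measurableU; exact: measurable_tnth_eq.
- apply/eqP; rewrite -measure_le0.
  have e00 : (@unif_cube R d [set Y : V | tnth Y j = tnth A j] +
     @unif_cube R d [set Y : V | tnth Y j = tnth B j] = 0)%E.
    by rewrite !unif_cube_tnth_eq adde0.
  apply: le_trans (eq_ind_r (fun z => z <= 0)%E (lexx 0%E) e00).
  by apply: measureU2; exact: measurable_tnth_eq.
- by rewrite divr_ge0 // ltW.
- move=> Y /not_orP[/= /eqP YA /eqP YB].
  have pA := rest_gt0 jk YA; have pB := rest_gt0 jk YB.
  have hp (u p : R) : 0 < p -> 0 < Num.sqrt (u ^+ 2 + p ^+ 2).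
    by move=> p0; rewrite sqrtr_gt0 ltr_wpDl ?sqr_ge0 // exprn_gt0.
  apply: le_trans (hyp_slice_le (tnth A k) (tnth B k) c pA pB l0 e0).
  rewrite le_eqVlt; apply/orP; left; apply/eqP; congr (unif01 _).
  apply/seteqP; split => y; rewrite /steep_band /= !dist_L2_upd /vec upd_same -/(hyp_gap _ _ _ _ _) /hyp_slope.
    by move=> [-> h] /=; rewrite -slope_le_cross // hp.
  by move=> /andP[-> h]; split=> //; rewrite slope_le_cross // hp.
Qed.

Lemma defect_eq0 A B Y : dist_L2 Y A * dist_L2 Y B = 0 -> defect Y A B = 0.
Proof.
move=> e; have := cauchy_dist Y A B; rewrite defectE e normr_le0 => /eqP ->.
by rewrite subrr mulr0.
Qed.

(** Distances in the cube are at most d, so the squared gradient, the defect divided by |YA| |YB|,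
    is at least (kap / d)^2, and one of its d components is at least kap / d^2 in absolute value. *)
Lemma exists_steep A B Y (kap : R) : unit_cube A -> unit_cube B -> unit_cube Y ->
  (0 < d)%N -> 0 < kap -> kap ^+ 2 <= defect Y A B ->
  exists k, kap / d%:R ^+ 2 <= `|dgap A B Y k|.
Proof.
move=> cA cB cY d0 k0 hk; apply: contrapT => nex.
have d1 : 1 <= d%:R :> R by rewrite ler1n.
have pq0 : 0 < dist_L2 Y A * dist_L2 Y B.
  rewrite lt_neqAle eq_sym mulr_ge0 ?dist_L2_ge0 // andbT; apply/eqP => /defect_eq0 e.
  by move: hk; rewrite e leNgt exprn_gt0.
have pq : dist_L2 Y A * dist_L2 Y B <= d%:R ^+ 2.
  by rewrite expr2 ler_pM ?dist_L2_ge0 // dist_L2_cube.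
have pA : 0 < dist_L2 Y A.
  by rewrite lt_neqAle dist_L2_ge0 andbT eq_sym; apply: contraTneq pq0 => ->; rewrite mul0r ltxx.
have pB : 0 < dist_L2 Y B.
  by rewrite lt_neqAle dist_L2_ge0 andbT eq_sym; apply: contraTneq pq0 => ->; rewrite mulr0 ltxx.
have lt k : dgap A B Y k ^+ 2 < (kap / d%:R ^+ 2) ^+ 2.
  rewrite -real_normK ?num_real // ltr_sqr ?nnegrE ?normr_ge0 ?divr_ge0 ?sqr_ge0 ?(ltW k0) //.
  by rewrite ltNge; apply/negP => h; apply: nex; exists k.
have S : \sum_(k < d) dgap A B Y k ^+ 2 < d%:R * (kap / d%:R ^+ 2) ^+ 2.
  rewrite mulr_natl -[X in _ *+ X]card_ord -sumr_const; apply: ltr_sum => //.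
  by apply/hasP; exists (Ordinal d0); rewrite ?mem_index_enum.
have := sum_dgap_sqr pA pB; rewrite -mulr_suml => e.
have : kap ^+ 2 < kap ^+ 2.
  apply: le_lt_trans hk _; rewrite -e.
  apply: lt_le_trans (_ : d%:R * (kap / d%:R ^+ 2) ^+ 2 * (dist_L2 Y A * dist_L2 Y B) <= _).
    by rewrite ltr_pM2r.
  apply: le_trans (_ : d%:R * (kap / d%:R ^+ 2) ^+ 2 * d%:R ^+ 2 <= _).
    by rewrite ler_wpM2l // mulr_ge0 ?sqr_ge0.
  have -> : d%:R * (kap / d%:R ^+ 2) ^+ 2 * d%:R ^+ 2 = kap ^+ 2 / d%:R.
    by field; rewrite gt_eqF // ltr0n.
  by rewrite ler_pdivrMr ?ltr0n // ler_peMr ?sqr_ge0.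
by rewrite ltxx.
Qed.

Definition near_hyp A B (t e : R) : set V :=
  [set Y | `|dist_L2 Y A - dist_L2 Y B - t| <= e].

Lemma measurable_near_hyp A B t e : measurable (near_hyp A B t e).
Proof.
have mg : measurable_fun [set: V] (fun Y => dist_L2 Y A - dist_L2 Y B).
  by apply: measurable_funB; exact: measurable_dist_L2l.
have -> : near_hyp A B t e = (fun Y => dist_L2 Y A - dist_L2 Y B) @^-1` `[t - e, t + e].
  by apply/seteqP; split => Y; rewrite /near_hyp /= in_itv /= ler_distl.
by rewrite -[X in measurable X]setTI; apply: mg => //; exact: measurable_itv.
Qed.

Lemma measurable_defect A B : measurable_fun [set: V] (fun Y => defect Y A B).
Proof.
apply: measurable_funB => //; apply: measurable_funX.
by apply: measurable_funB; exact: measurable_dist_L2l.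
Qed.

Lemma measurable_defect_ge A B (k : R) : measurable [set Y : V | k <= defect Y A B].
Proof.
have -> : [set Y : V | k <= defect Y A B] = (fun Y => defect Y A B) @^-1` `[k, +oo[.
  by apply/seteqP; split => Y; rewrite /= in_itv /= andbT.
by rewrite -[X in measurable X]setTI; apply: measurable_defect => //; exact: measurable_itv.
Qed.

(** There is one steep band for each coordinate and each sign of the derivative, a negative sign
    being treated by exchanging the foci. Each of the 2 d bands has width 2 e and slope kap /
    d^2. *)
Lemma near_hyp_steep_le A B (t e kap : R) : unit_cube A -> unit_cube B ->
  (2 <= d)%N -> 0 <= e -> 0 < kap ->
  (@unif_cube R d (near_hyp A B t e `&` [set Y : V | kap ^+ 2 <= defect Y A B]%R)
    <= (4 * d%:R ^+ 3 * (e / kap))%:E)%E.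
Proof.
move=> cA cB d2 e0 k0.
have d0 : (0 < d)%N by apply: ltnW.
have dp : 0 < d%:R :> R by rewrite ltr0n.
set l := kap / d%:R ^+ 2.
have l0 : 0 < l by rewrite divr_gt0 // exprn_gt0.
rewrite -unif_cubeI_cube.
pose S (i : 'I_d * bool) := if i.2 then steep_band A B (t - e) (2 * e) l i.1
  else steep_band B A (- t - e) (2 * e) l i.1.
have K0 : 0 <= 2 * e / l by rewrite divr_ge0 ?mulr_ge0 // ltW.
have mE : measurable (near_hyp A B t e `&` [set Y : V | kap ^+ 2 <= defect Y A B] `&` @unit_cube R d).
  apply: measurableI; last exact: measurable_unit_cube.
  by apply: measurableI; [exact: measurable_near_hyp|exact: measurable_defect_ge].
have H := @measure_finite_cover _ _ R (@unif_cube R d) _ xpredT S _ _ _ mE K0.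
apply: le_trans (H _ _ _) _.
- by move=> [k []]; exact: measurable_steep_band.
- move=> Y [[h1 h2] cY].
  have [k hk] := exists_steep cA cB cY d0 k0 h2.
  move: h1; rewrite /near_hyp /= ler_norml => /andP[h3 h4].
  have pq0 : 0 < dist_L2 Y A * dist_L2 Y B.
    rewrite lt_neqAle eq_sym mulr_ge0 ?dist_L2_ge0 // andbT; apply/eqP => /defect_eq0 e'.
    by move: h2; rewrite /= e' leNgt exprn_gt0.
  have pA : 0 < dist_L2 Y A.
    by rewrite lt_neqAle dist_L2_ge0 andbT eq_sym; apply: contraTneq pq0 => ->; rewrite mul0r ltxx.
  have pB : 0 < dist_L2 Y B.
    by rewrite lt_neqAle dist_L2_ge0 andbT eq_sym; apply: contraTneq pq0 => ->; rewrite mulr0 ltxx.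
  have [g0|g0] := leP 0 (dgap A B Y k).
    exists (k, true) => //; split => /=; first by apply/andP; split; lra.
    by rewrite slope_le_cross // -/(dgap A B Y k); rewrite ger0_norm in hk.
  exists (k, false) => //; split => /=; first by apply/andP; split; lra.
  rewrite slope_le_cross //; apply: le_trans hk _; rewrite ltr0_norm // /dgap; lra.
- move=> [k []] _; apply: steep_band_le => //; lra.
- rewrite lee_fin card_prod card_bool card_ord natrM /l le_eqVlt; apply/orP; left.
  by apply/eqP; field; rewrite !gt_eqF.
Qed.

End SliceBound.

(** * Measure of the neighbourhood of a sheet *)

Section Hyperbola.
Variables (R : realType) (d : nat).
Notation V := (d.-tuple R).
Implicit Types (A B Y O P Q : V).

(** Where the line through Y in direction j meets the line AB, after projection to the plane of the
    coordinates j and k. *)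
Definition axis_center A B Y j k : R :=
  tnth A j + vec A B j / vec A B k * vec A Y k.

Lemma minor_upd A B Y j k y : j != k -> vec A B k != 0 ->
  minor A B (upd Y j y) j k = vec A B k * (axis_center A B Y j k - y).
Proof.
move=> jk b0; rewrite /minor /axis_center [vec A (upd _ _ _)]lock /= -lock.
have -> : vec A (upd Y j y) k = vec A Y k by rewrite /vec upd_other // eq_sym.
have -> : vec A (upd Y j y) j = y - tnth A j by rewrite /vec upd_same.
by field.
Qed.

(** A defect below kap^2 forces |minor A B Y j k| <= kap * d. Along direction j the minor is affine
    with slope at least |AB| / d in size, so every slice is an interval of half-length at most d^2 *
    kap / |AB|. *)
Lemma flat_slab_le A B (kap : R) : unit_cube A -> unit_cube B -> (2 <= d)%N ->
  0 < kap -> 0 < dist_L2 A B ->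
  (@unif_cube R d (@unit_cube R d `&` ~` [set Y : V | (kap ^+ 2 <= defect Y A B)%R])
    <= (2 * d%:R ^+ 2 * (kap / dist_L2 A B))%:E)%E.
Proof.
move=> cA cB d2 k0 s0.
have [j [k [jk sk]]] := exists_main_coord A B d2.
have dp : 0 < d%:R :> R by rewrite ltr0n ltnW.
have bk0 : 0 < `|vec A B k|.
  by rewrite -(pmulr_rgt0 _ dp); apply: lt_le_trans sk.
pose W := [set Y : V | `|minor A B Y j k| <= kap * d%:R].
have mW : measurable W.
  have -> : W = (fun Y => `|minor A B Y j k|) @^-1` `]-oo, kap * d%:R].
    by apply/seteqP; split => Y; rewrite /W /= in_itv.
  rewrite -[X in measurable X]setTI.
  have : measurable_fun [set: V] (fun Y => `|minor A B Y j k|).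
    apply: measurableT_comp; first exact: normr_measurable.
    by apply: measurable_funB; apply: measurable_funM => //; exact: measurable_vec.
  by move=> /(_ measurableT); apply; exact: measurable_itv.
apply: le_trans (_ : (@unif_cube R d W <= _)%E).
  apply: le_measure; rewrite ?inE.
  - apply: measurableI; first exact: measurable_unit_cube.
    by apply: measurableC; exact: measurable_defect_ge.
  - exact: mW.
  - move=> Y [cY /= /negP]; rewrite -ltNge => h; rewrite /W /=.
    rewrite -ler_sqr ?nnegrE ?mulr_ge0 ?(ltW k0) // real_normK ?num_real // exprMn.
    have -> : minor A B Y j k = minor Y A B j k by rewrite -minor_rot.
    apply: le_trans (defect_minor Y A B j k) _.
    apply: ler_pM; rewrite ?mulr_ge0 ?dist_L2_ge0 ?defect_ge0 ?(ltW h) //.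
    by rewrite expr2 ler_pM ?dist_L2_ge0 // dist_L2_cube.
have r0 : 0 <= kap * d%:R / `|vec A B k| by rewrite divr_ge0 ?mulr_ge0 // ltW.
apply: (@slice_bound R d W set0 j) => //.
- by rewrite !mulr_ge0 ?sqr_ge0 ?invr_ge0 ?(ltW k0) ?(ltW s0).
- move=> Y _; rewrite /W.
  have -> : [set y : R | [set Y | `|minor A B Y j k| <= kap * d%:R] (upd Y j y)] =
     [set y | `|y - axis_center A B Y j k| <= kap * d%:R / `|vec A B k|].
    apply/seteqP; split => y /=; rewrite minor_upd ?normrM ?[`|_ - y|]distrC //;
      by rewrite -?normr_gt0 // ler_pdivlMr // mulrC.
  apply: (le_trans (unif01_ball_le _ r0)); rewrite lee_fin -[leRHS]mulrA ler_wpM2l //.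
  rewrite ler_pdivrMr //.
  have -> : kap * d%:R = d%:R * (kap / dist_L2 A B) * dist_L2 A B by field; rewrite gt_eqF.
  have -> : d%:R ^+ 2 * (kap / dist_L2 A B) * `|vec A B k| =
    d%:R * (kap / dist_L2 A B) * (d%:R * `|vec A B k|) by ring.
  by apply: ler_wpM2l => //; rewrite mulr_ge0 // divr_ge0 // ltW.
Qed.

Definition hyp_prob A B (t e : R) : R := fine (@unif_cube R d (near_hyp A B t e)).

Lemma hyp_probE A B t e : (@unif_cube R d (near_hyp A B t e) = (hyp_prob A B t e)%:E)%E.
Proof.
rewrite /hyp_prob fineK // fin_num_measure //; exact: measurable_near_hyp.
Qed.

Lemma hyp_prob_ge0 A B t e : 0 <= hyp_prob A B t e.
Proof. by rewrite /hyp_prob fine_ge0. Qed.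

Lemma hyp_prob_le1 A B t e : hyp_prob A B t e <= 1.
Proof.
rewrite -lee_fin -hyp_probE; apply: probability_le1; exact: measurable_near_hyp.
Qed.

Lemma near_hyp_split A B (t e kap : R) : 
  (@unif_cube R d (near_hyp A B t e) <=
   @unif_cube R d (near_hyp A B t e `&` [set Y : V | (kap ^+ 2 <= defect Y A B)%R]) +
   @unif_cube R d (@unit_cube R d `&` ~` [set Y : V | (kap ^+ 2 <= defect Y A B)%R]))%E.
Proof.
have mS := measurable_near_hyp A B t e.
have mD := measurable_defect_ge A B (kap ^+ 2).
have mC := @measurable_unit_cube R d.
rewrite -[leLHS]unif_cubeI_cube.
apply: le_trans (_ : (@unif_cube R d
  ((near_hyp A B t e `&` [set Y : V | (kap ^+ 2 <= defect Y A B)%R]) `|`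
   (@unit_cube R d `&` ~` [set Y : V | (kap ^+ 2 <= defect Y A B)%R])) <= _)%E).
  apply: le_measure; rewrite ?inE.
  - exact: measurableI.
  - apply: measurableU; [exact: measurableI|apply: measurableI => //; exact: measurableC].
  - move=> Y [h1 h2]; have [h|h] := pselect ([set Y : V | (kap ^+ 2 <= defect Y A B)%R] Y).
      by left.
    by right.
apply: measureU2; first exact: measurableI.
by apply: measurableI => //; exact: measurableC.
Qed.

(* The two parts of the cube on which [defect Y A B] is above and below
   [e * dist_L2 A B] both have measure O(sqrt (e / dist_L2 A B)). *)
Lemma hyp_prob_sqrt A B (t e : R) : unit_cube A -> unit_cube B -> (2 <= d)%N ->
  0 < e -> hyp_prob A B t e * Num.sqrt (dist_L2 A B) <= 6 * d%:R ^+ 3 * Num.sqrt e.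
Proof.
move=> cA cB d2 e0.
have dp : 1 <= d%:R :> R by rewrite ler1n ltnW.
have [s0|s0] := eqVneq (dist_L2 A B) 0.
  by rewrite s0 sqrtr0 mulr0 !mulr_ge0 ?sqrtr_ge0.
have {}s0 : 0 < dist_L2 A B by rewrite lt_neqAle eq_sym s0 dist_L2_ge0.
set s := dist_L2 A B; set a := Num.sqrt e; set b := Num.sqrt s.
have a0 : 0 < a by rewrite sqrtr_gt0.
have b0 : 0 < b by rewrite sqrtr_gt0.
have ea : e = a ^+ 2 by rewrite sqr_sqrtr // ltW.
have sb : s = b ^+ 2 by rewrite sqr_sqrtr // ltW.
have k0 : 0 < a * b by rewrite mulr_gt0.
have h1 := near_hyp_steep_le t cA cB d2 (ltW e0) k0.
have h2 := flat_slab_le cA cB d2 k0 s0.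
have h := le_trans (near_hyp_split A B t e (a * b)) (leeD h1 h2).
move: h; rewrite hyp_probE -EFinD lee_fin -/s => h.
rewrite -ler_pdivlMr //; apply: le_trans h _.
have -> : e / (a * b) = a / b by rewrite ea; field; rewrite !gt_eqF.
have -> : a * b / s = a / b by rewrite sb; field; rewrite !gt_eqF.
have ab : 0 <= a / b by rewrite divr_ge0 // ltW.
rewrite -[leRHS]mulrA -mulrDl ler_wpM2r //.
have : d%:R ^+ 2 <= d%:R ^+ 3 :> R by rewrite ler_weXn2l.
by lra.
Qed.

(** N^2 is a lower bound for the defect on the sheet itself. If N^2 >= 4 e |AB|, the defect stays
    above (N / 2)^2 on the whole neighbourhood and the steep bound covers all of it; otherwise N < 2
    sqrt (e |AB|), and the square root bound suffices. *)
Lemma hyp_prob_defect A B (t e N : R) : unit_cube A -> unit_cube B -> (2 <= d)%N ->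
  0 < e -> 0 <= N -> N ^+ 2 <= dist_L2 A B ^+ 2 - t ^+ 2 ->
  hyp_prob A B t e * N <= 12 * d%:R ^+ 3 * e.
Proof.
move=> cA cB d2 e0 N0 hN.
have dp : 1 <= d%:R :> R by rewrite ler1n ltnW.
set s := dist_L2 A B.
have s0 : 0 <= s := dist_L2_ge0 A B.
have [big|small] := leP (4 * e * s) (N ^+ 2); last first.
  have q := hyp_prob_sqrt t cA cB d2 e0; rewrite -/s in q.
  set a := Num.sqrt e in q; set b := Num.sqrt s in q.
  have a0 : 0 <= a by rewrite sqrtr_ge0.
  have b0 : 0 <= b by rewrite sqrtr_ge0.
  have ea : e = a ^+ 2 by rewrite sqr_sqrtr // ltW.
  have sb : s = b ^+ 2 by rewrite sqr_sqrtr.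
  have Nab : N <= 2 * (a * b).
    rewrite -ler_sqr ?nnegrE ?mulr_ge0 //; apply: le_trans (ltW small) _.
    by rewrite ea sb; lra.
  apply: le_trans (ler_wpM2l (hyp_prob_ge0 _ _ _ _) Nab) _.
  have -> : hyp_prob A B t e * (2 * (a * b)) = 2 * a * (hyp_prob A B t e * b) by ring.
  apply: le_trans (ler_wpM2l _ q) _; first by rewrite mulr_ge0.
  by rewrite [in leRHS]ea; lra.
have [->|N1] := eqVneq N 0.
  by rewrite mulr0 !mulr_ge0 ?exprn_ge0 // ltW.
have {}N1 : 0 < N by rewrite lt_neqAle eq_sym N1.
have k0 : 0 < N / 2 by rewrite divr_gt0.
have h1 := near_hyp_steep_le t cA cB d2 (ltW e0) k0.
have sub : near_hyp A B t e `<=` [set Y : V | (N / 2) ^+ 2 <= defect Y A B].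
  move=> Y; rewrite /near_hyp /=; set g := dist_L2 Y A - dist_L2 Y B => hg.
  have tri : `|g| <= s by exact: dist_L2_triangle.
  have ts : `|t| <= s.
    rewrite -ler_sqr ?nnegrE // real_normK ?num_real //.
    by move: hN; have := sqr_ge0 N; rewrite -/s; lra.
  have -> : defect Y A B = s ^+ 2 - g ^+ 2 by [].
  have E : g ^+ 2 - t ^+ 2 <= 2 * e * s.
    have h2s : `|g + t| <= 2 * s by apply: le_trans (ler_normD _ _) _; lra.
    rewrite subr_sqr; apply: le_trans (ler_norm _) _; rewrite normrM.
    have -> : 2 * e * s = e * (2 * s) by ring.
    exact: ler_pM.
  by rewrite expr_div_n; move: big E hN (sqr_ge0 N); rewrite -/s -!mulrA; lra.
move: h1; rewrite (setIidl sub) hyp_probE lee_fin => h1.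
rewrite -ler_pdivlMr //; apply: (le_trans h1).
have -> : e / (N / 2) = 2 * (e / N) by field; rewrite gt_eqF.
have q0 : 0 <= e / N by rewrite divr_ge0 // ltW.
have d3 : 0 <= d%:R ^+ 3 :> R by rewrite exprn_ge0.
by rewrite -[leRHS]mulrA -[leRHS]mulrA mulrCA; have := mulr_ge0 d3 q0; lra.
Qed.

End Hyperbola.

(** * Euclidean distances *)

Section CubeIntegrals.
Variables (R : realType) (d : nat).
Notation V := (d.-tuple R).
Implicit Types (A B Y : V) (f : V -> \bar R).

Lemma unif_cube_out : @unif_cube R d (~` @unit_cube R d) = 0%E.
Proof. by rewrite /unif_cube /mrestr setICl measure0. Qed.

Lemma unit_cube_upd Y k y : unit_cube Y -> 0 <= y <= 1 -> unit_cube (upd Y k y).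
Proof. by move=> cY y01 l; rewrite tnth_upd; case: eqP. Qed.

Lemma le_integral_cube f g :
  measurable_fun [set: V] f -> measurable_fun [set: V] g ->
  (forall Y, 0 <= f Y)%E -> (forall Y, 0 <= g Y)%E ->
  (forall Y, unit_cube Y -> (f Y <= g Y)%E) ->
  (\int[@unif_cube R d]_Y f Y <= \int[@unif_cube R d]_Y g Y)%E.
Proof.
move=> mf mg f0 g0 fg.
apply: (@le_integral_off_null R _ V (@unif_cube R d) (~` @unit_cube R d)) => //.
- apply: measurableC; exact: measurable_unit_cube.
- exact: unif_cube_out.
- by move=> Y /contrapT; exact: fg.
Qed.

Lemma measurable_slice f k : measurable_fun [set: V] f -> (forall Y, 0 <= f Y)%E ->
  measurable_fun [set: V] (fun Y => \int[@unif01 R]_y f (upd Y k y))%E.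
Proof. by move=> mf f0; exact: (@measurable_resample _ R R d (@unif01 R) f k mf f0). Qed.

Lemma measurable_fun_slice f k Y : measurable_fun [set: V] f ->
  measurable_fun [set: R] (fun y => f (upd Y k y)).
Proof. by move=> mf; exact: measurableT_comp mf (measurable_upd Y k). Qed.

Lemma integral_cube_slice f k (K : R) :
  measurable_fun [set: V] f -> (forall Y, 0 <= f Y)%E -> 0 <= K ->
  (forall Y, unit_cube Y -> (\int[@unif01 R]_y f (upd Y k y) <= K%:E)%E) ->
  (\int[@unif_cube R d]_Y f Y <= K%:E)%E.
Proof.
move=> mf f0 K0 h; rewrite (resample_coord k mf f0).
rewrite -[leRHS](integral_prob_cst (@unif_cube R d) K%:E).
apply: le_integral_cube => //; first exact: measurable_slice.
by move=> Y; exact: integral_ge0.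
Qed.

(** The power |AY|^(2g) dominates the product of the powers g of two coordinate differences, so two
    one-dimensional integrals suffice; singularities of order below 2 are integrable because d >=
    2. *)
Lemma integral_cube_powR2 (g : R) : 0 < g < 1 -> (2 <= d)%N ->
  exists2 C : R, 0 < C & forall f A (K : R),
  measurable_fun [set: V] f -> (forall Y, 0 <= f Y)%E -> 0 <= K ->
  (forall Y, unit_cube Y -> (f Y * (dist_L2 A Y `^ (2 * g))%:E <= K%:E)%E) ->
  (\int[@unif_cube R d]_Y f Y <= (C * K)%:E)%E.
Proof.
move=> g01 d2; have [C C0 HC] := integral_unif01_powR g01.
have g0 : 0 < g by case/andP: g01.
exists (C * C); first by rewrite mulr_gt0.
move=> f A K mf f0 K0 fK.
pose j : 'I_d := Ordinal (ltnW d2 : (0 < d)%N); pose k : 'I_d := Ordinal d2.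
have jk : j != k by [].
pose F Y := (\int[@unif01 R]_y f (upd Y j y))%E.
have mF : measurable_fun [set: V] F by exact: measurable_slice.
have F0 Y : (0 <= F Y)%E by exact: integral_ge0.
have FK Y : unit_cube Y -> (F Y * (`|tnth Y k - tnth A k| `^ g)%:E <= (C * K)%:E)%E.
  move=> cY; have [->|ne] := eqVneq (tnth Y k) (tnth A k).
    by rewrite subrr normr0 powR0 ?gt_eqF // mule0 lee_fin mulr_ge0 // ltW.
  have u0 : 0 < `|tnth Y k - tnth A k| `^ g by rewrite powR_gt0 // normr_gt0 subr_eq0.
  rewrite -lee_pdivlMr // -EFinM -mulrA.
  apply: (HC _ (tnth A j)); first exact: measurable_fun_slice.
  - by [].
  - by rewrite divr_ge0 // ltW.
  - move=> y y01; rewrite EFinM lee_pdivlMr // -muleA -EFinM.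
    apply: le_trans (fK _ (unit_cube_upd j cY y01)).
    apply: lee_wpmul2l => //; rewrite lee_fin mulr_natl -powRM ?normr_ge0 //.
    rewrite mulr2n powRD; last by rewrite (gt_eqF (addr_gt0 g0 g0)).
    rewrite -powRM ?dist_L2_ge0 // ge0_ler_powR ?nnegrE ?mulr_ge0 ?dist_L2_ge0 ?(ltW g0) //.
    apply: ler_pM => //.
      by have := dist_L2_ge_coord A (upd Y j y) j; rewrite /vec upd_same.
    by have := dist_L2_ge_coord A (upd Y j y) k; rewrite /vec upd_other // eq_sym.
have C1 : 0 <= C * K by rewrite mulr_ge0 // ltW.
rewrite (resample_coord j mf f0) -mulrA.
apply: (@integral_cube_slice F k) => //; first by rewrite mulr_ge0 // ltW.
move=> Y cY; apply: (HC _ (tnth A k)) => //; first exact: measurable_fun_slice.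
move=> y y01; have := FK _ (unit_cube_upd k cY y01); by rewrite upd_same.
Qed.

(** The bound f <= K / |minor| alone has a non-integrable singularity along direction j. As f <= 1,
    also f <= f^g, and (K / |minor|)^g is integrable for g < 1. *)
Lemma integral_cube_line (g : R) : 0 < g < 1 -> (2 <= d)%N ->
  exists2 C : R, 0 < C & forall (f : V -> R) A B (K : R) j k,
  measurable_fun [set: V] (EFin \o f) -> (forall Y, 0 <= f Y <= 1) -> 0 <= K ->
  j != k -> dist_L2 A B <= d%:R * `|vec A B k| ->
  (forall Y, unit_cube Y -> f Y * `|minor A B Y j k| <= K) ->
  (\int[@unif_cube R d]_Y (f Y)%:E * (dist_L2 A B `^ g)%:E <= (C * K `^ g)%:E)%E.
Proof.
move=> g01 d2; have [C C0 HC] := integral_unif01_powR g01.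
have g0 : 0 < g by case/andP: g01.
have g1 : g < 1 by case/andP: g01.
have dp : 0 < d%:R :> R by rewrite ltr0n ltnW.
exists (C * d%:R `^ g); first by rewrite mulr_gt0 // powR_gt0.
move=> f A B K j k mf f01 K0 jk sk fK.
have f0 Y : (0 <= (f Y)%:E)%E by rewrite lee_fin; case/andP: (f01 Y).
set s := dist_L2 A B.
have [->|s0] := eqVneq s 0.
  by rewrite powR0 ?gt_eqF // mule0 lee_fin !mulr_ge0 ?powR_ge0 // ltW.
have {}s0 : 0 < s by rewrite lt_neqAle eq_sym s0 dist_L2_ge0.
have bk0 : 0 < `|vec A B k| by rewrite -(pmulr_rgt0 _ dp); apply: lt_le_trans sk.
rewrite -lee_pdivlMr ?powR_gt0 // -EFinM.
have M0 : 0 <= (d%:R * K / s) `^ g by rewrite powR_ge0.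
have -> : C * d%:R `^ g * K `^ g * (s `^ g)^-1 = C * (d%:R * K / s) `^ g.
  rewrite powRM ?mulr_ge0 ?invr_ge0 ?(ltW s0) // powRM // -!mulrA; congr (_ * (_ * (_ * _))).
  by rewrite -powRN -(powR_inv1 (ltW s0)) -powRrM mulN1r.
apply: (@integral_cube_slice (EFin \o f) j) => //; first by rewrite mulr_ge0 // ltW.
move=> Y cY; apply: (HC _ (axis_center A B Y j k)) => //.
  exact: (measurable_fun_slice j Y mf).
  by move=> y; exact: f0.
move=> y y01 /=; rewrite -EFinM lee_fin.
set Z := upd Y j y; have cZ : unit_cube Z by exact: unit_cube_upd.
have /andP[fz0 fz1] := f01 Z.
apply: le_trans (_ : f Z `^ g * `|y - axis_center A B Y j k| `^ g <= _).
  rewrite ler_wpM2r ?powR_ge0 //.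
  have [->|fz] := eqVneq (f Z) 0; first by rewrite powR_ge0.
  by apply: ger1_powR; [rewrite lt_neqAle eq_sym fz fz0|exact: ltW].
rewrite -powRM // ge0_ler_powR ?nnegrE ?mulr_ge0 ?invr_ge0 ?(ltW g0) ?(ltW s0) //.
rewrite ler_pdivlMr //; apply: le_trans (ler_wpM2l (ltW dp) (fK Z cZ)).
rewrite minor_upd // -?normr_gt0 // normrM [`|axis_center _ _ _ _ _ - y|]distrC.
have -> : d%:R * (f Z * (`|vec A B k| * `|y - axis_center A B Y j k|)) =
  f Z * `|y - axis_center A B Y j k| * (d%:R * `|vec A B k|) by ring.
by apply: ler_wpM2l; rewrite ?mulr_ge0.
Qed.

(** Put q = |Y_k - A_k|^(1/4). Along direction j, f is a peak of height proportional to q^(-2) and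
    width proportional to q, so its integral is of order 1 / q, a singularity that is integrable in
    direction k. *)
Lemma integral_cube_sq : (2 <= d)%N ->
  exists2 C : R, 0 < C & forall (f : V -> R) A B (K a : R) j k,
  measurable_fun [set: V] (EFin \o f) -> (forall Y, 0 <= f Y) -> 0 <= K -> 0 < a ->
  j != k -> dist_L2 A B <= d%:R * `|vec A B k| ->
  (forall Y, unit_cube Y ->
     f Y * (dist_L2 A B * Num.sqrt `|tnth Y k - tnth A k|) <= K * a ^+ 2) ->
  (forall Y, unit_cube Y -> f Y * minor A B Y j k ^+ 2 <= K * a ^+ 4) ->
  (\int[@unif_cube R d]_Y (f Y)%:E * (Num.sqrt (dist_L2 A B) ^+ 3)%:E <=
     (C * K * a ^+ 3)%:E)%E.
Proof.
move=> d2.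
have g01 : 0 < (2^-1 * 2^-1 : R) < 1 by apply/andP; split; lra.
have [C C0 HC] := integral_unif01_powR g01.
have dp : 0 < d%:R :> R by rewrite ltr0n ltnW.
exists (C * (8 * d%:R)); first by rewrite !mulr_gt0.
move=> f A B K a j k mf fpos K0 a0 jk sk fK1 fK2.
have f0 Y : (0 <= (f Y)%:E)%E by rewrite lee_fin.
set s := dist_L2 A B; set b := Num.sqrt s.
have [sz|s0] := eqVneq s 0.
  by rewrite /b sz sqrtr0 expr0n /= mule0 lee_fin !mulr_ge0 ?exprn_ge0 // ltW.
have {}s0 : 0 < s by rewrite lt_neqAle eq_sym s0 dist_L2_ge0.
have b0 : 0 < b by rewrite sqrtr_gt0.
have sb : s = b ^+ 2 by rewrite sqr_sqrtr // ltW.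
have bk0 : 0 < `|vec A B k| by rewrite -(pmulr_rgt0 _ dp); apply: lt_le_trans sk.
rewrite -lee_pdivlMr ?exprn_gt0 // -EFinM.
set M := 8 * d%:R * K * a ^+ 3 / b ^+ 3.
have M0 : 0 <= M by rewrite /M !mulr_ge0 ?invr_ge0 ?exprn_ge0 // ltW.
have -> : C * (8 * d%:R) * K * a ^+ 3 / b ^+ 3 = C * M by rewrite /M !mulrA.
pose F Y := (\int[@unif01 R]_y (f (upd Y j y))%:E)%E.
have mF : measurable_fun [set: V] F by exact: (measurable_slice j mf).
have F0 Y : (0 <= F Y)%E by exact: integral_ge0.
have FM Y : unit_cube Y -> (F Y * (`|tnth Y k - tnth A k| `^ (2^-1 * 2^-1))%:E <= M%:E)%E.
  move=> cY; rewrite powRrM !powR12_sqrt ?sqrtr_ge0 ?normr_ge0 //.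
  set q := Num.sqrt (Num.sqrt _).
  have [->|q0] := eqVneq q 0; first by rewrite mule0 lee_fin.
  have {}q0 : 0 < q by rewrite lt_neqAle eq_sym q0 sqrtr_ge0.
  have qq : Num.sqrt `|tnth Y k - tnth A k| = q ^+ 2 by rewrite sqr_sqrtr // sqrtr_ge0.
  rewrite -lee_pdivlMr // -EFinM.
  set A0 := K * a ^+ 2 / (b ^+ 2 * q ^+ 2); set h := d%:R * a * q / b.
  have -> : M / q = 8 * (A0 * h).
    by rewrite /M /A0 /h; field; rewrite !gt_eqF.
  have A00 : 0 <= A0 by rewrite /A0 !mulr_ge0 ?invr_ge0 ?mulr_ge0 ?exprn_ge0 // ltW.
  have h0 : 0 < h by rewrite /h divr_gt0 ?mulr_gt0.
  apply: (integral_unif01_sq (c := axis_center A B Y j k)) => //.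
  - exact: (measurable_fun_slice j Y mf).
  - move=> y y01; have cZ := unit_cube_upd j cY y01.
    rewrite lee_fin /A0 ler_pdivlMr ?mulr_gt0 ?exprn_gt0 //.
    by have := fK1 _ cZ; rewrite upd_other 1?eq_sym // qq -/s sb.
  - move=> y y01; have cZ := unit_cube_upd j cY y01.
    rewrite -EFinM lee_fin.
    have -> : A0 * h ^+ 2 = K * a ^+ 4 * (d%:R ^+ 2 / s ^+ 2).
      by rewrite /A0 /h sb; field; rewrite !gt_eqF.
    rewrite [leRHS]mulrA ler_pdivlMr ?exprn_gt0 // [leRHS]mulrC.
    apply: le_trans (ler_wpM2l (sqr_ge0 d%:R) (fK2 _ cZ)).
    rewrite minor_upd // -?normr_gt0 // exprMn.
    have -> : d%:R ^+ 2 * (f (upd Y j y) * (vec A B k ^+ 2 * (axis_center A B Y j k - y) ^+ 2)) =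
      f (upd Y j y) * (y - axis_center A B Y j k) ^+ 2 * (d%:R * `|vec A B k|) ^+ 2.
      by rewrite [(d%:R * _) ^+ 2]exprMn real_normK ?num_real //; ring.
    apply: ler_wpM2l; first by rewrite mulr_ge0 ?sqr_ge0.
    by rewrite ler_sqr ?nnegrE ?mulr_ge0 // ltW.
rewrite (resample_coord j mf f0).
have CM0 : 0 <= C * M by rewrite mulr_ge0 // ltW.
apply: (@integral_cube_slice F k) => //.
move=> Y cY; apply: (HC _ (tnth A k)) => //; first exact: measurable_fun_slice.
by move=> y y01; have := FM _ (unit_cube_upd k cY y01); rewrite upd_same.
Qed.

End CubeIntegrals.

(** The integral of a nonnegative function is a supremum over the simple functions below it, so
    comparison holds for arbitrary functions, in particular for iterated integrals and for the path
    length. *)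
Lemma ge0_le_integralT (R : realType) d (T : measurableType d)
    (mu : {measure set T -> \bar R}) (f g : T -> \bar R) :
  (forall x, 0 <= f x)%E -> (forall x, f x <= g x)%E ->
  (\int[mu]_x f x <= \int[mu]_x g x)%E.
Proof.
move=> f0 fg; rewrite !ge0_integralTE //; last by move=> x; exact: le_trans (fg x).
by apply: ereal_sup_le => _ [h hf <-]; exists h => // x; exact: le_trans (fg x).
Qed.

(** * Hitting the neighbourhood of the sheet through a given point *)

Section PointIntegrals.
Variables (R : realType) (d : nat).
Notation V := (d.-tuple R).
Hypothesis d2 : (2 <= d)%N.
Let dp : 1 <= d%:R :> R. Proof. by rewrite ler1n ltnW. Qed.

(** The probability that a uniform point has, up to e, the same difference of distances to the foci
    A and B as O. *)
Definition hprob e (A B O : V) : R := hyp_prob A B (dist_L2 O A - dist_L2 O B) e.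

Lemma hprob_ge0 e A B O : 0 <= hprob e A B O. Proof. exact: hyp_prob_ge0. Qed.
Lemma hprob_le1 e A B O : hprob e A B O <= 1. Proof. exact: hyp_prob_le1. Qed.

Lemma measurable_hprob e :
  measurable_fun [set: V * V * V] (fun p => (hprob e p.1.1 p.1.2 p.2)%:E : \bar R).
Proof.
pose W : set (V * V * V * V) :=
  [set q | `|dist_L2 q.2 q.1.1.1 - dist_L2 q.2 q.1.1.2 -
             (dist_L2 q.1.2 q.1.1.1 - dist_L2 q.1.2 q.1.1.2)| <= e].
have mfst3 : measurable_fun [set: V * V * V * V] (fun q => q.1.1.1).
  by apply: (measurableT_comp measurable_fst); apply: (measurableT_comp measurable_fst).
have msnd3 : measurable_fun [set: V * V * V * V] (fun q => q.1.1.2).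
  by apply: (measurableT_comp measurable_snd); apply: (measurableT_comp measurable_fst).
have msnd2 : measurable_fun [set: V * V * V * V] (fun q => q.1.2).
  by apply: (measurableT_comp measurable_snd).
have mD (f g : V * V * V * V -> V) : measurable_fun setT f -> measurable_fun setT g ->
    measurable_fun setT (fun q => dist_L2 (f q) (g q)).
  move=> mf mg; have m2 : measurable_fun setT (fun q => (f q, g q)).
    exact/measurable_fun_pair.
  exact: (measurableT_comp (@measurable_dist_L2 R d) m2).
have mW : measurable W.
  pose G (q : V * V * V * V) := dist_L2 q.2 q.1.1.1 - dist_L2 q.2 q.1.1.2 -
             (dist_L2 q.1.2 q.1.1.1 - dist_L2 q.1.2 q.1.1.2).
  have mG : measurable_fun setT G.
    by apply: measurable_funB; apply: measurable_funB; apply: mD => //; exact: measurable_snd.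
  have -> : W = G @^-1` `[- e, e].
    by apply/seteqP; split => q; rewrite /W /G /= in_itv /= ler_norml.
  by rewrite -[X in measurable X]setTI; apply: mG => //; exact: measurable_itv.
have mi : measurable_fun setT (fun q => (\1_W q)%:E : \bar R) by exact: measurable_indic_EFin.
have H := @measurable_fun_fubini_tonelli_F _ _ _ V R (@unif_cube R d) _ mi.
have {}H := H (fun q => _); rewrite (_ : (fun p => _) = fubini_F (@unif_cube R d) (fun q => (\1_W q)%:E)).
  by apply: H => q; rewrite lee_fin.
apply/funext => p; rewrite /fubini_F /hprob -hyp_probE.
have -> : (fun y => (\1_W (p, y))%:E) =
   (fun y => (\1_(near_hyp p.1.1 p.1.2 (dist_L2 p.2 p.1.1 - dist_L2 p.2 p.1.2) e) y)%:E : \bar R).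
  by apply/funext => y; rewrite !indicE; congr (_ (nat_of_bool _))%:E; apply/idP/idP; rewrite !inE.
rewrite integral_indic ?setIT //; exact: measurable_near_hyp.
Qed.

Lemma measurable_hprob_comp e d' (T : measurableType d') (a b o : T -> V) :
  measurable_fun setT a -> measurable_fun setT b -> measurable_fun setT o ->
  measurable_fun setT (fun x => (hprob e (a x) (b x) (o x))%:E : \bar R).
Proof.
move=> ma mb mo; have m3 : measurable_fun setT (fun x => (a x, b x, o x)).
  apply/measurable_fun_pair => //; exact/measurable_fun_pair.
exact: (measurableT_comp (measurable_hprob e) m3).
Qed.

(** With N = |minor| / d in the defect bound: the squared minor is at most the defect at O times
    |OA| |OB| <= d^2. *)
Lemma hprob_minor e A B O j k : 0 < e -> unit_cube A -> unit_cube B -> unit_cube O ->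
  hprob e A B O * `|minor O A B j k| <= 12 * d%:R ^+ 4 * e.
Proof.
move=> e0 cA cB cO; have dp' := dp.
have d0 : 0 < d%:R :> R by lra.
have := @hyp_prob_defect R d A B (dist_L2 O A - dist_L2 O B) e (`|minor O A B j k| / d%:R)
  cA cB d2 e0.
have -> : 12 * d%:R ^+ 4 * e = 12 * d%:R ^+ 3 * e * d%:R by ring.
rewrite mulrA ler_pdivrMr //; apply; first by rewrite divr_ge0.
rewrite expr_div_n real_normK ?num_real // ler_pdivrMr ?exprn_gt0 //.
apply: le_trans (defect_minor O A B j k) _; rewrite -/(defect O A B).
apply: ler_wpM2l; first exact: defect_ge0.
by rewrite expr2; apply: ler_pM; rewrite ?dist_L2_ge0 ?dist_L2_cube.
Qed.

Lemma hprob_sqrt e A B O : 0 < e -> unit_cube A -> unit_cube B ->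
  hprob e A B O * Num.sqrt (dist_L2 A B) <= 6 * d%:R ^+ 3 * Num.sqrt e.
Proof. by move=> e0 cA cB; exact: hyp_prob_sqrt. Qed.

End PointIntegrals.

(** * Integration over the remaining vertices of a linked pair *)

Section ChainIntegrals.
Variables (R : realType) (d : nat).
Notation V := (d.-tuple R).
Hypothesis d2 : (2 <= d)%N.
Let dp : 1 <= d%:R :> R. Proof. by rewrite ler1n ltnW. Qed.
Notation mu := (@unif_cube R d).

Lemma measurable_partial (f : V * V -> \bar R) : measurable_fun setT f ->
  (forall p, 0 <= f p)%E -> measurable_fun [set: V] (fun x => \int[mu]_y f (x, y))%E.
Proof.
move=> mf f0; exact: (@measurable_fun_fubini_tonelli_F _ _ V V R mu f mf f0).
Qed.

(** Given A and O, the integrals over B and B' decouple into the square of [J O], which is O((e /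
    |AO|)^(15/16)); and |AO|^(-15/8) is integrable because 15/8 < 2. *)
Lemma integral_two_hprob : exists2 C : R, 0 < C & forall e (A : V),
  0 < e -> unit_cube A ->
  (\int[mu]_O \int[mu]_B' \int[mu]_B (hprob e A B O * hprob e A B' O)%:E
     <= (C * e `^ (15 / 8))%:E)%E.
Proof.
have g01 : 0 < (15 / 16 : R) < 1 by apply/andP; split; lra.
have [C1 C10 H1] := integral_cube_line g01 d2.
have [C2 C20 H2] := integral_cube_powR2 g01 d2.
have d0 : 0 < d%:R :> R by have := dp; lra.
exists (C2 * (C1 * (12 * d%:R ^+ 4) `^ (15/16)) ^+ 2).
  by rewrite mulr_gt0 // exprn_gt0 // mulr_gt0 // powR_gt0 // mulr_gt0 // exprn_gt0.
move=> e A e0 cA.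
pose J O := (\int[mu]_B (hprob e A B O)%:E)%E.
have mh O : measurable_fun [set: V] (fun B => (hprob e A B O)%:E : \bar R).
  by apply: measurable_hprob_comp => //; exact: measurable_cst.
have h0 B O : (0 <= (hprob e A B O)%:E)%E by rewrite lee_fin hprob_ge0.
have J0 O : (0 <= J O)%E by exact: integral_ge0.
have mJ : measurable_fun [set: V] J.
  apply: (measurable_partial (f := fun p => (hprob e A p.2 p.1)%:E)) => //.
  apply: measurable_hprob_comp; [exact: measurable_cst|exact: measurable_snd|exact: measurable_fst].
have -> : (\int[mu]_O \int[mu]_B' \int[mu]_B (hprob e A B O * hprob e A B' O)%:E =
   \int[mu]_O (J O * J O))%E.
  apply: eq_integral => O _.
  transitivity (\int[mu]_B' (J O * (hprob e A B' O)%:E))%E.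
    apply: eq_integral => B' _; rewrite /J -ge0_integralZr //; apply: eq_integral => B _.
  by rewrite ge0_integralZl.
rewrite -mulrA.
have -> : (C1 * (12 * d%:R ^+ 4) `^ (15 / 16)) ^+ 2 * e `^ (15 / 8) =
  (C1 * (12 * d%:R ^+ 4 * e) `^ (15 / 16)) ^+ 2.
  have : 0 <= 12 * d%:R ^+ 4 :> R by rewrite mulr_ge0 ?exprn_ge0 // ltW.
  move: (12 * _) => w w0.
  rewrite (powRM _ w0 (ltW e0)) [C1 * (_ * _)]mulrA [RHS]exprMn; congr (_ * _).
  by rewrite -powR_mulrn ?powR_ge0 // -powRrM; congr (_ `^ _); lra.
set K := C1 * _.
have K0 : 0 <= K by rewrite mulr_ge0 ?powR_ge0 ?ltW.
apply: (H2 (fun O => J O * J O)%E A (K ^+ 2)).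
- exact: emeasurable_funM.
- by move=> O; exact: mule_ge0.
- exact: sqr_ge0.
- move=> O cO.
  have JK : (J O * (dist_L2 A O `^ (15/16))%:E <= K%:E)%E.
    have [j [k [jk sk]]] := exists_main_coord O A d2.
    rewrite dist_L2C /J.
    apply: (H1 (fun B => hprob e A B O) O A (12 * d%:R ^+ 4 * e) j k (mh O)) => //.
    + by move=> B; rewrite hprob_ge0 hprob_le1.
    + by rewrite !mulr_ge0 ?exprn_ge0 // ltW.
    + by move=> B cB; exact: hprob_minor.
  have -> : (J O * J O * (dist_L2 A O `^ (2 * (15 / 16)))%:E =
     (J O * (dist_L2 A O `^ (15 / 16))%:E) * (J O * (dist_L2 A O `^ (15 / 16))%:E))%E.
    rewrite muleACA -EFinM -powRD; last by apply/implyP => /eqP; lra.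
    by congr (_ * (_ `^ _)%:E)%E; lra.
  rewrite expr2 EFinM; apply: lee_pmul => //; by rewrite mule_ge0 ?lee_fin ?powR_ge0.
Qed.

(** The two bounds make the integral over O of order K (e / |AB|)^(3/2), and |AB|^(-3/2) is
    integrable over A. *)
Lemma integral_hprob_pair : exists2 C : R, 0 < C & forall (f : V * V -> R) e K (B : V),
  measurable_fun [set: V * V] (EFin \o f) -> (forall p, 0 <= f p) -> 0 < e -> 0 <= K ->
  (forall A O j k, unit_cube A -> unit_cube O ->
     f (A, O) * (dist_L2 A B * Num.sqrt `|tnth O k - tnth A k|) <= K * e /\
     f (A, O) * minor A B O j k ^+ 2 <= K * e ^+ 2) ->
  (\int[mu]_A \int[mu]_O (f (A, O))%:E <= (C * K * Num.sqrt e ^+ 3)%:E)%E.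
Proof.
have g01 : 0 < (3 / 4 : R) < 1 by apply/andP; split; lra.
have [C1 C10 H1] := integral_cube_sq R d2.
have [C2 C20 H2] := integral_cube_powR2 g01 d2.
exists (C2 * C1); first exact: mulr_gt0.
move=> f e K B mf f0 e0 K0 fK.
set a := Num.sqrt e; have a0 : 0 < a by rewrite sqrtr_gt0.
have ea : e = a ^+ 2 by rewrite sqr_sqrtr // ltW.
have K1 : 0 <= C1 * K * a ^+ 3 by rewrite !mulr_ge0 ?exprn_ge0 ?(ltW a0) // ltW.
rewrite -!mulrA [C1 * _]mulrA.
apply: (H2 _ B (C1 * K * a ^+ 3)) => //.
- have fE p : (0 <= (EFin \o f) p)%E by rewrite lee_fin.
  exact: (measurable_partial mf fE).
- by move=> A; apply: integral_ge0 => O _; rewrite lee_fin.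
move=> A cA; have [j [k [jk sk]]] := exists_main_coord A B d2.
have mfA : measurable_fun [set: V] (EFin \o (fun O => f (A, O))).
  exact: (measurableT_comp mf (pair1_measurable A)).
have -> : dist_L2 B A `^ (2 * (3 / 4)) = Num.sqrt (dist_L2 A B) ^+ 3.
  rewrite dist_L2C -powR_mulrn ?sqrtr_ge0 // -powR12_sqrt ?dist_L2_ge0 //.
  by rewrite -powRrM; congr (_ `^ _); field.
apply: (H1 (fun O => f (A, O)) A B K a j k) => //.
  by move=> O cO; rewrite -ea; case: (fK A O j k cA cO).
move=> O cO; have [_] := fK A O j k cA cO.
by rewrite ea -exprM.
Qed.

(** Both factors belong to the same sheet, so B is integrated against a square instead of two
    independent factors; hence only e^(3/2). *)
Lemma integral_hprob_same : exists2 C : R, 0 < C & forall e (A : V),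
  0 < e -> unit_cube A ->
  (\int[mu]_B \int[mu]_O (hprob e A B O * hprob e A B O)%:E
     <= (C * Num.sqrt e ^+ 3)%:E)%E.
Proof.
have [C C0 H] := integral_hprob_pair.
have d0 : 0 < d%:R :> R by have := dp; lra.
exists (C * (144 * d%:R ^+ 8)); first by rewrite !mulr_gt0 ?exprn_gt0.
move=> e A e0 cA.
apply: (H (fun p => hprob e A p.1 p.2 * hprob e A p.1 p.2) _ _ A) => //.
- have m1 : measurable_fun [set: V * V] (fun p => (hprob e A p.1 p.2)%:E : \bar R).
    by apply: measurable_hprob_comp => //.
  by rewrite [EFin \o _](_ : _ =
    (fun p => (hprob e A p.1 p.2)%:E * (hprob e A p.1 p.2)%:E)%E) //; exact: emeasurable_funM.
- by move=> p; rewrite mulr_ge0 ?hprob_ge0.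
move=> B O j k cB cO /=; set h := hprob e A B O.
have h0 : 0 <= h by exact: hprob_ge0.
split.
  have := hprob_sqrt d2 O e0 cA cB; rewrite -/h => h1.
  have h2 : (h * Num.sqrt (dist_L2 A B)) ^+ 2 <= (6 * d%:R ^+ 3 * Num.sqrt e) ^+ 2.
    by rewrite ler_sqr ?nnegrE ?mulr_ge0 ?sqrtr_ge0 ?exprn_ge0 ?(ltW d0).
  rewrite !exprMn !sqr_sqrtr ?dist_L2_ge0 ?(ltW e0) // in h2.
  apply: (@le_trans _ _ (h ^+ 2 * dist_L2 A B)).
    rewrite -expr2 dist_L2C; apply: ler_wpM2l; first exact: sqr_ge0.
    apply: ler_piMr; first exact: dist_L2_ge0.
    rewrite -[leRHS]sqrtr1; apply: ler_wsqrtr.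
    have /andP[? ?] := cB k; have /andP[? ?] := cO k.
    by rewrite ler_norml; apply/andP; split; lra.
  apply: (le_trans h2); apply: ler_wpM2r; first exact: ltW.
  have -> : 6 ^+ 2 * (d%:R ^+ 2 * (d%:R ^+ 2 * d%:R ^+ 2)) = 36 * d%:R ^+ 6 :> R by ring.
  have d1 := dp; apply: ler_pM; rewrite ?exprn_ge0 ?(ltW d0) //; first by lra.
  exact: ler_weXn2l.
have := hprob_minor d2 j k e0 cA cB cO; rewrite -/h => h1.
have h2 : (h * `|minor O A B j k|) ^+ 2 <= (12 * d%:R ^+ 4 * e) ^+ 2.
  by rewrite ler_sqr ?nnegrE ?mulr_ge0 ?exprn_ge0 ?(ltW d0) ?(ltW e0).
rewrite !exprMn real_normK ?num_real // in h2.
rewrite minorC sqrrN -minor_rot -minor_rot -expr2; apply: (le_trans h2).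
by rewrite le_eqVlt; apply/orP; left; apply/eqP; ring.
Qed.

(** One sheet has foci A, B and passes through O, the other has foci B, O and passes through A. Both
    minors come from the triangle A, B, O and agree up to sign, so the two minor bounds multiply to
    a bound with the squared minor. *)
Lemma integral_hprob_cross : exists2 C : R, 0 < C & forall e (A : V),
  0 < e -> unit_cube A ->
  (\int[mu]_B \int[mu]_O (hprob e A B O * hprob e B O A)%:E
     <= (C * Num.sqrt e ^+ 3)%:E)%E.
Proof.
have [C C0 H] := integral_hprob_pair.
have d0 : 0 < d%:R :> R by have := dp; lra.
have d1 := dp.
exists (C * (144 * d%:R ^+ 8)); first by rewrite !mulr_gt0 ?exprn_gt0.
move=> e A e0 cA.
apply: (H (fun p => hprob e A p.1 p.2 * hprob e p.1 p.2 A) _ _ A) => //.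
- have m1 : measurable_fun [set: V * V] (fun p => (hprob e A p.1 p.2)%:E : \bar R).
    by apply: measurable_hprob_comp => //.
  have m2 : measurable_fun [set: V * V] (fun p => (hprob e p.1 p.2 A)%:E : \bar R).
    by apply: measurable_hprob_comp => //.
  by rewrite [EFin \o _](_ : _ =
    (fun p => (hprob e A p.1 p.2)%:E * (hprob e p.1 p.2 A)%:E)%E) //; exact: emeasurable_funM.
- by move=> p; rewrite mulr_ge0 ?hprob_ge0.
move=> B O j k cB cO /=.
have h10 := hprob_ge0 e A B O; have h20 := hprob_ge0 e B O A.
set h1 := hprob e A B O in h10 *; set h2 := hprob e B O A in h20 *.
have e0' := ltW e0; have d0' := ltW d0.
split.
  have b1 := hprob_sqrt d2 O e0 cA cB; have b2 := hprob_sqrt d2 A e0 cB cO.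
  rewrite -/h1 -/h2 in b1 b2.
  have b3 : (h1 * Num.sqrt (dist_L2 A B)) * (h2 * Num.sqrt (dist_L2 B O)) <=
     (6 * d%:R ^+ 3 * Num.sqrt e) * (6 * d%:R ^+ 3 * Num.sqrt e).
    by apply: ler_pM => //; rewrite mulr_ge0 ?sqrtr_ge0.
  rewrite -expr2 exprMn sqr_sqrtr // in b3.
  (* Of |AB|, one square root is absorbed by the bound for h1 and the other is at most d; the
     coordinate difference is absorbed by the bound for h2, which carries sqrt |BO|. *)
  have b4 : dist_L2 B A <= d%:R * Num.sqrt (dist_L2 A B).
    rewrite dist_L2C -[leLHS](sqr_sqrtr (dist_L2_ge0 A B)) expr2.
    apply: ler_wpM2r; first exact: sqrtr_ge0.
    apply: le_trans (_ : Num.sqrt (d%:R ^+ 2) <= _); last by rewrite sqrtr_sqr ger0_norm.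
    apply: ler_wsqrtr; apply: (le_trans (dist_L2_cube cA cB)).
    by rewrite expr2 ler_peMl.
  have b5 : Num.sqrt `|tnth O k - tnth B k| <= Num.sqrt (dist_L2 B O).
    by apply: ler_wsqrtr; exact: (dist_L2_ge_coord B O k).
  apply: (@le_trans _ _ (h1 * h2 * (d%:R * Num.sqrt (dist_L2 A B) * Num.sqrt (dist_L2 B O)))).
    apply: ler_wpM2l; first exact: mulr_ge0.
      by apply: ler_pM; rewrite ?dist_L2_ge0 ?sqrtr_ge0.
  have -> : h1 * h2 * (d%:R * Num.sqrt (dist_L2 A B) * Num.sqrt (dist_L2 B O)) =
    d%:R * (h1 * Num.sqrt (dist_L2 A B) * (h2 * Num.sqrt (dist_L2 B O))) by ring.
  apply: le_trans (ler_wpM2l d0' b3) _; rewrite mulrA; apply: ler_wpM2r => //.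
  have -> : d%:R * (6 * d%:R ^+ 3) ^+ 2 = 36 * d%:R ^+ 7 :> R by ring.
  apply: ler_pM; rewrite ?exprn_ge0 //; first by lra.
  exact: ler_weXn2l.
have b1 := hprob_minor d2 j k e0 cA cB cO; have b2 := hprob_minor d2 j k e0 cB cO cA.
rewrite -/h1 -/h2 in b1 b2.
have b3 : (h1 * `|minor O A B j k|) * (h2 * `|minor A B O j k|) <=
   (12 * d%:R ^+ 4 * e) * (12 * d%:R ^+ 4 * e) by apply: ler_pM => //; rewrite mulr_ge0.
rewrite (minor_rot O A B) in b3; rewrite (minorC B) sqrrN -minor_rot.
rewrite -(real_normK (num_real (minor A B O j k))).
have -> : h1 * h2 * `|minor A B O j k| ^+ 2 = h1 * `|minor A B O j k| * (h2 * `|minor A B O j k|) by ring.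
by apply: (le_trans b3); rewrite le_eqVlt; apply/orP; left; apply/eqP; ring.
Qed.

End ChainIntegrals.

(** * From the law of the instance to integrals over uniform vertices *)

Section Transfer.
Local Open Scope ereal_scope.
Variables (R : realType) (d n : nat).
Notation V := (d.-tuple R).
Notation config := (n.-tuple (d.-tuple R)).
Notation mu := (@unif_cube R d).

(** The head of s is resampled first and becomes the innermost integral; the last element gives the
    outermost one. *)
Fixpoint resample_seq (s : seq 'I_n) (f : config -> \bar R) : config -> \bar R :=
  if s is i :: s' then resample_seq s' (fun c => \int[mu]_x f (upd c i x)) else f.

Lemma resample_seq_ge0 s f : (forall c, 0 <= f c) -> forall c, 0 <= resample_seq s f c.
Proof.
by elim: s f => //= i s IH f f0; apply: IH => c; exact: integral_ge0.
Qed.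

Lemma measurable_resample_seq s f : measurable_fun setT f -> (forall c, 0 <= f c) ->
  measurable_fun setT (resample_seq s f).
Proof.
elim: s f => //= i s IH f mf f0; apply: IH; first exact: measurable_resample_cube.
by move=> c; exact: integral_ge0.
Qed.

Variables (disp : measure_display) (Omega : measurableType disp).
Variables (P : probability Omega R) (v : 'I_n -> {RV P >-> d.-tuple R}) (phi : R).
Hypothesis phi0 : (0 <= phi)%R.
Hypothesis vP : perturbed_instance phi v.

Lemma le_resample_seq s f : measurable_fun setT f -> (forall c, 0 <= f c) ->
  \int[sample_law v]_c f c <=
    (phi ^+ size s)%:E * \int[sample_law v]_c resample_seq s f c.
Proof.
elim: s f => [|i s IH] f mf f0 /=; first by rewrite expr0 mul1e.
apply: (le_trans (resample_vertex i phi0 vP mf f0)).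
rewrite exprS EFinM -muleA lee_wpmul2l ?lee_fin //; apply: IH.
  exact: measurable_resample_cube.
by move=> c; exact: integral_ge0.
Qed.

Lemma measurable_vertex_out i : measurable [set c : config | ~ unit_cube (tnth c i)].
Proof.
have -> : [set c : config | ~ unit_cube (tnth c i)] = (fun c => tnth c i) @^-1` (~` @unit_cube R d) by [].
rewrite -[X in measurable X]setTI; apply: (@measurable_tnth _ V n i) => //.
by apply: measurableC; exact: measurable_unit_cube.
Qed.

Lemma sample_law_vertex_out i : sample_law v [set c | ~ unit_cube (tnth c i)] = 0.
Proof.
have mB := measurable_vertex_out i.
apply/eqP; rewrite eq_le measure_ge0 andbT.
have -> : sample_law v [set c | ~ unit_cube (tnth c i)] =
    \int[sample_law v]_c (\1_[set c : config | ~ unit_cube (tnth c i)] c)%:E.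
  by rewrite integral_indic // setIT.
apply: le_trans (resample_vertex i phi0 vP _ _) _.
- exact: measurable_indic_EFin.
- by move=> c; rewrite lee_fin.
- have mC : measurable (~` @unit_cube R d) by apply: measurableC; exact: measurable_unit_cube.
  rewrite (eq_integral (fun=> 0)) ?integral0 ?mule0 // => c _.
  transitivity (\int[mu]_x (\1_(~` @unit_cube R d) x)%:E).
    apply: eq_integral => x _; rewrite !indicE; congr (_ (nat_of_bool _))%:E.
    by apply/idP/idP; rewrite !inE /= upd_same.
  rewrite integral_indic // setIT; exact: unif_cube_out.
Qed.

(** The bound is only required when vertex i lies in the cube, an almost sure event. A vertex left
    out of s in this way costs no factor phi. *)
Lemma sample_law_resample_le s i (B : set config) (K : R) :
  measurable B -> (0 <= K)%R ->
  (forall c, unit_cube (tnth c i) -> resample_seq s (fun c => (\1_B c)%:E) c <= K%:E) ->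
  sample_law v B <= (phi ^+ size s * K)%:E.
Proof.
move=> mB K0 h.
have m1 : measurable_fun setT (fun c : config => (\1_B c)%:E : \bar R) by exact: measurable_indic_EFin.
have f0 c : 0 <= (\1_B c)%:E :> \bar R by rewrite lee_fin.
have -> : sample_law v B = \int[sample_law v]_c (\1_B c)%:E.
  by rewrite integral_indic // setIT.
apply: (le_trans (le_resample_seq s m1 f0)).
rewrite EFinM lee_wpmul2l ?lee_fin ?exprn_ge0 //.
rewrite -[leRHS](integral_prob_cst (sample_law v) K%:E).
apply: (@le_integral_off_null R _ config (sample_law v) [set c | ~ unit_cube (tnth c i)]) => //.
- exact: measurable_vertex_out.
- exact: sample_law_vertex_out.
- exact: measurable_resample_seq.
- exact: resample_seq_ge0.
- by move=> c /contrapT; exact: h.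
Qed.

Lemma integral_two_near (F : V -> V -> \bar R) A B t A' B' t' e :
  (forall y z, 0 <= F y z) ->
  (forall y z, F y z <= (\1_(near_hyp A' B' t' e) y)%:E * (\1_(near_hyp A B t e) z)%:E) ->
  \int[mu]_y \int[mu]_z F y z <= (hyp_prob A B t e * hyp_prob A' B' t' e)%:E.
Proof.
move=> F0 FN; have mA := measurable_near_hyp A B t e; have mA' := measurable_near_hyp A' B' t' e.
apply: (@le_trans _ _ (\int[mu]_y ((\1_(near_hyp A' B' t' e) y)%:E * (hyp_prob A B t e)%:E))).
  apply: ge0_le_integralT => [y|y]; first exact: integral_ge0.
  apply: (@le_trans _ _ (\int[mu]_z ((\1_(near_hyp A' B' t' e) y)%:E * (\1_(near_hyp A B t e) z)%:E))).
    exact: ge0_le_integralT.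
  rewrite ge0_integralZl ?lee_fin //; last by apply: measurable_indic_EFin.
  by rewrite integral_indic // setIT -hyp_probE.
rewrite ge0_integralZr ?lee_fin ?hyp_prob_ge0 //; last by apply: measurable_indic_EFin.
by rewrite integral_indic // setIT mulrC EFinM -[X in _ <= X * _]hyp_probE.
Qed.

Lemma indic_prod_ge (T : Type) (S : set T) (A1 A2 : set V) (c : T) y z :
  (S c -> A1 y /\ A2 z) -> (\1_S c)%:E <= (\1_A1 y)%:E * (\1_A2 z)%:E :> \bar R.
Proof.
move=> h; rewrite -EFinM lee_fin !indicE.
have [/set_mem/h [h1 h2]|_] := boolP (c \in S); first by rewrite !mem_set ?mulr1.
by rewrite mulr_ge0.
Qed.

(** The gain is |x4 x3| - |x4 x2| minus the same difference taken at x1. As a condition on x4 it is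
    closeness to the sheet through x1 with foci x3 and x2. *)
Lemma near_hyp_gain (x1 x2 x3 x4 : V) e :
  (0 < dist_L2 x1 x2 + dist_L2 x3 x4 - dist_L2 x1 x3 - dist_L2 x2 x4 <= e)%R ->
  near_hyp x3 x2 (dist_L2 x1 x3 - dist_L2 x1 x2) e x4.
Proof.
rewrite /near_hyp /= (dist_L2C x4 x3) (dist_L2C x4 x2) ler_norml => /andP[? ?].
by apply/andP; split; lra.
Qed.

Lemma near_hyp_gain_sym (x1 x2 x3 x4 : V) e :
  (0 < dist_L2 x1 x2 + dist_L2 x3 x4 - dist_L2 x1 x3 - dist_L2 x2 x4 <= e)%R ->
  near_hyp x2 x3 (dist_L2 x1 x2 - dist_L2 x1 x3) e x4.
Proof.
rewrite /near_hyp /= (dist_L2C x4 x3) (dist_L2C x4 x2) ler_norml => /andP[? ?].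
by apply/andP; split; lra.
Qed.

Lemma near_hyp_gain_mid (x1 x3 y x2 : V) e :
  (0 < dist_L2 x1 x3 + dist_L2 y x2 - dist_L2 x1 y - dist_L2 x3 x2 <= e)%R ->
  near_hyp x2 x1 (dist_L2 x3 x2 - dist_L2 x3 x1) e y.
Proof.
rewrite /near_hyp /= (dist_L2C y x1) (dist_L2C x3 x1) ler_norml => /andP[? ?].
by apply/andP; split; lra.
Qed.

End Transfer.

(** * Linked gains in the Euclidean metric *)

Section EuclideanPairs.
Local Open Scope ereal_scope.
Variables (R : realType) (d : nat).
Notation V := (d.-tuple R).
Hypothesis d2 : (2 <= d)%N.

(** The last vertices v4 and v6 occur in one gain each and are confined to sheets through v1 with
    the common focus v3. In the integral, v3 is A, v1 is O, and the other foci v2 and v5 are B and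
    B'. *)
Lemma euclidean_disjoint_le : exists2 C : R, (0 < C)%R &
  forall n disp (Omega : measurableType disp) (P : probability Omega R)
    (v : 'I_n -> {RV P >-> d.-tuple R}) (phi e : R) (v1 v2 v3 v4 v5 v6 : 'I_n),
  (0 <= phi)%R -> perturbed_instance phi v -> (0 < e)%R ->
  uniq [:: v1; v2; v3; v4; v5; v6] ->
  sample_law v (gain_event (@dist_L2 R d) e v1 v2 v3 v4 v5 v6) <=
    (phi ^+ 5 * (C * e `^ (15 / 8)))%:E.
Proof.
have [C C0 H] := @integral_two_hprob R d d2; exists C => //.
move=> n disp Omega P v phi e v1 v2 v3 v4 v5 v6 phi0 vP e0 u.
have N := @nth_uniq _ v1 [:: v1; v2; v3; v4; v5; v6].
have E := ((N 0%N 1%N isT isT u : (v1 == v2) = false),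
    (N 0%N 2%N isT isT u : (v1 == v3) = false),
    (N 0%N 3%N isT isT u : (v1 == v4) = false),
    (N 0%N 4%N isT isT u : (v1 == v5) = false),
    (N 0%N 5%N isT isT u : (v1 == v6) = false),
    (N 1%N 0%N isT isT u : (v2 == v1) = false),
    (N 1%N 2%N isT isT u : (v2 == v3) = false),
    (N 1%N 3%N isT isT u : (v2 == v4) = false),
    (N 1%N 4%N isT isT u : (v2 == v5) = false),
    (N 1%N 5%N isT isT u : (v2 == v6) = false),
    (N 2%N 0%N isT isT u : (v3 == v1) = false),
    (N 2%N 1%N isT isT u : (v3 == v2) = false),
    (N 2%N 3%N isT isT u : (v3 == v4) = false),
    (N 2%N 4%N isT isT u : (v3 == v5) = false),
    (N 2%N 5%N isT isT u : (v3 == v6) = false),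
    (N 3%N 0%N isT isT u : (v4 == v1) = false),
    (N 3%N 1%N isT isT u : (v4 == v2) = false),
    (N 3%N 2%N isT isT u : (v4 == v3) = false),
    (N 3%N 4%N isT isT u : (v4 == v5) = false),
    (N 3%N 5%N isT isT u : (v4 == v6) = false),
    (N 4%N 0%N isT isT u : (v5 == v1) = false),
    (N 4%N 1%N isT isT u : (v5 == v2) = false),
    (N 4%N 2%N isT isT u : (v5 == v3) = false),
    (N 4%N 3%N isT isT u : (v5 == v4) = false),
    (N 4%N 5%N isT isT u : (v5 == v6) = false),
    (N 5%N 0%N isT isT u : (v6 == v1) = false),
    (N 5%N 1%N isT isT u : (v6 == v2) = false),
    (N 5%N 2%N isT isT u : (v6 == v3) = false),
    (N 5%N 3%N isT isT u : (v6 == v4) = false),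
    (N 5%N 4%N isT isT u : (v6 == v5) = false)).
apply: (sample_law_resample_le (s := [:: v4; v6; v2; v5; v1]) (i := v3) phi0 vP).
- exact: (measurable_gain_event _ _ _ _ _ _ _ (@measurable_dist_L2 R d)).
- by rewrite mulr_ge0 ?powR_ge0 ?ltW.
move=> c c3 /=; apply: le_trans (H e (tnth c v3) e0 c3).
apply: ge0_le_integralT => [x1|x1].
  by do 4 (apply: integral_ge0 => ? _); rewrite lee_fin.
apply: ge0_le_integralT => [x5|x5].
  by do 3 (apply: integral_ge0 => ? _); rewrite lee_fin.
apply: ge0_le_integralT => [x2|x2].
  by do 2 (apply: integral_ge0 => ? _); rewrite lee_fin.
apply: integral_two_near => [x6 x4|x6 x4]; first by rewrite lee_fin.
apply: indic_prod_ge => -[]; rewrite /gain !tnth_upd !eqxx !E => g1 g2; split.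
  exact: near_hyp_gain_sym g2.
exact: near_hyp_gain g1.
Qed.

(** With A, B, O = v3, v2, v1, vertex v4 is near the sheet through O with foci A and B. When v2 is
    the third vertex of the second 2-change, w is near the same sheet; when v2 is its fourth vertex,
    w is near the sheet through A with foci B and O. *)
Lemma euclidean_chain_le : exists2 C : R, (0 < C)%R &
  forall n disp (Omega : measurableType disp) (P : probability Omega R)
    (v : 'I_n -> {RV P >-> d.-tuple R}) (phi e : R) (v1 v2 v3 v4 w : 'I_n),
  (0 <= phi)%R -> perturbed_instance phi v -> (0 < e)%R ->
  uniq [:: v1; v2; v3; v4; w] ->
  sample_law v (gain_event (@dist_L2 R d) e v1 v2 v3 v4 v2 w) <=
    (phi ^+ 4 * (C * Num.sqrt e ^+ 3))%:E /\
  sample_law v (gain_event (@dist_L2 R d) e v1 v2 v3 v4 w v2) <=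
    (phi ^+ 4 * (C * Num.sqrt e ^+ 3))%:E.
Proof.
have [C1 C10 H1] := @integral_hprob_same R d d2.
have [C2 C20 H2] := @integral_hprob_cross R d d2.
exists (C1 + C2)%R; first exact: addr_gt0.
move=> n disp Omega P v phi e v1 v2 v3 v4 w phi0 vP e0 u.
have N := @nth_uniq _ v1 [:: v1; v2; v3; v4; w].
have E := ((N 0%N 1%N isT isT u : (v1 == v2) = false),
    (N 0%N 2%N isT isT u : (v1 == v3) = false),
    (N 0%N 3%N isT isT u : (v1 == v4) = false),
    (N 0%N 4%N isT isT u : (v1 == w) = false),
    (N 1%N 0%N isT isT u : (v2 == v1) = false),
    (N 1%N 2%N isT isT u : (v2 == v3) = false),
    (N 1%N 3%N isT isT u : (v2 == v4) = false),
    (N 1%N 4%N isT isT u : (v2 == w) = false),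
    (N 2%N 0%N isT isT u : (v3 == v1) = false),
    (N 2%N 1%N isT isT u : (v3 == v2) = false),
    (N 2%N 3%N isT isT u : (v3 == v4) = false),
    (N 2%N 4%N isT isT u : (v3 == w) = false),
    (N 3%N 0%N isT isT u : (v4 == v1) = false),
    (N 3%N 1%N isT isT u : (v4 == v2) = false),
    (N 3%N 2%N isT isT u : (v4 == v3) = false),
    (N 3%N 4%N isT isT u : (v4 == w) = false),
    (N 4%N 0%N isT isT u : (w == v1) = false),
    (N 4%N 1%N isT isT u : (w == v2) = false),
    (N 4%N 2%N isT isT u : (w == v3) = false),
    (N 4%N 3%N isT isT u : (w == v4) = false)).
have K0 : (0 <= (C1 + C2) * Num.sqrt e ^+ 3)%R.
  by rewrite mulr_ge0 ?exprn_ge0 ?sqrtr_ge0 // ltW // addr_gt0.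
have s0 : (0 <= Num.sqrt e ^+ 3)%R by rewrite exprn_ge0 ?sqrtr_ge0.
split; apply: (sample_law_resample_le (s := [:: v4; w; v1; v2]) (i := v3) phi0 vP) => //;
  try exact: (measurable_gain_event _ _ _ _ _ _ _ (@measurable_dist_L2 R d)).
- move=> c c3 /=; apply: (@le_trans _ _ (C1 * Num.sqrt e ^+ 3)%:E); last first.
    by rewrite lee_fin ler_wpM2r // lerDl ltW.
  apply: le_trans (H1 e (tnth c v3) e0 c3).
  apply: ge0_le_integralT => [x2|x2].
    by do 3 (apply: integral_ge0 => ? _); rewrite lee_fin.
  apply: ge0_le_integralT => [x1|x1].
    by do 2 (apply: integral_ge0 => ? _); rewrite lee_fin.
  apply: integral_two_near => [x6 x4|x6 x4]; first by rewrite lee_fin.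
  apply: indic_prod_ge => -[]; rewrite /gain !tnth_upd !eqxx !E => g1 g2; split.
    exact: near_hyp_gain_sym g2.
  exact: near_hyp_gain g1.
- move=> c c3 /=; apply: (@le_trans _ _ (C2 * Num.sqrt e ^+ 3)%:E); last first.
    by rewrite lee_fin ler_wpM2r // lerDr ltW.
  apply: le_trans (H2 e (tnth c v3) e0 c3).
  apply: ge0_le_integralT => [x2|x2].
    by do 3 (apply: integral_ge0 => ? _); rewrite lee_fin.
  apply: ge0_le_integralT => [x1|x1].
    by do 2 (apply: integral_ge0 => ? _); rewrite lee_fin.
  apply: integral_two_near => [x5 x4|x5 x4]; first by rewrite lee_fin.
  apply: indic_prod_ge => -[]; rewrite /gain !tnth_upd !eqxx !E => g1 g2; split.
    exact: near_hyp_gain_mid g2.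
  exact: near_hyp_gain g1.
Qed.

(** Reading the shared edge from its other end turns coincidences of v5 or v6 with v4 into
    coincidences with v2. *)
Lemma gain_event_swap n (e : R) (v1 v2 v3 v4 v5 v6 : 'I_n) :
  gain_event (@dist_L2 R d) e v1 v2 v3 v4 v5 v6 =
  gain_event (@dist_L2 R d) e v3 v4 v1 v2 v6 v5.
Proof.
rewrite /gain_event; apply/seteqP; split => c /=; rewrite /gain.
  rewrite (dist_L2C (tnth c v3) (tnth c v1)) (dist_L2C (tnth c v4) (tnth c v2)) (dist_L2C (tnth c v6)).
  move=> [/andP[? ?] /andP[? ?]]; split; apply/andP; split; lra.
rewrite (dist_L2C (tnth c v3) (tnth c v1)) (dist_L2C (tnth c v4) (tnth c v2)) (dist_L2C (tnth c v6)).
move=> [/andP[? ?] /andP[? ?]]; split; apply/andP; split; lra.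
Qed.

End EuclideanPairs.

(** * Expected path length *)

Section DyadicTail.
Local Open Scope ereal_scope.
Context d (T : measurableType d) (R : realType) (mu : probability T R).

(** If 4^l * t0 <= x < 4^(l+1) * t0, the term of index l alone covers x. *)
Lemma le_dyadic_sum (t0 x : R) (b : nat -> bool) L : (0 < t0)%R ->
  (forall l, 4 ^+ l * t0 <= x -> b l)%R -> (x < 4 ^+ L * t0)%R ->
  (x <= t0 + \sum_(l < L) 4 ^+ l.+1 * t0 * (b l)%:R)%R.
Proof.
move=> t00 hb; elim: L => [|L IH]; first by rewrite expr0 mul1r big_ord0 addr0 => /ltW.
move=> xL; rewrite big_ord_recr /= addrA.
have [h|h] := ltP x (4 ^+ L * t0)%R.
  by apply: le_trans (IH h) _; rewrite lerDl !mulr_ge0 ?exprn_ge0 // ltW.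
rewrite (hb _ h) mulr1; apply: (le_trans (ltW xL)); rewrite lerDr.
apply: addr_ge0; first exact: ltW.
by apply: sumr_ge0 => l _; rewrite !mulr_ge0 ?exprn_ge0 // ltW.
Qed.

Lemma sum_geometric_half_le (L : nat) : (\sum_(l < L) (1 / 2) ^+ l <= (2 : R))%R.
Proof.
have -> : (\sum_(l < L) (1 / 2) ^+ l = 2 - 2 * (1 / 2) ^+ L :> R)%R.
  elim: L => [|L IH]; first by rewrite big_ord0 expr0; lra.
  by rewrite big_ord_recr /= IH exprS; lra.
by rewrite lerBlDr lerDl mulr_ge0 ?exprn_ge0.
Qed.

(** The weights 4^(l+1) * t0 against a tail K / 8^l sum to at most 8 * t0 * K. The rate 1/8 is that
    of e^(3/2) when e shrinks by the factor 4. The events [B l] carry the measurability, and M only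
    makes the sum finite. *)
Lemma expectation_dyadic_tail (X : T -> R) (B : nat -> set T) (t0 K M : R) :
  (0 < t0)%R -> (forall w, 0 <= X w <= M)%R -> (forall l, measurable (B l)) ->
  (forall l w, 4 ^+ l * t0 <= X w -> B l w)%R ->
  (forall l, mu (B l) <= (K * (1 / 8) ^+ l)%:E) ->
  'E_mu[X] <= (t0 * (1 + 8 * K))%:E.
Proof.
move=> t00 X0M mB XB muB; rewrite unlock.
have K0 : (0 <= K)%R.
  by have := le_trans (measure_ge0 mu (B 0%N)) (muB 0%N); rewrite expr0 mulr1 lee_fin.
have [L hL] : exists L, (M < 4 ^+ L * t0)%R.
  have [L hL] : exists L : nat, (M / t0 < L%:R)%R.
    by exists (Num.bound `|M / t0|%R); exact: le_lt_trans (ler_norm _) (archi_boundP (normr_ge0 _)).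
  exists L; rewrite -ltr_pdivrMr //; apply: (lt_le_trans hL).
  by rewrite -natrX ler_nat ltnW // ltn_expl.
apply: (@le_trans _ _ (\int[mu]_w (t0%:E + \sum_(l < L) (4 ^+ l.+1 * t0)%:E * (\1_(B l) w)%:E))).
  apply: ge0_le_integralT => w; first by rewrite lee_fin; case/andP: (X0M w).
  under eq_bigr do rewrite -EFinM; rewrite sumEFin -EFinD lee_fin.
  apply: (@le_dyadic_sum t0 (X w) (fun l => w \in B l)) => //.
    by move=> l h; apply: mem_set; exact: XB.
  by apply: le_lt_trans hL; case/andP: (X0M w).
have m1 l : measurable_fun setT (fun w => (\1_(B l) w)%:E : \bar R).
  by apply: measurable_indic_EFin.
have c0 l : (0 <= 4 ^+ l * t0)%R by rewrite mulr_ge0 ?exprn_ge0 // ltW.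
have m2 l : measurable_fun setT (fun w => (4 ^+ l.+1 * t0)%:E * (\1_(B l) w)%:E : \bar R).
  exact: measurable_funeM.
have p2 l w : 0 <= (4 ^+ l.+1 * t0)%:E * (\1_(B l) w)%:E :> \bar R.
  by rewrite mule_ge0 ?lee_fin.
have p0 w : 0 <= t0%:E :> \bar R by rewrite lee_fin ltW.
rewrite ge0_integralD //; last 2 first.
- by move=> w _; apply: sume_ge0.
- by apply: emeasurable_sum => l.
rewrite integral_prob_cst ge0_integral_sum //.
rewrite mulrDr mulr1 EFinD leeD2l //.
apply: (@le_trans _ _ (\sum_(l < L) (4 * t0 * K * (1 / 2) ^+ l)%:E)).
  apply: lee_sum => l _; rewrite ge0_integralZl ?lee_fin //.
  rewrite integral_indic // setIT.
  apply: (le_trans (lee_wpmul2l _ (muB l))); first by rewrite lee_fin.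
  rewrite -EFinM lee_fin exprS -!mulrA ler_pM2l // mulrCA ler_pM2l // mulrCA ler_wpM2l //.
  by rewrite -exprMn; have -> : (4 * (1 / 8) = 1 / 2 :> R)%R by field.
rewrite sumEFin lee_fin -mulr_sumr.
have h := sum_geometric_half_le L.
have -> : (t0 * (8 * K) = 4 * t0 * K * 2)%R by ring.
by apply: ler_wpM2l => //; rewrite !mulr_ge0 // ltW.
by move=> w _; exact: p0.
Qed.

End DyadicTail.

Lemma longest_path_le (V : finType) (e : rel V) : (longest_path e <= #|V|)%N.
Proof. by apply/bigmax_leqP => k _; exact: ltnW. Qed.

Lemma card_tour_small n : (n <= 2)%N -> #|{: tour n}| = 0%N.
Proof.
move=> n2; apply: eq_card0 => T; have /andP[] := valP T.
by rewrite ltnNge n2.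
Qed.

(** * Long paths and the event of linked gains *)

Section LinkedEvent.
Local Open Scope ereal_scope.
Variables (R : realType) (d n : nat).
Notation V := (d.-tuple R).
Notation config := (n.-tuple (d.-tuple R)).
Variable dist : V -> V -> R.
Hypothesis dist_sym : forall p q, dist p q = dist q p.
Hypothesis dist_ge0 : forall p q, (0 <= dist p q)%R.
Hypothesis dist_le : forall p q, unit_cube p -> unit_cube q -> (dist p q <= d%:R)%R.
Hypothesis measurable_dist : measurable_fun [set: V * V] (fun p => dist p.1 p.2).

Notation six := ('I_n * 'I_n * 'I_n * 'I_n * 'I_n * 'I_n)%type.

Definition linked (p : six) : bool :=
  let: (v1, v2, v3, v4, v5, v6) := p in
  [&& uniq [:: v1; v2; v3; v4], uniq [:: v1; v3; v5; v6] &
      [set v5; v6]%SET != [set v2; v4]%SET].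

Definition gain_event6 e (p : six) : set config :=
  let: (v1, v2, v3, v4, v5, v6) := p in gain_event dist e v1 v2 v3 v4 v5 v6.

Definition linked_event e : set config :=
  \bigcup_(p in [set p | linked p]) gain_event6 e p.

Lemma measurable_gain_event6 e p : measurable (gain_event6 e p).
Proof.
by case: p => [[[[[v1 v2] v3] v4] v5] v6]; exact: measurable_gain_event.
Qed.

Lemma measurable_linked_event e : measurable (linked_event e).
Proof.
apply: fin_bigcup_measurable; first exact: finite_finset.
by move=> p _; exact: measurable_gain_event6.
Qed.

(** Vertices lie in the cube only almost surely; this null event collects the configurations where
    the bound d on the distances may fail. *)
Definition some_vertex_out : set config :=
  \bigcup_(i in [set: 'I_n]) [set c | ~ unit_cube (tnth c i)].

Lemma measurable_some_vertex_out : measurable some_vertex_out.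
Proof.
apply: fin_bigcup_measurable; first exact: finite_finset.
by move=> i _; exact: measurable_vertex_out.
Qed.

Variables (disp : measure_display) (Omega : measurableType disp).
Variables (P : probability Omega R) (v : 'I_n -> {RV P >-> V}) (phi : R).
Hypothesis phi0 : (0 <= phi)%R.
Hypothesis vP : perturbed_instance phi v.

Lemma sample_law_some_vertex_out : sample_law v some_vertex_out = 0.
Proof.
apply/eqP; rewrite eq_le measure_ge0 andbT.
have := @measure_finite_cover _ _ R (sample_law v) _ xpredT
  (fun i => [set c : config | ~ unit_cube (tnth c i)]) some_vertex_out 0.
rewrite mulr0; apply => //.
- exact: measurable_vertex_out.
- exact: measurable_some_vertex_out.
- by move=> c [i _ h]; exists i.
- move=> i _; rewrite le_eqVlt; apply/orP; left; apply/eqP.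
  exact: sample_law_vertex_out phi0 vP i.
Qed.

Lemma long_path_linked_event w e :
  let T := longest_path (two_opt_arc dist (fun i => v i w)) in
  (0 < e)%R -> (4 * n < T)%N -> (12 * n%:R * d%:R <= e * T%:R)%R ->
  (some_vertex_out `|` linked_event e) (sample v w).
Proof.
move=> T e0 nT eT.
have [[i ci]|out] := pselect (exists i, ~ unit_cube (v i w)).
  by left; exists i => //=; rewrite tnth_sample.
right; have cube i : unit_cube (v i w) by apply: contrapT => h; apply: out; exists i.
have [v1 [v2 [v3 [v4 [v5 [v6 [u1 u2 ne g1 g2]]]]]]] :=
  linked_gains_of_path (x := fun i => v i w) dist_sym dist_ge0
    (fun i j => dist_le (cube i) (cube j)) e0 nT eT (leqnn T).
exists (v1, v2, v3, v4, v5, v6); first exact/and3P.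
by split; rewrite /gain !tnth_sample.
Qed.

(** At length at least 4^l * t0 > 4 n, tour lengths of at most n * d produce linked gains at the
    threshold e = 12 n d / (4^l * t0), with the constant 12 of the counting argument. *)
Lemma expectation_longest_path_le (t0 K : R) :
  (0 < t0)%R -> (4 * n%:R < t0)%R -> (0 < n)%N -> (0 < d)%N ->
  (forall l, sample_law v (linked_event (12 * n%:R * d%:R / (4 ^+ l * t0))) <=
     (K * (1 / 8) ^+ l)%:E) ->
  'E_P[longest_2opt_path dist v] <= (t0 * (1 + 8 * K))%:E.
Proof.
move=> t00 nt0 n0 d0 tail.
have s0 l : (0 < 4 ^+ l * t0)%R by rewrite mulr_gt0 ?exprn_gt0.
pose e l := (12 * n%:R * d%:R / (4 ^+ l * t0))%R.
have e0 l : (0 < e l)%R by rewrite divr_gt0 // !mulr_gt0 // ltr0n.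
have mB l : measurable (some_vertex_out `|` linked_event (e l)).
  by apply: measurableU; [exact: measurable_some_vertex_out|exact: measurable_linked_event].
apply: (@expectation_dyadic_tail _ _ _ _ _
  (fun l => sample v @^-1` (some_vertex_out `|` linked_event (e l))) t0 K #|{: tour n}|%:R) => //.
- by move=> w; rewrite ler0n ler_nat longest_path_le.
- by move=> l; rewrite -[X in measurable X]setTI; exact: measurable_sample.
- move=> l w lT; apply: long_path_linked_event => //.
    rewrite -(ltr_nat R) natrM; apply: lt_le_trans lT.
    by apply: (lt_le_trans nt0); rewrite ler_peMl ?(ltW t00) // exprn_ege1 // ler1n.
  by rewrite /e [leRHS]mulrAC ler_pdivlMr // ler_wpM2l.
- move=> l; apply: le_trans (tail l).
  apply: (le_trans (measureU2 (sample_law v) measurable_some_vertex_out (measurable_linked_event (e l)))).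
  by rewrite [X in X + _]sample_law_some_vertex_out add0e.
Qed.

End LinkedEvent.

(** * The Manhattan bound *)

Section Manhattan.
Variables (R : realType) (d : nat).
Notation V := (d.-tuple R).

Lemma dist_L1C (p q : V) : dist_L1 p q = dist_L1 q p.
Proof. by rewrite /dist_L1; apply: eq_bigr => k _; rewrite distrC. Qed.

Lemma dist_L1_ge0 (p q : V) : 0 <= dist_L1 p q.
Proof. exact: sumr_ge0. Qed.

Lemma dist_L1_cube (p q : V) : unit_cube p -> unit_cube q -> dist_L1 p q <= d%:R.
Proof.
move=> cp cq; rewrite /dist_L1 -[X in _ <= X%:R]card_ord -sumr_const.
apply: ler_sum => k _; have /andP[? ?] := cp k; have /andP[? ?] := cq k.
by rewrite ler_norml; apply/andP; split; lra.
Qed.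

Lemma manhattan_linked_event_le : exists2 C : R, 0 <= C &
  forall n disp (Omega : measurableType disp) (P : probability Omega R)
    (v : 'I_n -> {RV P >-> V}) (phi e : R),
  1 <= phi -> perturbed_instance phi v -> 0 <= e ->
  (sample_law v (linked_event (@dist_L1 R d) e) <= (n%:R ^+ 6 * (C * phi ^+ 2 * e ^+ 2))%:E)%E.
Proof.
set param := ({ffun 'I_d -> 7.-tuple bool} * ('I_6 * 'I_d) * ('I_6 * 'I_d) * 'I_3)%type.
exists (#|{: param}|%:R * 2) => // n disp Omega P v phi e phi1 vP e0.
have K0 : 0 <= #|{: param}|%:R * 2 * phi ^+ 2 * e ^+ 2.
  by rewrite mulr_ge0 ?sqr_ge0 // mulr_ge0 ?sqr_ge0.
have := @measure_finite_cover _ _ R (sample_law v) _ (@linked n)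
  (gain_event6 (@dist_L1 R d) e) (linked_event (@dist_L1 R d) e) _ _ _ K0.
rewrite !card_prod !card_ord.
have -> : (n * n * n * n * n * n)%:R = n%:R ^+ 6 :> R by rewrite !natrM; ring.
apply.
- by move=> p; apply: measurable_gain_event6; exact: measurable_dist_L1.
- by apply: measurable_linked_event; exact: measurable_dist_L1.
- by move=> c [p hp h]; exists p.
- move=> [[[[[v1 v2] v3] v4] v5] v6] /and3P[u1 u2 ne].
  have := manhattan_gain_event_le phi1 vP u1 u2 ne e0.
  by rewrite !card_prod !card_ord !mulrA.
Qed.

Lemma manhattan_expectation : exists2 C : R, 0 <= C &
    forall (n : nat) (phi : R) (disp : measure_display)
      (Omega : measurableType disp) (P : probability Omega R)
      (v : 'I_n -> {RV P >-> d.-tuple R}),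
      (2 < n)%N -> (0 < d)%N -> 1 <= phi -> perturbed_instance phi v ->
      ('E_P[longest_2opt_path (@dist_L1 R d) v]
         <= (C * (n%:R ^+ 4 * phi))%:E)%E.
Proof.
have [C C0 H] := manhattan_linked_event_le.
exists (1 + 8 * (C * (144 * d%:R ^+ 2))) => [|n phi disp Omega P v n2 d0 phi1 vP];
  first by rewrite addr_ge0 ?mulr_ge0 ?exprn_ge0.
have phi0 : 0 < phi by apply: lt_le_trans phi1.
have n3 : 3 <= n%:R :> R by rewrite ler_nat.
have nr0 : 0 < n%:R :> R by apply: lt_le_trans n3.
set t0 := n%:R ^+ 4 * phi.
have t00 : 0 < t0 by rewrite mulr_gt0 ?exprn_gt0.
rewrite mulrC.
apply: (expectation_longest_path_le dist_L1C dist_L1_ge0 dist_L1_cube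
  (@measurable_dist_L1 R d) (ltW phi0) vP) => //.
- apply: lt_le_trans (_ : n%:R ^+ 4 <= _); last by rewrite ler_peMr // exprn_ge0 // ltW.
  rewrite exprSr ltr_pM2r //; apply: lt_le_trans (_ : 3 ^+ 3 <= _); first by lra.
  by rewrite lerXn2r // nnegrE ltW.
- exact: ltnW (ltnW n2).
move=> l; set e := _ / _.
have e0 : 0 <= e by rewrite divr_ge0 ?mulr_ge0 ?exprn_ge0 // ltW.
apply: (le_trans (H _ _ _ _ _ _ _ phi1 vP e0)); rewrite lee_fin.
(* The scale t0 = n^4 * phi is the one at which all powers of n and phi cancel; 144 is the square of
   the 12 in e. *)
have -> : n%:R ^+ 6 * (C * phi ^+ 2 * e ^+ 2) = C * (144 * d%:R ^+ 2) * (1 / 16) ^+ l.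
  have -> : (1 / 16) ^+ l = 1 / (4 ^+ l) ^+ 2 :> R.
    by rewrite exprAC expr_div_n expr1n; congr (_ / _ ^+ _); ring.
  have s0 : 4 ^+ l != 0 :> R by rewrite expf_neq0.
  by rewrite /e /t0; field; rewrite s0 !gt_eqF.
apply: ler_wpM2l; first by rewrite !mulr_ge0 ?exprn_ge0.
by rewrite lerXn2r ?nnegrE //; lra.
Qed.

End Manhattan.

(** * The Euclidean bound *)

Section Euclidean.
Variables (R : realType) (d : nat).
Notation V := (d.-tuple R).
Hypothesis d2 : (2 <= d)%N.

(** At most one of v5, v6 lies in {v2, v4}, since otherwise the two sets would be equal.
    Coincidences with v4 are listed in the order in which [gain_event_swap] reads them. *)
Lemma linked_cases n (v1 v2 v3 v4 v5 v6 : 'I_n) :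
  linked (v1, v2, v3, v4, v5, v6) ->
  [\/ uniq [:: v1; v2; v3; v4; v5; v6],
      v5 = v2 /\ uniq [:: v1; v2; v3; v4; v6],
      v6 = v2 /\ uniq [:: v1; v2; v3; v4; v5] |
      (v5 = v4 /\ uniq [:: v3; v4; v1; v2; v6]) \/
      (v6 = v4 /\ uniq [:: v3; v4; v1; v2; v5])].
Proof.
move=> /and3P[].
rewrite /= !inE !negb_or !andbT.
move=> /and3P[/and3P[a12 a13 a14] /andP[a23 a24] a34].
move=> /and3P[/and3P[_ a15 a16] /andP[a35 a36] a56] ne.
have [e5|n52] := eqVneq v5 v2.
  subst v5; apply: Or42; split => //.
  have n64 : v6 != v4 by apply: contra ne => /eqP ->.
  by repeat (apply/andP; split); rewrite // eq_sym.
have [e6|n62] := eqVneq v6 v2.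
  subst v6; apply: Or43; split => //.
  have n54 : v5 != v4 by apply: contra ne => /eqP ->; rewrite finset.setUC.
  by repeat (apply/andP; split); rewrite // eq_sym.
have [e5|n54] := eqVneq v5 v4.
  by subst v5; apply: Or44; left; split => //; repeat (apply/andP; split); rewrite // eq_sym.
have [e6|n64] := eqVneq v6 v4.
  by subst v6; apply: Or44; right; split => //; repeat (apply/andP; split); rewrite // eq_sym.
by apply: Or41; repeat (apply/andP; split); rewrite // eq_sym.
Qed.

Lemma euclidean_linked_event_le : exists2 C : R, 0 < C &
  forall n disp (Omega : measurableType disp) (P : probability Omega R)
    (v : 'I_n -> {RV P >-> V}) (phi e : R),
  0 <= phi -> perturbed_instance phi v -> 0 < e ->
  (sample_law v (linked_event (@dist_L2 R d) e) <=
    (C * (n%:R ^+ 6 * phi ^+ 5 * e `^ (15 / 8) + n%:R ^+ 5 * phi ^+ 4 * Num.sqrt e ^+ 3))%:E)%E.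
Proof.
have [C1 C10 H1] := @euclidean_disjoint_le R d d2.
have [C2 C20 H2] := @euclidean_chain_le R d d2.
exists (C1 + 2 * C2) => [|n disp Omega P v phi e phi0 vP e0]; first by rewrite addr_gt0 ?mulr_gt0.
have mD := @measurable_dist_L2 R d.
pose ge := gain_event (n := n) (@dist_L2 R d) e.
have mge a b c e' f g : measurable (ge a b c e' f g) by exact: measurable_gain_event.
pose A1 (p : 'I_n * 'I_n * 'I_n * 'I_n * 'I_n * 'I_n) := gain_event6 (@dist_L2 R d) e p.
pose Q1 (p : 'I_n * 'I_n * 'I_n * 'I_n * 'I_n * 'I_n) :=
  let: (v1, v2, v3, v4, v5, v6) := p in uniq [:: v1; v2; v3; v4; v5; v6].
pose A2 (p : 'I_n * 'I_n * 'I_n * 'I_n * 'I_n) : set (n.-tuple V) :=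
  let: (v1, v2, v3, v4, w) := p in ge v1 v2 v3 v4 v2 w `|` ge v1 v2 v3 v4 w v2.
pose Q2 (p : 'I_n * 'I_n * 'I_n * 'I_n * 'I_n) :=
  let: (v1, v2, v3, v4, w) := p in uniq [:: v1; v2; v3; v4; w].
pose B1 := \bigcup_(p in [set p | Q1 p]) A1 p; pose B2 := \bigcup_(p in [set p | Q2 p]) A2 p.
have mA1 p : measurable (A1 p) by exact: measurable_gain_event6.
have mA2 p : measurable (A2 p).
  by case: p => [[[[v1 v2] v3] v4] w]; exact: measurableU.
have mB1 : measurable B1 by apply: fin_bigcup_measurable => //; exact: finite_finset.
have mB2 : measurable B2 by apply: fin_bigcup_measurable => //; exact: finite_finset.
have cover : linked_event (@dist_L2 R d) e `<=` B1 `|` B2.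
  move=> c [[[[[[v1 v2] v3] v4] v5] v6]] /linked_cases[u|[E u]|[E u]|[[E u]|[E u]]] h.
  - by left; exists (v1, v2, v3, v4, v5, v6).
  - by right; exists (v1, v2, v3, v4, v6) => //; left; rewrite E in h.
  - by right; exists (v1, v2, v3, v4, v5) => //; right; rewrite E in h.
  - right; exists (v3, v4, v1, v2, v6) => //; right.
    by move: h; rewrite E /= gain_event_swap.
  - right; exists (v3, v4, v1, v2, v5) => //; left.
    by move: h; rewrite E /= gain_event_swap.
set x := e `^ _; set y := Num.sqrt e ^+ 3.
have x0 : 0 <= x by exact: powR_ge0.
have y0 : 0 <= y by rewrite exprn_ge0 ?sqrtr_ge0.
have b1 : (sample_law v B1 <= (n%:R ^+ 6 * (phi ^+ 5 * (C1 * x)))%:E)%E.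
  have K0 : 0 <= phi ^+ 5 * (C1 * x) by rewrite !mulr_ge0 ?exprn_ge0 // ltW.
  have := @measure_finite_cover _ _ R (sample_law v) _ Q1 A1 B1 _ mA1 mB1 K0.
  rewrite !card_prod !card_ord.
  have -> : (n * n * n * n * n * n)%:R = n%:R ^+ 6 :> R by rewrite !natrM; ring.
  apply; first by move=> c [p hp h]; exists p.
  by move=> [[[[[v1 v2] v3] v4] v5] v6]; exact: H1.
have b2 : (sample_law v B2 <= (n%:R ^+ 5 * (phi ^+ 4 * (C2 * y) + phi ^+ 4 * (C2 * y)))%:E)%E.
  have K0 : 0 <= phi ^+ 4 * (C2 * y) + phi ^+ 4 * (C2 * y).
    by apply: addr_ge0; rewrite !mulr_ge0 ?exprn_ge0 // ltW.
  have := @measure_finite_cover _ _ R (sample_law v) _ Q2 A2 B2 _ mA2 mB2 K0.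
  rewrite !card_prod !card_ord.
  have -> : (n * n * n * n * n)%:R = n%:R ^+ 5 :> R by rewrite !natrM; ring.
  apply; first by move=> c [p hp h]; exists p.
  move=> [[[[v1 v2] v3] v4] w] u; have [h1 h2] := H2 _ _ _ _ _ _ _ _ _ _ _ _ phi0 vP e0 u.
  apply: (le_trans (measureU2 (sample_law v) (mge _ _ _ _ _ _) (mge _ _ _ _ _ _))).
  by rewrite EFinD; exact: leeD.
apply: (@le_trans _ _ (sample_law v (B1 `|` B2))).
  apply: le_measure; rewrite ?inE //; first exact: measurable_linked_event.
  exact: measurableU.
apply: (le_trans (measureU2 (sample_law v) mB1 mB2)).
apply: (le_trans (leeD b1 b2)); rewrite -EFinD lee_fin.
have X0 : 0 <= n%:R ^+ 6 * phi ^+ 5 * x by rewrite !mulr_ge0 ?exprn_ge0.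
have Y0 : 0 <= n%:R ^+ 5 * phi ^+ 4 * y by rewrite !mulr_ge0 ?exprn_ge0.
rewrite -subr_ge0.
have -> : (C1 + 2 * C2) * (n%:R ^+ 6 * phi ^+ 5 * x + n%:R ^+ 5 * phi ^+ 4 * y) -
  (n%:R ^+ 6 * (phi ^+ 5 * (C1 * x)) + n%:R ^+ 5 * (phi ^+ 4 * (C2 * y) + phi ^+ 4 * (C2 * y))) =
  2 * C2 * (n%:R ^+ 6 * phi ^+ 5 * x) + C1 * (n%:R ^+ 5 * phi ^+ 4 * y) by ring.
by rewrite addr_ge0 // mulr_ge0 // ?mulr_ge0 // ltW.
Qed.

Lemma powR_natM (a r : R) (m k : nat) : 0 <= a -> m%:R * r = k%:R ->
  (a ^+ m) `^ r = a ^+ k.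
Proof. by move=> a0 mr; rewrite -!powR_mulrn // -powRrM mr. Qed.

Lemma powR_third_exp (a : R) (m : nat) : 0 <= a -> (a `^ (1 / 3)) ^+ m = a `^ (m%:R / 3).
Proof. by move=> a0; rewrite -powR_mulrn ?powR_ge0 // -powRrM; congr (_ `^ _); field. Qed.

(** In a = N^(1/3), b = phi^(1/3) and s = 2^l one has e = D / x^2 with x = s a^5 b^4. The term of
    five vertices is balanced exactly, which fixes the scale. For six vertices, x^(15/4) contains
    b^15 exactly, a^(75/4) >= a^18 and s^(15/4) >= s^3. *)
Lemma euclidean_scaling (N phi D : R) l : 1 <= N -> 1 <= phi -> 0 < D ->
  let e := D * N / (4 ^+ l * (N `^ (4 + 1 / 3) * phi `^ (8 / 3))) in
  N ^+ 6 * phi ^+ 5 * e `^ (15 / 8) + N ^+ 5 * phi ^+ 4 * Num.sqrt e ^+ 3 <=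
  (D `^ (15 / 8) + Num.sqrt D ^+ 3) * (1 / 8) ^+ l.
Proof.
move=> N1 p1 D0 /=.
have N0 : 0 <= N by lra.
have p0 : 0 <= phi by lra.
set a := N `^ (1 / 3); set b := phi `^ (1 / 3); set s : R := 2 ^+ l.
have a1 : 1 <= a by rewrite -(powRr0 N) /a; apply: ler_powR => //; lra.
have b1 : 1 <= b by rewrite -(powRr0 phi) /b; apply: ler_powR => //; lra.
have s1 : 1 <= s by rewrite exprn_ege1 // ler1n.
have Na : N = a ^+ 3 by rewrite powR_third_exp // divff // powRr1.
have pb : phi = b ^+ 3 by rewrite powR_third_exp // divff // powRr1.
have -> : N `^ (4 + 1 / 3) = a ^+ 13 by rewrite powR_third_exp //; congr (_ `^ _); field.
have -> : phi `^ (8 / 3) = b ^+ 8 by rewrite powR_third_exp.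
have -> : 4 ^+ l = s ^+ 2 :> R by rewrite /s exprAC; congr (_ ^+ _); ring.
have -> : (1 / 8) ^+ l = (s ^+ 3)^-1 :> R.
  by rewrite /s exprAC -exprVn; congr (_ ^+ _); field.
rewrite Na pb; move: a b s a1 b1 s1 {Na pb} => a b s a1 b1 s1.
have a0 : 0 < a by lra.
have b0 : 0 < b by lra.
have s0 : 0 < s by lra.
set x := s * a ^+ 5 * b ^+ 4.
have x0 : 0 < x by rewrite !mulr_gt0 ?exprn_gt0.
have -> : D * a ^+ 3 / (s ^+ 2 * (a ^+ 13 * b ^+ 8)) = D / x ^+ 2.
  by rewrite /x; field; rewrite !gt_eqF.
rewrite [leRHS]mulrDl; apply: lerD; last first.
  have -> : Num.sqrt (D / x ^+ 2) = Num.sqrt D / x.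
    by rewrite sqrtrM ?ltW // sqrtrV ?exprn_ge0 ?(ltW x0) // sqrtr_sqr ger0_norm // ltW.
  have -> : (a ^+ 3) ^+ 5 * (b ^+ 3) ^+ 4 * (Num.sqrt D / x) ^+ 3 = Num.sqrt D ^+ 3 / s ^+ 3.
    by rewrite /x; field; rewrite !gt_eqF.
  by [].
rewrite ler_pdivlMr ?exprn_gt0 //.
have e0 : 0 <= (D / x ^+ 2) `^ (15 / 8) by exact: powR_ge0.
have -> : D `^ (15 / 8) = (D / x ^+ 2) `^ (15 / 8) * x `^ (15 / 4).
  have -> : x `^ (15 / 4) = (x ^+ 2) `^ (15 / 8).
    by rewrite -powR_mulrn ?ltW // -powRrM; congr (_ `^ _); field.
  rewrite -powRM ?divr_ge0 ?exprn_ge0 ?(ltW D0) ?(ltW x0) // divfK //.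
  by rewrite gt_eqF ?exprn_gt0.
have hx : s ^+ 3 * a ^+ 18 * b ^+ 15 <= x `^ (15 / 4).
  have h1 : s ^+ 3 <= s `^ (15 / 4).
    by rewrite -[s ^+ 3]powR_mulrn ?(ltW s0) //; apply: ler_powR => //; lra.
  have h2 : a ^+ 18 <= (a ^+ 5) `^ (15 / 4).
    rewrite -(@powR_natM a (18 / 5) 5 18 (ltW a0)); last by field.
    by apply: ler_powR; rewrite ?exprn_ege1 //; lra.
  have h3 : b ^+ 15 = (b ^+ 4) `^ (15 / 4).
    by rewrite (@powR_natM b (15 / 4) 4 15 (ltW b0)); last by field.
  have a5 : 0 <= a ^+ 5 by rewrite exprn_ge0 // ltW.
  have b4 : 0 <= b ^+ 4 by rewrite exprn_ge0 // ltW.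
  rewrite /x (powRM _ (mulr_ge0 (ltW s0) a5) b4) (powRM _ (ltW s0) a5) -h3.
  apply: ler_wpM2r; first by rewrite exprn_ge0 // ltW.
  by apply: ler_pM => //; rewrite exprn_ge0 // ltW.
have := ler_wpM2l e0 hx; rewrite -(exprM a) -(exprM b); set E := _ `^ _.
have -> : E * (s ^+ 3 * a ^+ 18 * b ^+ 15) = a ^+ 18 * b ^+ 15 * E * s ^+ 3 by ring.
by [].
Qed.

Lemma euclidean_expectation : exists2 C : R, 0 <= C &
    forall (n : nat) (phi : R) (disp : measure_display)
      (Omega : measurableType disp) (P : probability Omega R)
      (v : 'I_n -> {RV P >-> d.-tuple R}),
      (2 < n)%N -> 1 <= phi -> perturbed_instance phi v ->
      ('E_P[longest_2opt_path (@dist_L2 R d) v]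
         <= (C * (n%:R `^ (4 + 1 / 3) * phi `^ (8 / 3)))%:E)%E.
Proof.
have [C C0 H] := euclidean_linked_event_le.
have d0 : 0 < d%:R :> R by rewrite ltr0n ltnW.
set D : R := 12 * d%:R.
have D0 : 0 < D by rewrite mulr_gt0.
set K := C * (D `^ (15 / 8) + Num.sqrt D ^+ 3).
have K0 : 0 <= K by rewrite mulr_ge0 ?addr_ge0 ?powR_ge0 ?exprn_ge0 ?sqrtr_ge0 // ltW.
exists (1 + 8 * K) => [|n phi disp Omega P v n2 phi1 vP];
  first exact: (addr_ge0 ler01 (mulr_ge0 (ler0n _ _) K0)).
have phi0 : 0 < phi by apply: lt_le_trans phi1.
have n3 : 3 <= n%:R :> R by rewrite ler_nat.
have nr0 : 0 < n%:R :> R by apply: lt_le_trans n3.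
have n1 : 1 <= n%:R :> R by lra.
set t0 := n%:R `^ (4 + 1 / 3) * phi `^ (8 / 3).
have t00 : 0 < t0 by rewrite mulr_gt0 ?powR_gt0.
rewrite mulrC.
apply: (expectation_longest_path_le (@dist_L2C R d) (@dist_L2_ge0 R d) (@dist_L2_cube R d)
  (@measurable_dist_L2 R d) (ltW phi0) vP) => //.
- have p1 : 1 <= phi `^ (8 / 3) by rewrite -[leLHS](powRr0 phi); apply: ler_powR => //; lra.
  apply: lt_le_trans (_ : n%:R `^ (4 + 1 / 3) <= _); last by rewrite ler_peMr // powR_ge0.
  apply: lt_le_trans (_ : n%:R ^+ 4 <= _); last first.
    by rewrite -powR_mulrn ?(ltW nr0) //; apply: ler_powR => //; lra.
  rewrite exprSr ltr_pM2r //; apply: lt_le_trans (_ : 3 ^+ 3 <= _); first by lra.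
  by rewrite lerXn2r // nnegrE ltW.
- exact: ltnW (ltnW n2).
- exact: ltnW.
move=> l.
have -> : 12 * n%:R * d%:R / (4 ^+ l * t0) = D * n%:R / (4 ^+ l * t0).
  by rewrite /D [12 * n%:R * _]mulrAC.
set e := D * n%:R / _.
have e0 : 0 < e by apply: divr_gt0; apply: mulr_gt0 => //; rewrite exprn_gt0.
apply: (le_trans (H _ _ _ _ _ _ _ (ltW phi0) vP e0)); rewrite lee_fin /K -[leRHS]mulrA.
by apply: ler_wpM2l; [exact: ltW|exact: euclidean_scaling].
Qed.

End Euclidean.

Lemma expectation_small (R : realType) (d n : nat) (disp : measure_display)
  (Omega : measurableType disp) (P : probability Omega R)
  (v : 'I_n -> {RV P >-> d.-tuple R}) dist : (n <= 2)%N ->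
  ('E_P[longest_2opt_path dist v] = 0)%E.
Proof.
move=> n2; rewrite unlock (eq_integral (fun=> 0%E)) ?integral0 // => w _.
have := longest_path_le (two_opt_arc dist (fun i => v i w)).
by rewrite /longest_2opt_path card_tour_small // leqn0 => /eqP ->.
Qed.

Theorem theorem2 (R : realType) (d : nat) (hd : (2 <= d)%N) :
  (exists C : R,
    forall (n : nat) (phi : R) (disp : measure_display)
      (Omega : measurableType disp) (P : probability Omega R)
      (v : 'I_n -> {RV P >-> d.-tuple R}),
      (0 < n)%N -> 1 <= phi -> perturbed_instance phi v ->
      ('E_P[longest_2opt_path (@dist_L1 R d) v]
         <= (C * (n%:R ^+ 4 * phi))%:E)%E)
  /\
  (exists C : R,
    forall (n : nat) (phi : R) (disp : measure_display)
      (Omega : measurableType disp) (P : probability Omega R)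
      (v : 'I_n -> {RV P >-> d.-tuple R}),
      (0 < n)%N -> 1 <= phi -> perturbed_instance phi v ->
      ('E_P[longest_2opt_path (@dist_L2 R d) v]
         <= (C * (n%:R `^ (4 + 1 / 3) * ln (n%:R * phi) * phi `^ (8 / 3)))%:E)%E).
Proof.
split.
  have [C C0 H] := manhattan_expectation R d.
  exists C => n phi disp Omega P v n0 phi1 vP.
  have [n2|n2] := leqP n 2; last exact: H (ltnW hd) phi1 vP.
  by rewrite expectation_small // lee_fin !mulr_ge0 ?exprn_ge0 //; lra.
have [C C0 H] := euclidean_expectation R hd.
have ln2 : 0 < ln 2 :> R by rewrite ln_gt0 // ltr1n.
(* For n >= 3 the quotient ln (n phi) / ln 2 is at least 1 and supplies the logarithm. For n <= 2
   there is no tour, so the expectation is 0. *)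
exists (C / ln 2) => n phi disp Omega P v n0 phi1 vP.
have nr : 1 <= n%:R :> R by rewrite ler1n.
have np : 1 <= n%:R * phi by rewrite -[leLHS]mulr1; apply: ler_pM.
have [n2|n2] := leqP n 2.
  rewrite expectation_small // lee_fin.
  apply: mulr_ge0; first by apply: divr_ge0 => //; exact: ltW.
  by apply: mulr_ge0; rewrite ?powR_ge0 // mulr_ge0 ?powR_ge0 ?ln_ge0.
apply: (le_trans (H _ _ _ _ _ _ n2 phi1 vP)); rewrite lee_fin.
have np2 : 2 <= n%:R * phi.
  by rewrite -[leLHS]mulr1; apply: ler_pM => //; rewrite ler_nat ltnW.
have lnp : ln 2 <= ln (n%:R * phi) by rewrite ler_ln // posrE; lra.
apply: (@le_trans _ _ (C * (n%:R `^ (4 + 1 / 3) * phi `^ (8 / 3)) * (ln (n%:R * phi) / ln 2))).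
  by rewrite ler_peMr ?ler_pdivlMr ?mul1r // !mulr_ge0 ?powR_ge0.
by rewrite le_eqVlt; apply/orP; left; apply/eqP; field; rewrite gt_eqF.
Qed.
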